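(* Let $C$ be a tropical curve of genus $g$. The map $\gamma\mapsto\mathcal K_\gamma$ from $H_1(C,\mathbb Z/2\mathbb Z)$ to the set of theta characteristics of $C$ is an isomorphism of affine $\mathbb Z/2\mathbb Z$-lattices (i.e. it is a bijection, and $\gamma\mapsto\mathcal K_\gamma-\mathcal K_0$ is a group isomorphism onto the group $\frac12\Lambda/\Lambda$ of 2-torsion points of $J(C)\cong\operatorname{Pic}^0(C)$, under which the set of theta characteristics is a torsor). Among all the classes $\mathcal K_\gamma$, $\gamma\in H_1(C,\mathbb Z/2\mathbb Z)$, only $\mathcal K_0=-\kappa$ is not the class of an effective divisor (i.e. divisors in this class are not linearly equivalent to an effective divisor).
   Context: **Tropical curves.** Let $\Gamma$ be a connected finite graph and $\mathcal V_1(\Gamma)$ its set of 1-valent vertices. $\Gamma$ is a metric graph if $\Gamma\setminus\mathcal V_1(\Gamma)$ is given a complete metric structure and $\Gamma$ is its compactification (so all leaves have infinite length). Introducing a new two-valent vertex in the interior of an edge gives an equivalent metric graph; a tropical curve $C$ is an equivalence class of such graphs. Its genus is $g=b_1(\Gamma)$. For $p\in C$, $\operatorname{val}(p)$ is the valence of $p$. **Divisors.** A divisor is a finite formal sum $D=\sum a_ip_i$ with $a_i\in\mathbb Z$, $p_i\in C$; $\deg D=\sum a_i$; $D$ is effective ($D\ge 0$) if all $a_i\ge0$. For a piecewise linear function $f$ on $C$ with integral slopes (finitely many linear pieces, infinite values being allowed at the ends of leaves), $(f)=\sum_{p\in C}\big(\sum_{i=1}^{\operatorname{val}(p)}\frac{\partial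 f(p)}{\partial\xi_i}\big)p$, where $\xi_i$ are the outward primitive (unit) tangent vectors at $p$; such divisors are called principal. $D_1\sim D_2$ (linear equivalence) means $D_1-D_2$ is principal. $\operatorname{Pic}^d(C)$ is the set of degree $d$ divisors modulo $\sim$. The canonical divisor is $K=\sum_{p\in C}(\operatorname{val}(p)-2)p$, of degree $2g-2$. **Jacobian.** Let $\operatorname{Aff}$ be the sheaf of local PL functions $f$ with integral slopes and $(f)=0$; the sheaf $\mathcal T^*_{\mathbb Z}$ is defined by the exact sequence $0\to\mathbb R\to\operatorname{Aff}\to\mathcal T^*_{\mathbb Z}\to0$. The rank $g$ lattice of 1-forms $\Omega_{\mathbb Z}(C)$ is the group of global sections of $\mathcal T_{\mathbb Z}^*$. $\Omega(C)^*$ is the vector space of $\mathbb R$-valued linear functionals on $\Omega_{\mathbb Z}(C)$; $\Lambda\subset\Omega(C)^*$ is the lattice given by $H_1(C,\mathbb Z)$ acting by integration. The Jacobian is $J(C)=\Omega(C)^*/\Lambda$. Fix $p_0\in C$. The Abel–Jacobi map $\mu^d$ sends a degree $d$ divisor $\sum a_ip_i$ to the class in $J(C)$ of $\omega\mapsto\sum a_i\int_{p_0}^{p_i}\omega$. By the tropical Abel–Jacobi theorem, $\mu^d$ factors through a bijection $\phi:\operatorname{Pic}^d(C)\to J(C)$ for each $d$; for $d=0$ it is independent of $p_0$ and is used to identify $\operatorname{Pic}^0(C)$ with $J(C)$. Write $\mu=\mu^1|_C:C\to J(C)$. **Theta function, $\kappa$ and $\mathcal K_0$.** Let $Q$ be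 the symmetric positive definite bilinear form on $\Omega(C)^*$ determined by the metric, $Q(\ell,\ell)=\operatorname{length}(\ell)$ on simple cycles $\ell$ (for cycles $\lambda=\sum a_ee$, $\lambda'=\sum b_ee$ over oriented edges, $Q(\lambda,\lambda')=\sum a_eb_e\operatorname{length}(e)$). Put $\Theta(x)=\max_{\lambda\in\Lambda}\{Q(\lambda,x)-\frac12Q(\lambda,\lambda)\}$ for $x\in\Omega(C)^*$. Its corner locus descends to the theta divisor $[\Theta]\subset J(C)$. For $\lambda\in J(C)$ let $[\Theta_\lambda]=[\Theta]+\lambda$ and let $D_\lambda=\mu^*[\Theta_\lambda]$ be its pull-back to $C$, an effective divisor of degree $g$ (locally the divisor of $x\mapsto\Theta(\tilde\mu(x)-\tilde\lambda)$ for lifts $\tilde\mu,\tilde\lambda$ of $\mu,\lambda$ to $\Omega(C)^*$). By tropical Jacobi inversion there is a universal $\kappa$ such that $\mu^g(D_\lambda)+\kappa=\lambda$ for all $\lambda\in J(C)$. Let $\mathcal K_0=-\kappa$, that is, the class in $\operatorname{Pic}^{g-1}(C)$ with $\phi(\mathcal K_0)=-\kappa$; it satisfies $2\mathcal K_0=[K]$ in $\operatorname{Pic}^{2g-2}(C)$. **Theta characteristics.** A theta characteristic is a class $\mathcal K\in\operatorname{Pic}^{g-1}(C)$ with $2\mathcal K=[K]$ in $\operatorname{Pic}^{2g-2}(C)$ (equivalently $2\phi(\mathcal K)=\mu^{2g-2}(K)$). **The classes $\mathcal K_\gamma$.** For $\gamma=0\in H_1(C,\mathbb Z/2\mathbb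 Z)$, $\mathcal K_\gamma$ is the class $\mathcal K_0$ above. For non-trivial $\gamma\in H_1(C,\mathbb Z/2\mathbb Z)$ choose a simple representative $\bar\gamma\in H_1(C,\mathbb Z)$, i.e. an integral cycle reducing to $\gamma$ mod 2 and containing any edge of $C$ with multiplicity at most one (in absolute value). Let $|\gamma|$ be the support of $\bar\gamma$; it depends only on $\gamma$. Let $d_\gamma(x)=\operatorname{dist}(|\gamma|,x)$. Orient the edges of (a suitable graph representing) $C$ as follows: edges outside $|\gamma|$ by the gradient flow of $d_\gamma$ (direction of increasing $d_\gamma$), edges in $|\gamma|$ by the cyclic orientation of $\bar\gamma$. For $p\in C$ let $\operatorname{val}_+(p)$, $\operatorname{val}_-(p)$ be the numbers of outgoing, respectively incoming, edges at $p$, and set $\mathcal K^\pm_\gamma=\sum_{p\in C}(\operatorname{val}_\pm(p)-1)p$. These divisors have degree $g-1$, depend only on $\gamma$, and satisfy $\mathcal K_\gamma^++\mathcal K_\gamma^-=K$ and $\mathcal K_\gamma^+-\mathcal K_\gamma^-=(d_\gamma)$; $\mathcal K_\gamma\in\operatorname{Pic}^{g-1}(C)$ denotes their common class, which is a theta characteristic. *)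

(* Defs.v *)
From HB Require Import structures.
From mathcomp Require Import all_boot all_order all_algebra.
From mathcomp Require Import freeg ring.
From mathcomp Require Import mathcomp_extra boolp classical_sets functions.
From mathcomp Require Import cardinality fsbigop reals constructive_ereal ereal.

Set Implicit Arguments.
Unset Strict Implicit.
Unset Printing Implicit Defensive.

Import Order.TTheory GRing.Theory Num.Theory.
Local Open Scope classical_set_scope.
Local Open Scope ring_scope.
Local Open Scope quotient_scope.

(* Finite connected multigraphs; loops and multiple edges are allowed, and the
   orientation src -> tgt of an edge is only an auxiliary choice. *)
Record graph := Graph {
  vert : finType;
  edge : finType;
  src : edge -> vert;
  tgt : edge -> vert;
  graph_nonempty : (0 < #|vert|)%N;
  graph_connected : forall u v : vert,
    connect (fun x y => [exists e, ((src e == x) && (tgt e == y))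
                                || ((src e == y) && (tgt e == x))]) u v
}.

(* The half-edge (e, true) starts at src e, (e, false) starts at tgt e. *)
Definition hend (G : graph) (h : edge G * bool) : vert G :=
  if h.2 then src h.1 else tgt h.1.

Definition vvalence (G : graph) (v : vert G) : nat :=
  #|[pred h : edge G * bool | hend h == v]|.

(* A graph representing a tropical curve.  The edge e is a copy of the interval
   [lo e, hi e] of extended reals, with lo e glued to src e and hi e to tgt e.
   The 1-valent vertices are exactly the points at infinity. *)
Record tropCurve (R : realType) := TropCurve {
  tgraph :> graph;
  lo : edge tgraph -> \bar R;
  hi : edge tgraph -> \bar R;
  lo_lt_hi : forall e, (lo e < hi e)%E;
  lo_infinite : forall e, (lo e == -oo%E) = (vvalence (src e) == 1%N);
  hi_infinite : forall e, (hi e == +oo%E) = (vvalence (tgt e) == 1%N)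
}.

Section Curve.
Variables (R : realType) (C : tropCurve R).
Local Notation V := (vert C).
Local Notation E := (edge C).

Definition ept := {x : E * R | (lo x.1 < x.2%:E < hi x.1)%E}.

(* A point is a vertex or a point in the interior of an edge. *)
Definition Point := (V + ept)%type.

(* The gluing map [lo e, hi e] -> C. *)
Definition epoint (e : E) (x : \bar R) : Point :=
  if (x <= lo e)%E then inl (src e)
  else if (hi e <= x)%E then inl (tgt e)
  else oapp (fun u : ept => inr u) (inl (src e)) (insub (e, fine x)).

(* A unit tangent vector is a triple (e, a, d): it is based at the point of
   coordinate a on the edge e and points to increasing coordinates iff d. *)
Definition tangent := (E * \bar R * bool)%type.

Definition tangents (p : Point) : seq tangent :=
  match p with
  | inl v => [seq (h.1, if h.2 then lo h.1 else hi h.1, h.2)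
                | h <- enum [pred h : E * bool | hend h == v]]
  | inr u => [:: ((val u).1, (val u).2%:E, true);
                 ((val u).1, (val u).2%:E, false)]
  end.

Definition valence (p : Point) : nat := size (tangents p).

(* At an infinite coordinate the product is taken in \bar R with 0 * oo = 0,
   which is continuity at the end of a leaf. *)
Definition affine_on (g : \bar R -> \bar R) (a b : \bar R) (s : int) :=
  exists c : R, forall x, (a <= x <= b)%E -> (g x = (s%:~R)%:E * x + c%:E)%E.

Definition has_slope (g : \bar R -> \bar R) (a : \bar R) (d : bool) (s : int) :=
  exists b, if d then (a < b)%E /\ affine_on g a b s
            else (b < a)%E /\ affine_on g b a (- s).

(* The derivative of g at a in the direction d. *)
Definition slope (g : \bar R -> \bar R) (a : \bar R) (d : bool) : int :=
  xget 0 [set s | has_slope g a d s].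

(* Piecewise linear functions with integral slopes: on every edge, f is affine
   away from a finite set B of breakpoints. *)
Definition is_PL (f : Point -> \bar R) : Prop :=
  (forall p, valence p != 1%N -> f p \is a fin_num) /\
  (forall e : E, exists B : seq (\bar R), forall a b,
     (lo e <= a)%E -> (a < b)%E -> (b <= hi e)%E ->
     (forall x, x \in B -> ~~ (a < x < b)%E) ->
     exists s, affine_on (f \o epoint e) a b s).

Definition order_at (f : Point -> \bar R) (p : Point) : int :=
  \sum_(t <- tangents p) let: (e, a, d) := t in slope (f \o epoint e) a d.

Definition Div := {freeg Point / int}.

Definition effective (D : Div) : Prop := forall p, 0 <= coeff p D.

Definition canonical_div : Div :=
  \sum_(p \in [set: Point]) << (valence p)%:Z - 2 *g p >>.

Definition principal : {pred Div} := fun D =>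
  `[< exists2 f, is_PL f & forall p, coeff p D = order_at f p >].

Lemma er_dense (a b : \bar R) : (a < b)%E -> exists r : R, (a < r%:E < b)%E.
Proof.
case: a b => [a| |] [b| |] //.
- by rewrite lte_fin => ab; exists ((a + b) / 2); rewrite !lte_fin !midf_lt.
- by move=> _; exists (a + 1); rewrite ltry lte_fin ltrDl ltr01.
- by move=> _; exists (b - 1); rewrite ltNyr lte_fin gtrBl ltr01.
- by move=> _; exists 0; rewrite ltNyr ltry.
Qed.

Lemma affine_uniq (g : \bar R -> \bar R) a b (s1 s2 : int) (c1 c2 : R) :
  (a < b)%E ->
  (forall x, (a < x < b)%E -> (g x = (s1%:~R)%:E * x + c1%:E)%E) ->
  (forall x, (a < x < b)%E -> (g x = (s2%:~R)%:E * x + c2%:E)%E) ->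
  s1 = s2 /\ c1 = c2.
Proof.
move=> ab h1 h2.
have [x /andP[ax xb]] := er_dense ab.
have [y /andP[xy yb]] := er_dense xb.
have gx := h1 x%:E; rewrite h2 ?ax ?xb // in gx; have {gx} := gx isT.
have gy := h1 y%:E; rewrite h2 ?(lt_trans ax xy) ?yb // in gy.
have {gy} := gy isT.
rewrite lte_fin in xy.
move=> [Ey] [Ex].
have Es : (s1%:~R - s2%:~R) * (y - x) = 0 :> R.
  have -> : (s1%:~R - s2%:~R) * (y - x) =
    (s1%:~R * y + c1 - (s2%:~R * y + c2))
    - (s1%:~R * x + c1 - (s2%:~R * x + c2)) :> R by ring.
  by rewrite Ex Ey !subrr.
have s12 : s1 = s2.
  move/eqP: Es; rewrite mulf_eq0 !subr_eq0 (gt_eqF xy) orbF => /eqP.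
  exact: intr_inj.
by split=> //; move: Ex; rewrite s12 => /addrI ->.
Qed.

Lemma gapr (B : seq (\bar R)) a h : (a < h)%E ->
  exists r, [/\ (a < r)%E, (r <= h)%E & forall x, x \in B -> ~~ (a < x < r)%E].
Proof.
move=> ah; elim: B => [|y B [r [ar rh IH]]]; first by exists h.
case: (boolP (a < y < r)%E) => [/andP[ay yr]|nyr].
  exists y; split=> //; first exact: le_trans (ltW yr) rh.
  move=> x; rewrite inE => /orP[/eqP->|/IH]; first by rewrite ltxx andbF.
  by apply: contra => /andP[-> /lt_trans ->].
by exists r; split=> // x; rewrite inE => /orP[/eqP->|/IH].
Qed.

Lemma gapl (B : seq (\bar R)) a h : (h < a)%E ->
  exists r, [/\ (r < a)%E, (h <= r)%E & forall x, x \in B -> ~~ (r < x < a)%E].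
Proof.
move=> ah; elim: B => [|y B [r [ar rh IH]]]; first by exists h.
case: (boolP (r < y < a)%E) => [/andP[ry ya]|nyr].
  exists y; split=> //; first exact: le_trans rh (ltW ry).
  move=> x; rewrite inE => /orP[/eqP->|/IH]; first by rewrite ltxx.
  by apply: contra => /andP[yx ->]; rewrite (lt_trans ry yx).
by exists r; split=> // x; rewrite inE => /orP[/eqP->|/IH].
Qed.

Lemma epoint_lo e x : (x <= lo e)%E -> epoint e x = inl (src e).
Proof. by rewrite /epoint => ->. Qed.

Lemma epoint_hi e x : (hi e <= x)%E -> epoint e x = inl (tgt e).
Proof.
move=> hx; rewrite /epoint leNgt (lt_le_trans (lo_lt_hi e) hx) /=.
by rewrite hx.
Qed.

Lemma epoint_in e (x : R) (h : (lo e < x%:E < hi e)%E) :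
  epoint e x%:E = inr (exist (fun z : E * R => (lo z.1 < z.2%:E < hi z.1)%E) (e, x) h).
Proof.
have /andP[h1 h2] := h; rewrite /epoint !leNgt h1 h2 /=.
by rewrite (@insubT _ (fun z : E * R => (lo z.1 < z.2%:E < hi z.1)%E) _ (e, x) h).
Qed.

Lemma tangentsP p e a d : (e, a, d) \in tangents p ->
  epoint e a = p /\
  if d then (lo e <= a < hi e)%E else (lo e < a <= hi e)%E.
Proof.
case: p => [v|[[e0 x] h]] /=.
  case/mapP=> [[e1 d1]]; rewrite mem_enum inE /= => /eqP <- [-> -> ->] /=.
  case: d1; first by rewrite epoint_lo // lexx lo_lt_hi.
  by rewrite epoint_hi // lexx lo_lt_hi.
have /andP[h1 h2] := h.
rewrite !inE => /orP[] /eqP[-> -> ->]; rewrite (epoint_in h); split=> //.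
  by rewrite h2 ltW.
by rewrite h1 ltW.
Qed.

Lemma tangents_lo e : (e, lo e, true) \in tangents (inl (src e)).
Proof. by apply/mapP; exists (e, true); rewrite // mem_enum inE. Qed.

Lemma tangents_hi e : (e, hi e, false) \in tangents (inl (tgt e)).
Proof. by apply/mapP; exists (e, false); rewrite // mem_enum inE. Qed.

Lemma valence_inl v : valence (inl v) = vvalence v.
Proof. by rewrite /valence size_map -cardE. Qed.

Definition aff (f : Point -> \bar R) (e : E) l r (s : int) (c : R) :=
  forall x, (l <= x <= r)%E -> f (epoint e x) = ((s%:~R)%:E * x + c%:E)%E.

Definition biaff (f1 f2 : Point -> \bar R) (t : tangent) s1 c1 s2 c2 := exists l r,
  [/\ (l < r)%E, t.1.2 = (if t.2 then l else r), (lo t.1.1 <= l)%E &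
      (r <= hi t.1.1)%E] /\ aff f1 t.1.1 l r s1 c1 /\ aff f2 t.1.1 l r s2 c2.

Lemma biaff_ex f1 f2 p t : is_PL f1 -> is_PL f2 -> t \in tangents p ->
  exists s1 c1 s2 c2, biaff f1 f2 t s1 c1 s2 c2.
Proof.
case: t => [[e a] d] [_ /(_ e)[B1 P1]] [_ /(_ e)[B2 P2]] /tangentsP[_].
case: d => /andP[h1 h2].
  have [r [ar rh Br]] := gapr (B1 ++ B2) h2.
  have [|s1 [c1 F1]] := P1 a r h1 ar rh.
    by move=> x xB; apply: Br; rewrite mem_cat xB.
  have [|s2 [c2 F2]] := P2 a r h1 ar rh.
    by move=> x xB; apply: Br; rewrite mem_cat xB orbT.
  by exists s1, c1, s2, c2, a, r.
have [l [la hl Bl]] := gapl (B1 ++ B2) h1.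
have [|s1 [c1 F1]] := P1 l a hl la h2.
  by move=> x xB; apply: Bl; rewrite mem_cat xB.
have [|s2 [c2 F2]] := P2 l a hl la h2.
  by move=> x xB; apply: Bl; rewrite mem_cat xB orbT.
by exists s1, c1, s2, c2, l, a.
Qed.

Lemma aff_uniq f e l r l' r' (d : bool) s c s' c' :
  (l < r)%E -> (l' < r')%E ->
  (if d then l else r) = (if d then l' else r') ->
  aff f e l r s c -> aff f e l' r' s' c' -> s = s' /\ c = c'.
Proof.
move=> lr lr' + F F'; case: d => [ll|rr].
  subst l'; apply: (@affine_uniq (f \o epoint e) l (Order.min r r')).
  - by rewrite lt_min lr.
  - move=> x; rewrite lt_min => /and3P[h1 h2 h3]; apply: F.
    by rewrite !ltW.
  - move=> x; rewrite lt_min => /and3P[h1 h2 h3]; apply: F'.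
    by rewrite !ltW.
subst r'; apply: (@affine_uniq (f \o epoint e) (Order.max l l') r).
- by rewrite gt_max lr.
- move=> x; rewrite gt_max => /andP[/andP[h1 h2] h3]; apply: F.
  by rewrite !ltW.
- move=> x; rewrite gt_max => /andP[/andP[h1 h2] h3]; apply: F'.
  by rewrite !ltW.
Qed.

Lemma slope_aff f e a d l r s c : (l < r)%E -> a = (if d then l else r) ->
  aff f e l r s c -> slope (f \o epoint e) a d = (if d then s else - s).
Proof.
move=> lr -> F; apply: xget_unique.
  by case: d; [exists r|exists l]; split=> //; exists c; rewrite ?opprK.
move=> s' [b]; case: d => -[lb [c' F']].
  by have [] := aff_uniq (d := true) lb lr erefl F' F.
have [] := aff_uniq (d := false) lb lr erefl F' F.
by move=> <- _; rewrite opprK.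
Qed.

Lemma PL_diff f1 f2 : is_PL f1 -> is_PL f2 ->
  exists2 h, is_PL h & forall p, order_at h p = order_at f1 p - order_at f2 p.
Proof.
move=> P1 P2.
pose end_val (v : V) : set (\bar R) := [set y | exists t s1 c1 s2 c2,
  [/\ t \in tangents (inl v), biaff f1 f2 t s1 c1 s2 c2 &
      y = (((s1 - s2)%:~R)%:E * t.1.2 + (c1 - c2)%:E)%E]].
pose h p := match p with
  | inl v => if vvalence v == 1%N then xget 0%E (end_val v)
             else (f1 p - f2 p)%E
  | inr u => (f1 p - f2 p)%E
  end.
have h_fin p : valence p != 1%N -> h p = (f1 p - f2 p)%E.
  by case: p => [v|u] //; rewrite valence_inl /h => /negbTE ->.
have aff_h e l r s1 c1 s2 c2 : (lo e <= l)%E -> (l < r)%E -> (r <= hi e)%E ->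
    aff f1 e l r s1 c1 -> aff f2 e l r s2 c2 ->
    aff h e l r (s1 - s2) (c1 - c2).
  move=> hl lr hr F1 F2.
  have end_h t v : t \in tangents (inl v) -> vvalence v = 1%N ->
      biaff f1 f2 t s1 c1 s2 c2 ->
      h (inl v) = (((s1 - s2)%:~R)%:E * t.1.2 + (c1 - c2)%:E)%E.
    move=> tv v1 Bt; rewrite /h v1 eqxx; apply: xget_unique.
      by exists t, s1, c1, s2, c2.
    move=> y [t' [s1' [c1' [s2' [c2' [t'v Bt' ->]]]]]].
    have tt' : t' = t.
      have := valence_inl v; rewrite v1 /valence.
      case: (tangents (inl v)) tv t'v => [|t0 [|]] //.
      by rewrite !inE => /eqP -> /eqP ->.
    subst t'.
    move: Bt Bt' => [l0 [r0 [[lr0 E0 _ _] [A1 A2]]]].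
    move=> [l1 [r1 [[lr1 E1 _ _] [A1' A2']]]].
    have EE := etrans (esym E0) E1.
    have [-> ->] := aff_uniq lr0 lr1 EE A1 A1'.
    by have [-> ->] := aff_uniq lr0 lr1 EE A2 A2'.
  have fin_h (x : R) : (l <= x%:E <= r)%E -> valence (epoint e x%:E) != 1%N ->
      h (epoint e x%:E) = (((s1 - s2)%:~R)%:E * x%:E + (c1 - c2)%:E)%E.
    move=> xlr vx; rewrite h_fin // (F1 _ xlr) (F2 _ xlr).
    by rewrite -!EFinM -!EFinD intrB; congr (_%:E); ring.
  move=> x xlr; have /andP[lx xr] := xlr.
  have [xlo|xlo] := leP x (lo e).
    have Ex : x = lo e by apply/eqP; rewrite eq_le xlo (le_trans hl lx).
    have El : l = lo e by apply/eqP; rewrite eq_le hl -Ex lx.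
    case: (eqVneq (vvalence (src e)) 1%N) => v1.
      rewrite epoint_lo // (end_h _ _ (tangents_lo e) v1) /= ?Ex //.
      by exists l, r; rewrite El in lr F1 F2 *.
    have := lo_infinite e; rewrite (negbTE v1) -Ex => xNy.
    clear lx xr; case: x xlr xlo Ex xNy => [x| |] xlr xlo Ex // _.
      by rewrite fin_h // epoint_lo // valence_inl.
    by move: (lo_lt_hi e); rewrite -Ex ltNge leey.
  have [xhi|xhi] := leP (hi e) x.
    have Ex : x = hi e by apply/eqP; rewrite eq_le xhi (le_trans xr hr).
    have Er : r = hi e by apply/eqP; rewrite eq_le hr -Ex xr.
    case: (eqVneq (vvalence (tgt e)) 1%N) => v1.
      rewrite epoint_hi // (end_h _ _ (tangents_hi e) v1) /= ?Ex //.
      by exists l, r; rewrite Er in lr F1 F2 *.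
    have := hi_infinite e; rewrite (negbTE v1) -Ex => xNy.
    clear lx xr; case: x xlr xlo xhi Ex xNy => [x| |] xlr xlo xhi Ex // _.
      by rewrite fin_h // epoint_hi // valence_inl.
    by move: xlo; rewrite ltNge leNye.
  clear lx xr; case: x xlr xlo xhi => [x| |] xlr xlo xhi.
  - have hx : (lo e < x%:E < hi e)%E by rewrite xlo xhi.
    by rewrite fin_h // (epoint_in hx).
  - by move: xhi; rewrite ltNge leey.
  - by move: xlo; rewrite ltNge leNye.
exists h.
  split=> [p v1|e].
    by rewrite h_fin // fin_numB (P1.1 _ v1) (P2.1 _ v1).
  have [B1 Q1] := P1.2 e; have [B2 Q2] := P2.2 e.
  exists (B1 ++ B2) => a b la ab bh nB.
  have [|s1 [c1 F1]] := Q1 a b la ab bh.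
    by move=> x xB; apply: nB; rewrite mem_cat xB.
  have [|s2 [c2 F2]] := Q2 a b la ab bh.
    by move=> x xB; apply: nB; rewrite mem_cat xB orbT.
  by exists (s1 - s2), (c1 - c2); apply: aff_h.
move=> p; rewrite /order_at -sumrB big_seq [RHS]big_seq; apply: eq_bigr => t tp.
have [s1 [c1 [s2 [c2 [l [r [[lr Ea ll rr] [F1 F2]]]]]]]] := biaff_ex P1 P2 tp.
case: t tp Ea ll rr F1 F2 => [[e a] d] /= tp Ea ll rr F1 F2.
rewrite (slope_aff lr Ea F1) (slope_aff lr Ea F2).
rewrite (slope_aff lr Ea (aff_h _ _ _ _ _ _ _ ll lr rr F1 F2)).
by case: d {tp Ea} => //; rewrite opprB opprK addrC.
Qed.

Lemma principal_zmod_closed : zmod_closed principal.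
Proof.
have P0 : is_PL (fun=> 0%E).
  split=> // e; exists [::] => a b _ _ _ _; exists 0, 0 => x _ /=.
  by rewrite mul0e add0e.
have closedB : {in principal &, forall D1 D2, D1 - D2 \in principal}.
  move=> D1 D2 /asboolP[f1 P1 E1] /asboolP[f2 P2 E2].
  have [h Ph Eh] := PL_diff P1 P2.
  by apply/asboolP; exists h => // p; rewrite coeffB E1 E2 Eh.
split=> //; have [h Ph Eh] := PL_diff P0 P0.
by apply/asboolP; exists h => // p; rewrite coeff0 Eh subrr.
Qed.

HB.instance Definition _ :=
  GRing.isZmodClosed.Build Div principal principal_zmod_closed.

(* The group of divisor classes of all degrees. *)
Definition Pic := Quotient.quot principal.

Definition cls (D : Div) : Pic := \pi_(Pic) D.

Definition Pic_deg (d : int) : set Pic :=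
  [set x | exists2 D : Div, cls D = x & deg D = d].

Section Chains.
Variable A : zmodType.

Definition boundary (c : {ffun E -> A}) : {ffun V -> A} :=
  [ffun v => \sum_(e | tgt e == v) c e - \sum_(e | src e == v) c e].

Definition is_cycle : {pred {ffun E -> A}} := fun c => boundary c == 0.

Lemma cycle_zmod_closed : zmod_closed is_cycle.
Proof.
split=> [|c1 c2 /eqP h1 /eqP h2]; rewrite /is_cycle /in_mem /=.
  by apply/eqP/ffunP => v; rewrite !ffunE !big1 ?subr0 // => e _; rewrite ffunE.
have sumB (P : pred E) : \sum_(e | P e) (c1 - c2) e =
    \sum_(e | P e) c1 e - \sum_(e | P e) c2 e.
  by rewrite -sumrB; apply: eq_bigr => e _; rewrite !ffunE.
apply/eqP/ffunP => v; move/ffunP/(_ v): h1; move/ffunP/(_ v): h2.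
rewrite !ffunE !sumB => /subr0_eq -> /subr0_eq ->.
by rewrite subrr.
Qed.

HB.instance Definition _ :=
  GRing.isZmodClosed.Build {ffun E -> A} is_cycle cycle_zmod_closed.

(* H_1(C, A): a graph has no 2-chains, so homology classes are cycles. *)
Record H1 := Cycle { cycle_chain :> {ffun E -> A}; _ : cycle_chain \in is_cycle }.
HB.instance Definition _ := [isSub for cycle_chain].
HB.instance Definition _ := [Choice of H1 by <:].
HB.instance Definition _ := [SubChoice_isSubZmodule of H1 by <:].

End Chains.

(* The first Betti number. *)
Definition genus : nat :=
  \dim (lker (linfun (@boundary R^o : {ffun E -> R^o} -> {ffun V -> R^o}))).

(* Global sections of Aff / R.  Such a section is recorded by its slope along
   each edge, which is constant since (f) = 0 at interior points; (f) = 0 at a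
   vertex says that the outgoing slopes there add up to 0.  These are the
   equations of an integral cycle. *)
Definition OmegaZ := H1 int.

Definition is_functional : {pred OmegaZ -> R} := fun l =>
  `[< {morph l : w1 w2 / w1 + w2} >].

Lemma functional_zmod_closed : zmod_closed is_functional.
Proof.
split=> [|l1 l2 /asboolP h1 /asboolP h2]; apply/asboolP => w1 w2.
  by rewrite addr0.
by rewrite -![(_ - _) _]/(_ - _) h1 h2 opprD addrACA.
Qed.

HB.instance Definition _ :=
  GRing.isZmodClosed.Build (OmegaZ -> R) is_functional functional_zmod_closed.

(* Omega(C)^*. *)
Record OmegaDual :=
  Functional { eval_form :> OmegaZ -> R; _ : eval_form \in is_functional }.
HB.instance Definition _ := [isSub for eval_form].
HB.instance Definition _ := [Choice of OmegaDual by <:].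
HB.instance Definition _ := [SubChoice_isSubZmodule of OmegaDual by <:].

(* 0 on infinite edges, where all cycles and all 1-forms vanish. *)
Definition len (e : E) : R := fine (hi e - lo e).

Lemma integral_functional (a : {ffun E -> R}) :
  (fun w : OmegaZ => \sum_e a e * (w e)%:~R * len e) \in is_functional.
Proof.
apply/asboolP => w1 w2; rewrite -big_split; apply: eq_bigr => e _ /=.
by rewrite ffunE intrD mulrDr mulrDl.
Qed.

Definition integral (a : {ffun E -> R}) : OmegaDual :=
  Functional (integral_functional a).

(* The lattice Lambda of periods. *)
Definition Lambda : {pred OmegaDual} := fun l =>
  `[< exists c : H1 int, l = integral [ffun e => (c e)%:~R] >].

Lemma Lambda_zmod_closed : zmod_closed Lambda.
Proof.
split=> [|_ _ /asboolP[c1 ->] /asboolP[c2 ->]]; apply/asboolP.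
  exists 0; apply: val_inj; apply/funext => w /=.
  by rewrite big1 // => e _; rewrite !ffunE !mul0r.
exists (c1 - c2); apply: val_inj; apply/funext => w /=.
rewrite -[LHS]/(_ - _) -sumrB; apply: eq_bigr => e _ /=.
by rewrite !ffunE intrB !mulrBl.
Qed.

HB.instance Definition _ :=
  GRing.isZmodClosed.Build OmegaDual Lambda Lambda_zmod_closed.

Definition Jac := Quotient.quot Lambda.

(* (1/2) Lambda / Lambda. *)
Definition half_periods : set Jac :=
  [set \pi_(Jac) x | x in [set x : OmegaDual | x *+ 2 \in Lambda]].

(* A path from p to q is a list of segments (e, x, y), each running from the
   coordinate x to the coordinate y on the edge e. *)
Definition cpath := seq (E * \bar R * \bar R).

Fixpoint is_path (p : Point) (s : cpath) (q : Point) : Prop :=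
  if s is (e, x, y) :: s' then
    [/\ p = epoint e x, (lo e <= x <= hi e)%E, (lo e <= y <= hi e)%E
      & is_path (epoint e y) s' q]
  else p = q.

Definition path_length (s : cpath) : \bar R :=
  (\sum_(t <- s) let: (e, x, y) := t in `|y - x|)%E.

Definition dist (S : set Point) (x : Point) : \bar R :=
  ereal_inf [set path_length s | s in
    [set s : cpath | exists2 q, S q & is_path x s q]].

(* On a leaf the 1-form w vanishes, so infinite segments contribute 0. *)
Lemma path_integral_functional (s : cpath) :
  (fun w : OmegaZ => \sum_(t <- s)
     let: (e, x, y) := t in (w e)%:~R * fine (y - x)%E) \in is_functional.
Proof.
apply/asboolP => w1 w2; rewrite -big_split; apply: eq_bigr => -[[e x] y] _ /=.
by rewrite ffunE intrD mulrDl.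
Qed.

Definition path_integral (s : cpath) : OmegaDual :=
  Functional (path_integral_functional s).

Section Base.
Variable p0 : Point.

Definition path_to (p : Point) : cpath :=
  xget ([::] : cpath) [set s | is_path p0 s p].

Definition mu (p : Point) : Jac := \pi_(Jac) (path_integral (path_to p)).

(* The Abel-Jacobi maps mu^d on divisors, and phi on divisor classes. *)
Definition AJ (D : Div) : Jac := \sum_(p <- dom D) mu p *~ coeff p D.

Definition phi (x : Pic) : Jac := AJ (repr x).

(* Q is transported from cycles to Omega(C)^* by the integration isomorphism
   H_1(C, R) -> Omega(C)^*. *)
Definition real_cycle (x : OmegaDual) : H1 R :=
  xget 0 [set a : H1 R | integral a = x].

Definition Q (x y : OmegaDual) : R :=
  \sum_e real_cycle x e * real_cycle y e * len e.

(* The supremum is a maximum, as Q is positive definite and Lambda a lattice. *)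
Definition Theta (x : OmegaDual) : R :=
  sup [set Q l x - Q l l / 2 | l in [set l | l \in Lambda]].

(* Near p, the lift of mu at the point of coordinate y on the edge e is the
   integral over path_to p followed by the segment from p to this point. *)
Definition theta_div (j : Jac) : Div :=
  \sum_(p \in [set: Point]) <<
    \sum_(t <- tangents p) let: (e, a, d) := t in
      slope (fun y => (Theta (path_integral (path_to p)
               + path_integral [:: (e, a, y)] - repr j))%:E) a d
    *g p >>.

(* The constant of Jacobi inversion. *)
Definition kappa : Jac :=
  xget 0 [set k | forall j, AJ (theta_div j) + k = j].

Definition K0 : Pic :=
  xget 0 [set x | Pic_deg (genus%:Z - 1) x /\ phi x = - kappa].

Section Gamma.
Variable gamma : H1 'F_2.

Definition simple_rep (c : H1 int) : Prop :=
  forall e, (c e)%:~R = gamma e /\ `|c e| <= 1.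

Definition support : set Point :=
  [set p | exists e x, [/\ gamma e != 0, (lo e <= x <= hi e)%E & p = epoint e x]].

Definition dist_gamma : Point -> \bar R := dist support.

(* Whether a tangent vector points along the orientation: by c inside the
   support of gamma, by increasing distance outside. *)
Definition outgoing (c : H1 int) (t : tangent) : bool :=
  let: (e, a, d) := t in
  if gamma e != 0 then (0 < c e) == d
  else 0 < slope (dist_gamma \o epoint e) a d.

Definition val_plus (c : H1 int) (p : Point) : nat :=
  count (outgoing c) (tangents p).

(* The divisor K_gamma^+ for the orientation given by c. *)
Definition Kplus (c : H1 int) : Div :=
  \sum_(p \in [set: Point]) << (val_plus c p)%:Z - 1 *g p >>.

(* K_gamma^+ - K_gamma^- is the divisor of dist_gamma, so the opposite
   orientation, i.e. K_gamma^-, gives the same class. *)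
Definition Kgamma : Pic :=
  if gamma == 0 then K0 else cls (Kplus (xget 0 simple_rep)).

End Gamma.
End Base.

Definition theta_chars : set Pic :=
  [set x | Pic_deg (genus%:Z - 1) x /\ x *+ 2 = cls canonical_div].

End Curve.

Arguments H1 {R} C A.
Arguments Point {R} C.
Arguments Div {R} C.
Arguments theta_chars {R} C.
Arguments half_periods {R} C.

(* Main.v *)
Require Import Defs.
From HB Require Import structures.
From mathcomp Require Import all_boot all_order all_algebra.
From mathcomp Require Import freeg ring lra zify.
From mathcomp Require Import mathcomp_extra boolp classical_sets functions.
From mathcomp Require Import cardinality fsbigop reals constructive_ereal ereal.

Set Implicit Arguments.
Unset Strict Implicit.
Unset Printing Implicit Defensive.

Import Order.TTheory GRing.Theory Num.Theory.
Local Open Scope classical_set_scope.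
Local Open Scope ring_scope.
Local Open Scope quotient_scope.

(** Every class in the statement is pinned down by its degree and its Abel-Jacobi
    image, and these are computed by explicit divisors.

    The tool is a Stokes theorem for families of piecewise linear functions, one on
    each edge, which need not match at the vertices
    ([divisor_of_edge_functions]): such a family has a divisor of degree 0, whose
    Abel-Jacobi image is minus the functional sending a form [w] to the sum over
    the edges of [w e] times the increment of the function.  For a global function
    the increments are those of a vertex potential and the functional vanishes
    ([principal_deg_AJ]).  Conversely a divisor of degree 0 is, up to equivalence,
    the divisor of a family, and if its Abel-Jacobi image is 0 then after
    subtraction of an integral cycle the increments are orthogonal to all cycles,
    hence come from a potential that glues the family ([Abel]).  So [phi] is
    injective on classes of given degree ([phi_inj]).

    The theta function is, along each edge, a supremum of affine functions with
    integral slopes, so Stokes' theorem applies to it as well.  By quasi-periodicity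
    the increment along an edge is a vertex potential plus the value of the argument
    on the fundamental cycle of the edge, plus a constant.  As every cycle is the
    combination of the fundamental cycles with its own coefficients, the translation
    [j] is recovered: the image of the theta divisor of [j] is [j] plus a constant
    ([AJ_theta_div]).  The constant is then brought into closed form by completing
    squares: it is the image of the divisor [K0_div], the sum of the midpoints of
    the edges minus the sum of the vertices ([AJ_K0_div]).  Hence [K_0] is the class
    of [K0_div], and [2 K_0] is canonical because a midpoint counts as half of the
    two ends of its edge.

    This class is not effective ([K0_not_effective]): if [K0_div] plus the divisor
    of [f] were effective, [f] would leave a finite vertex where it is largest with
    positive slope along some edge, be convex up to the midpoint of the edge, and,
    with a single chip there, could not decrease afterwards, so that its value at
    the other end would be larger.

    For nonzero [gamma], the distance to the support rises along an edge from both
    ends to a peak, and the image of [K_gamma^+] differs from that of [K0_div] by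
    shifts between midpoints and peaks and, on the support, between midpoints and
    ends.  The former cancel since they are half of the increments of a vertex
    function, the latter give half of the cycle lifting [gamma] ([AJ_Kplus]).  Thus [K_gamma - K_0] is the half-period of
    [gamma], and [gamma] corresponds to half-periods bijectively and additively since
    every class mod 2 lifts to an integral cycle; such a lift with values at most 1
    is an Eulerian orientation of the support ([simple_rep_ex]).  Finally
    [K - K_gamma^+] is in the same class, and it is effective because every point has
    an incoming direction ([incoming]). *)

(** * Chains and cycles *)

Section Chains.
Variables (R : realType) (C : tropCurve R).
Local Notation V := (vert C).
Local Notation E := (edge C).

Lemma boundaryD (A : zmodType) (a b : {ffun E -> A}) v :
  boundary (a + b) v = boundary a v + boundary b v.
Proof.
rewrite !ffunE addrACA -opprD -!big_split.
by congr (_ - _); apply: eq_bigr => e _; rewrite ffunE.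
Qed.

Lemma boundaryN (A : zmodType) (a : {ffun E -> A}) v :
  boundary (- a) v = - boundary a v.
Proof.
have hN (P : pred E) : \sum_(e | P e) (- a) e = - \sum_(e | P e) a e.
  by rewrite -sumrN; apply: eq_bigr => e _; rewrite ffunE.
by rewrite !ffunE !hN opprD.
Qed.

Lemma boundaryB (A : zmodType) (a b : {ffun E -> A}) v :
  boundary (a - b) v = boundary a v - boundary b v.
Proof. by rewrite boundaryD boundaryN. Qed.

Definition edge_chain (e : E) : {ffun E -> int} := [ffun f => (f == e)%:R].

Lemma boundary_edge_chain e v :
  boundary (edge_chain e) v = (v == tgt e)%:R - (v == src e)%:R.
Proof.
rewrite ffunE; congr (_ - _).
  rewrite (eq_bigr (fun f => if f == e then 1 else 0)); last first.
    by move=> f _; rewrite ffunE; case: eqP.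
  rewrite -big_mkcondr /= [v == _]eq_sym; case: eqP => [<-|ne].
    rewrite (bigD1 e) ?eqxx //= big1 ?addr0 // => f /andP[/andP[_ /eqP->]].
    by rewrite eqxx.
  by rewrite big1 // => f /andP[/eqP h /eqP h']; case: ne; rewrite -h'.
rewrite (eq_bigr (fun f => if f == e then 1 else 0)); last first.
  by move=> f _; rewrite ffunE; case: eqP.
rewrite -big_mkcondr /= [v == _]eq_sym; case: eqP => [<-|ne].
  rewrite (bigD1 e) ?eqxx //= big1 ?addr0 // => f /andP[/andP[_ /eqP->]].
  by rewrite eqxx.
by rewrite big1 // => f /andP[/eqP h /eqP h']; case: ne; rewrite -h'.
Qed.

Lemma vchain_ex (u v : V) :
  exists c : {ffun E -> int}, forall x, boundary c x = (x == v)%:R - (x == u)%:R.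
Proof.
have /connectP[p] := graph_connected u v.
elim: p u => [|y p IH] u /=.
  by move=> _ ->; exists 0 => x; rewrite subrr ffunE !big1 ?subrr // => e _; rewrite ffunE.
case/andP=> /existsP[e ue] /IH{}IH /IH[c hc].
case/orP: ue => /andP[/eqP Eu /eqP Ey].
  by exists (c + edge_chain e) => x; rewrite boundaryD hc boundary_edge_chain Eu Ey addrA subrK.
exists (c - edge_chain e) => x; rewrite boundaryB hc boundary_edge_chain Eu Ey.
by rewrite opprB addrA subrK.
Qed.

(** Summation by parts: a chain integrates the differential of a vertex
    potential to the pairing of its boundary with that potential. *)
Lemma sum_by_parts (M : zmodType) (c : {ffun E -> int}) (F : V -> M) :
  \sum_e (F (tgt e) - F (src e)) *~ c e = \sum_v F v *~ boundary c v.
Proof.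
have part (h : E -> V) : \sum_e F (h e) *~ c e = \sum_v F v *~ (\sum_(e | h e == v) c e).
  rewrite (partition_big h xpredT) //=; apply: eq_bigr => v _.
  rewrite mulrz_sumr; apply: eq_bigr => e /eqP <- //.
under eq_bigr do rewrite mulrzBl.
rewrite sumrB !part -sumrB; apply: eq_bigr => v _.
by rewrite ffunE mulrzBr.
Qed.

Lemma sum_by_parts_real (c : {ffun E -> R}) (F : V -> R) :
  \sum_e c e * (F (tgt e) - F (src e)) = \sum_v boundary c v * F v.
Proof.
have part (h : E -> V) : \sum_e c e * F (h e) = \sum_v (\sum_(e | h e == v) c e) * F v.
  rewrite (partition_big h xpredT) //=; apply: eq_bigr => v _.
  rewrite mulr_suml; apply: eq_bigr => e /eqP <- //.
under eq_bigr do rewrite mulrBr.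
rewrite sumrB !part -sumrB; apply: eq_bigr => v _.
by rewrite ffunE mulrBl.
Qed.

Lemma cycle_boundary (A : zmodType) (c : H1 C A) v : boundary c v = 0.
Proof. by case: c => c /= /eqP ->; rewrite ffunE. Qed.

Lemma cycle_potential (c : H1 C int) (M : zmodType) (F : V -> M) :
  \sum_e (F (tgt e) - F (src e)) *~ c e = 0.
Proof. by rewrite sum_by_parts big1 // => v _; rewrite cycle_boundary mulr0z. Qed.

Lemma cycle_potential_real (c : H1 C R) (F : V -> R) :
  \sum_e c e * (F (tgt e) - F (src e)) = 0.
Proof. by rewrite sum_by_parts_real big1 // => v _; rewrite cycle_boundary mul0r. Qed.

Lemma H1D (A : zmodType) (a b : H1 C A) e : (a + b) e = a e + b e.
Proof. by rewrite -[(a + b) e]/((a + b : {ffun E -> A}) e) ffunE. Qed.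
Lemma H1N (A : zmodType) (a : H1 C A) e : (- a) e = - a e.
Proof. by rewrite -[(- a) e]/((- (a : {ffun E -> A})) e) ffunE. Qed.
Lemma H1B (A : zmodType) (a b : H1 C A) e : (a - b) e = a e - b e.
Proof. by rewrite H1D H1N. Qed.
Lemma H10 (A : zmodType) e : (0 : H1 C A) e = 0.
Proof. by rewrite -[LHS]/((0 : {ffun E -> A}) e) ffunE. Qed.
Lemma H1_eq (A : zmodType) (a b : H1 C A) : (forall e, a e = b e) -> a = b.
Proof. by move=> h; apply: val_inj; apply/ffunP. Qed.
Lemma H1_sum (A : zmodType) I (r : seq I) (P : pred I) (F : I -> H1 C A) e :
  (\sum_(i <- r | P i) F i) e = \sum_(i <- r | P i) F i e.
Proof.
by elim/big_rec2: _ => [|i a b _ <-]; rewrite ?H10 ?H1D.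
Qed.
Lemma H1Mz (A : zmodType) (a : H1 C A) k e : (a *~ k) e = a e *~ k.
Proof.
have nat m : (a *+ m) e = a e *+ m.
  by elim: m => [|m IH]; rewrite ?mulr0n ?H10 // !mulrS H1D IH.
by case: k => m; [rewrite -!pmulrn nat | rewrite NegzE !mulrNz H1N -!pmulrn nat].
Qed.

Lemma mk_cycle (A : zmodType) (a : {ffun E -> A}) :
  (forall v, boundary a v = 0) -> {c : H1 C A | forall e, c e = a e}.
Proof.
move=> h; suff ha : a \in @is_cycle R C A by exists (Cycle ha).
by apply/eqP/ffunP => v; rewrite h ffunE.
Qed.

Definition ofint (n : {ffun E -> int}) : {ffun E -> R} := [ffun e => (n e)%:~R].

Lemma boundary_ofint n v : boundary (ofint n) v = (boundary n v)%:~R.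
Proof.
rewrite !ffunE rmorphB !rmorph_sum /=.
by congr (_ - _); apply: eq_bigr => e _; rewrite ffunE.
Qed.

Lemma val1_edge (h k : E * bool) : vvalence (hend h) = 1%N -> hend k = hend h -> k = h.
Proof.
rewrite /vvalence => /mem_card1[z hz] hk.
by have := hz h; have := hz k; rewrite !inE hk eqxx => /esym/eqP -> /esym/eqP ->.
Qed.

(** Balance at an end of valence 1 leaves no room for flow on its edge. *)
Lemma leaf_cycle0 (A : zmodType) (c : H1 C A) (h : E * bool) :
  vvalence (hend h) = 1%N -> c h.1 = 0.
Proof.
move=> v1; have := cycle_boundary c (hend h); rewrite ffunE.
have only (k : E * bool) : hend k = hend h -> k = h := val1_edge v1.
case: h only {v1} => e [] only; rewrite /hend /= in only *.
  rewrite [X in X - _]big1 => [|f /eqP ff]; last by have := only (f, false) ff.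
  rewrite (bigD1 e) //= big1 => [|f /andP[/eqP ff /eqP fe]].
    by rewrite addr0 sub0r => /eqP; rewrite oppr_eq0 => /eqP.
  by have [] := only (f, true) ff.
rewrite [X in _ - X]big1 => [|f /eqP ff]; last by have := only (f, true) ff.
rewrite (bigD1 e) //= big1 => [|f /andP[/eqP ff /eqP fe]].
  by rewrite addr0 subr0.
by have [] := only (f, false) ff.
Qed.

Definition leaf (e : E) : bool := (lo e == -oo%E) || (hi e == +oo%E).

Lemma leaf_cycle (A : zmodType) (c : H1 C A) e : leaf e -> c e = 0.
Proof.
rewrite /leaf lo_infinite hi_infinite => /orP[] /eqP h.
  exact: (@leaf_cycle0 _ c (e, true)).
exact: (@leaf_cycle0 _ c (e, false)).
Qed.

Lemma finite_edge e : ~~ leaf e ->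
  exists a b : R, [/\ lo e = a%:E, hi e = b%:E, a < b & @len R C e = b - a].
Proof.
rewrite /leaf negb_or /len; have := lo_lt_hi e.
case: (lo e) (hi e) => [a| |] [b| |] //=; rewrite ?lte_fin => ab _.
by exists a, b.
Qed.

Lemma len_gt0 e : ~~ leaf e -> 0 < @len R C e.
Proof. by case/finite_edge => a [b [_ _ ab ->]]; rewrite subr_gt0. Qed.

Lemma len_leaf e : leaf e -> @len R C e = 0.
Proof.
rewrite /leaf /len; have := lo_lt_hi e.
by case: (lo e) (hi e) => [a| |] [b| |].
Qed.

Lemma len_ge0 e : 0 <= @len R C e.
Proof.
by have [/len_leaf -> //|/len_gt0/ltW] := boolP (leaf e).
Qed.

End Chains.

(** * Duality of cycles and forms, and the theta series *)

Section Pairing.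
Variables (R : realType) (C : tropCurve R).
Local Notation V := (vert C).
Local Notation E := (edge C).
Local Notation len := (@len R C).

Lemma od_eq (x y : OmegaDual C) : (forall w, x w = y w) -> x = y.
Proof. by move=> h; apply: val_inj; apply/funext. Qed.
Lemma odD (x y : OmegaDual C) w : (x + y) w = x w + y w. Proof. by []. Qed.
Lemma odN (x : OmegaDual C) w : (- x) w = - x w. Proof. by []. Qed.
Lemma odB (x y : OmegaDual C) w : (x - y) w = x w - y w. Proof. by []. Qed.
Lemma od0 w : (0 : OmegaDual C) w = 0. Proof. by []. Qed.
Lemma od_sum I (r : seq I) (P : pred I) (F : I -> OmegaDual C) w :
  (\sum_(i <- r | P i) F i) w = \sum_(i <- r | P i) F i w.
Proof. by elim/big_rec2: _ => [|i a b _ <-]; rewrite ?od0 ?odD. Qed.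
Lemma odMn (x : OmegaDual C) n w : (x *+ n) w = x w *+ n.
Proof. by elim: n => [|n IH]; rewrite ?mulr0n ?od0 // !mulrS odD IH. Qed.
Lemma odMz (x : OmegaDual C) n w : (x *~ n) w = x w * n%:~R.
Proof.
rewrite mulrzr; case: n => n; first by rewrite -!pmulrn odMn.
by rewrite NegzE !mulrNz odN -!pmulrn odMn.
Qed.

Section Functional.
Variable x : OmegaDual C.
Lemma formD w1 w2 : x (w1 + w2) = x w1 + x w2.
Proof. by case: x => l /= /asboolP. Qed.
Lemma form0 : x 0 = 0.
Proof. by have := formD 0 0; rewrite addr0 => /eqP; rewrite -subr_eq0 opprD addrA subrr sub0r oppr_eq0 => /eqP. Qed.
Lemma formN w : x (- w) = - x w.
Proof. by apply/eqP; rewrite -subr_eq0 opprK -formD addNr form0. Qed.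
Lemma form_sum I (r : seq I) (P : pred I) (F : I -> OmegaZ C) :
  x (\sum_(i <- r | P i) F i) = \sum_(i <- r | P i) x (F i).
Proof. by elim/big_rec2: _ => [|i a b _ <-]; rewrite ?form0 ?formD. Qed.
Lemma formMn w n : x (w *+ n) = x w *+ n.
Proof. by elim: n => [|n IH]; rewrite ?mulr0n ?form0 // !mulrS formD IH. Qed.
Lemma formMz w n : x (w *~ n) = x w * n%:~R.
Proof.
rewrite mulrzr; case: n => n; first by rewrite -!pmulrn formMn.
by rewrite NegzE !mulrNz formN -!pmulrn formMn.
Qed.
End Functional.

Lemma integralE a (w : OmegaZ C) :
  integral a w = \sum_e a e * (w e)%:~R * len e.
Proof. by []. Qed.
Lemma integralD a b : @integral R C (a + b) = integral a + integral b.
Proof.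
apply: od_eq => w; rewrite odD !integralE -big_split.
by apply: eq_bigr => e _ /=; rewrite ffunE !mulrDl.
Qed.
Lemma integralN a : @integral R C (- a) = - integral a.
Proof.
apply: od_eq => w; rewrite odN !integralE -sumrN.
by apply: eq_bigr => e _ /=; rewrite ffunE !mulNr.
Qed.

Definition chain_form (n : {ffun E -> int}) : OmegaDual C := integral (ofint n).

Lemma chain_formE n w : chain_form n w = \sum_e (n e)%:~R * (w e)%:~R * len e.
Proof. by rewrite integralE; apply: eq_bigr => e _; rewrite ffunE. Qed.
Lemma chain_formD n m : chain_form (n + m) = chain_form n + chain_form m.
Proof.
by rewrite -integralD; congr integral; apply/ffunP => e; rewrite !ffunE intrD.
Qed.
Lemma chain_formN n : chain_form (- n) = - chain_form n.
Proof.
by rewrite -integralN; congr integral; apply/ffunP => e; rewrite !ffunE mulrNz.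
Qed.
Lemma chain_formB n m : chain_form (n - m) = chain_form n - chain_form m.
Proof. by rewrite chain_formD chain_formN. Qed.
Lemma chain_form0 : chain_form 0 = 0.
Proof. by apply: od_eq => w; rewrite chain_formE big1 // => e _; rewrite ffunE !mul0r. Qed.

Lemma LambdaP (x : OmegaDual C) : reflect (exists c : H1 C int, x = chain_form c) (x \in @Lambda R C).
Proof. exact: asboolP. Qed.

Lemma chain_form_Lambda (c : H1 C int) : chain_form c \in @Lambda R C.
Proof. by apply/LambdaP; exists c. Qed.

Lemma closed_Lambda (n : {ffun E -> int}) :
  (forall v, boundary n v = 0) -> chain_form n \in @Lambda R C.
Proof.
case/mk_cycle => c hc; apply/LambdaP; exists c; congr chain_form.
by apply/ffunP => e; rewrite hc.
Qed.

Lemma jac_eqP (x y : OmegaDual C) :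
  reflect (\pi_(Jac C) x = \pi_(Jac C) y) (x - y \in @Lambda R C).
Proof. by rewrite Quotient.idealrBE; apply: eqP. Qed.

Lemma jacD (x y : OmegaDual C) : \pi_(Jac C) (x + y) = \pi_(Jac C) x + \pi_(Jac C) y.
Proof. exact: raddfD. Qed.
Lemma jacN (x : OmegaDual C) : \pi_(Jac C) (- x) = - \pi_(Jac C) x.
Proof. exact: raddfN. Qed.
Lemma jacB (x y : OmegaDual C) : \pi_(Jac C) (x - y) = \pi_(Jac C) x - \pi_(Jac C) y.
Proof. exact: raddfB. Qed.
Lemma jac0 : \pi_(Jac C) (0 : OmegaDual C) = 0.
Proof. exact: raddf0. Qed.
Lemma jac_sum I (r : seq I) (P : pred I) (F : I -> OmegaDual C) :
  \pi_(Jac C) (\sum_(i <- r | P i) F i) = \sum_(i <- r | P i) \pi_(Jac C) (F i).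
Proof. exact: raddf_sum. Qed.
Lemma jacMz (x : OmegaDual C) k : \pi_(Jac C) (x *~ k) = \pi_(Jac C) x *~ k.
Proof. exact: raddfMz. Qed.

Lemma jac_repr (j : Jac C) : \pi_(Jac C) (repr j) = j.
Proof. exact: reprK. Qed.

Section Cycles.
Variable v0 : V.

(** The constructions below depend on the choice of these chains only through
    periods. *)
Definition vchain (v : V) : {ffun E -> int} :=
  xget 0 [set c | forall x, boundary c x = (x == v)%:R - (x == v0)%:R].

Lemma boundary_vchain v x : boundary (vchain v) x = (x == v)%:R - (x == v0)%:R.
Proof.
have [c hc] := vchain_ex v0 v.
have := @xgetPex _ 0 [set c : {ffun E -> int} |
  forall x, boundary c x = (x == v)%:R - (x == v0)%:R].
by apply; exists c.
Qed.

Lemma fund_cycle_closed e v :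
  boundary (edge_chain e - vchain (tgt e) + vchain (src e)) v = 0.
Proof.
rewrite boundaryD boundaryB !boundary_vchain boundary_edge_chain; ring.
Qed.

(** Fundamental cycles, with the chains [vchain] in the place of a spanning tree.
    They are not independent, but every cycle is their combination with its own
    coefficients, over the integers and over the reals. *)
Definition fund_cycle (e : E) : H1 C int := sval (mk_cycle (fund_cycle_closed e)).

Lemma fund_cycleE e f :
  fund_cycle e f = (f == e)%:R - vchain (tgt e) f + vchain (src e) f.
Proof. by rewrite /fund_cycle; case: mk_cycle => c /= ->; rewrite !ffunE. Qed.

Lemma cycle_fund_cycle (w : H1 C int) : w = \sum_e fund_cycle e *~ w e.
Proof.
apply: H1_eq => f; rewrite H1_sum.
transitivity (\sum_e (f == e)%:R *~ w e +
    \sum_e ((- vchain (tgt e) f) - (- vchain (src e) f)) *~ w e); last first.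
  rewrite -big_split; apply: eq_bigr => e _ /=.
  by rewrite H1Mz fund_cycleE -mulrzDl opprK addrA.
rewrite (cycle_potential w (fun v => - vchain v f)) addr0.
rewrite (bigD1 f) //= eqxx big1 ?addr0 ?intz // => e /negbTE.
by rewrite eq_sym => ->; rewrite mul0rz.
Qed.

Lemma cycle_fund_cycle_real (a : H1 C R) f : a f = \sum_e a e * (fund_cycle e f)%:~R.
Proof.
under eq_bigr do rewrite fund_cycleE -addrA intrD mulrDr.
rewrite big_split /= [X in _ + X](_ : _ = 0) ?addr0.
  rewrite (bigD1 f) //= eqxx mulr1 big1 ?addr0 // => e /negbTE.
  by rewrite eq_sym => ->; rewrite mulr0.
rewrite -[RHS](cycle_potential_real a (fun v => - (vchain v f)%:~R)).
by apply: eq_bigr => e _; rewrite intrD mulrNz opprK.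
Qed.

(** The pairing of a cycle with itself is its squared length. *)
Lemma integral_cycle_inj (a : H1 C R) : integral a = 0 -> a = 0.
Proof.
move=> a0; have sq : \sum_e a e * a e * len e = 0.
  transitivity (\sum_e a e * integral a (fund_cycle e)).
    transitivity (\sum_f \sum_e (a e * (fund_cycle e f)%:~R) * a f * len f).
      by apply: eq_bigr => f _; rewrite {1}(cycle_fund_cycle_real a f) !mulr_suml.
    rewrite exchange_big /=; apply: eq_bigr => e _.
    by rewrite mulr_sumr; apply: eq_bigr => f _; ring.
  by rewrite a0 big1 // => e _; rewrite od0 mulr0.
apply: H1_eq => e; rewrite H10.
have [/leaf_cycle -> //|/len_gt0 le] := boolP (leaf e).
have ge0 f : true -> 0 <= a f * a f * len f.
  by rewrite mulr_ge0 ?len_ge0 // -expr2 sqr_ge0.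
have /eqP := sq; rewrite psumr_eq0 // => /allP /(_ e (mem_index_enum _)) /=.
by rewrite !mulf_eq0 (gt_eqF le) orbF orbb => /eqP.
Qed.

(** Riesz duality for the length pairing.  The Gram matrix of the fundamental
    cycles has the same kernel as their linear relations, so the values of a
    functional, which respect these relations, lie in its row space. *)
Lemma integral_cycle_surj (l : OmegaDual C) : exists a : H1 C R, integral a = l.
Proof.
pose N := #|E|.
pose z i : H1 C int := fund_cycle (@enum_val E predT i).
pose Z : 'M[R]_N := \matrix_(i, f) (z i (enum_val f))%:~R.
pose S : 'M[R]_N := \matrix_(i, j) \sum_e (z i e)%:~R * (z j e)%:~R * len e.
pose L : 'rV[R]_N := \row_i l (z i).
have sumE (M : nmodType) (F : E -> M) : \sum_e F e = \sum_(i < N) F (enum_val i).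
  by rewrite (reindex (@enum_val E predT)) //=; exact/onW_bij/enum_val_bij.
have : (L <= S)%MS.
  rewrite submxE; apply/eqP/matrixP => i0 j; rewrite !mxE ord1 {i0}.
  pose y i := cokermx S i j.
  have Sy i : \sum_k S i k * y k = 0.
    by have /matrixP/(_ i j) := mulmx_coker S; rewrite !mxE.
  pose t e := \sum_i y i * (z i e)%:~R.
  have t0 e : t e = 0.
    have [le|le] := boolP (leaf e).
      by rewrite /t big1 // => i _; rewrite leaf_cycle // mulr0.
    have sq : \sum_f t f * t f * len f = 0.
      transitivity (\sum_i y i * \sum_k S i k * y k); last first.
        by rewrite big1 // => i _; rewrite Sy mulr0.
      under [RHS]eq_bigr do under eq_bigr do rewrite mxE mulr_suml.
      under [RHS]eq_bigr do rewrite exchange_big mulr_sumr.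
      rewrite [RHS]exchange_big; apply: eq_bigr => f _ /=.
      rewrite /t !mulr_suml; apply: eq_bigr => i _ /=.
      rewrite !mulr_sumr mulr_suml; apply: eq_bigr => k _; ring.
    have ge0 f : true -> 0 <= t f * t f * len f.
      by rewrite mulr_ge0 ?len_ge0 // -expr2 sqr_ge0.
    have /eqP := sq; rewrite psumr_eq0 // => /allP /(_ e (mem_index_enum _)) /=.
    by rewrite !mulf_eq0 (gt_eqF (len_gt0 le)) orbF orbb => /eqP.
  transitivity (\sum_e t e * l (fund_cycle e)); last first.
    by rewrite big1 // => e _; rewrite t0 mul0r.
  under eq_bigr do rewrite mxE /z (cycle_fund_cycle (fund_cycle _)) form_sum mulr_suml.
  rewrite exchange_big; apply: eq_bigr => e _ /=.
  rewrite /t mulr_suml; apply: eq_bigr => i _; rewrite formMz -/(y i) /z; ring.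
case/submxP => x Lx.
have [a ha] : exists a : H1 C R, forall e, a e = \sum_i x 0 i * (z i e)%:~R.
  have cl v : boundary [ffun e => \sum_i x 0 i * (z i e)%:~R] v = 0.
    transitivity (\sum_i x 0 i * (boundary (z i) v)%:~R); last first.
      by rewrite big1 // => i _; rewrite cycle_boundary mulr0.
    rewrite ffunE.
    under [RHS]eq_bigr do rewrite ffunE rmorphB !rmorph_sum /= mulrBr !mulr_sumr.
    rewrite sumrB; congr (_ - _); rewrite [RHS]exchange_big /=;
      by apply: eq_bigr => e _; rewrite ffunE.
  by have [a ha] := mk_cycle cl; exists a => e; rewrite ha ffunE.
exists a; apply: od_eq => w.
have key e : integral a (fund_cycle e) = l (fund_cycle e).
  have /matrixP/(_ 0 (enum_rank e)) := Lx; rewrite !mxE /z enum_rankK => ->.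
  rewrite integralE; under eq_bigr do rewrite ha !mulr_suml.
  rewrite exchange_big; apply: eq_bigr => i _ /=.
  rewrite mxE /z enum_rankK mulr_sumr; apply: eq_bigr => f _; ring.
rewrite (cycle_fund_cycle w) !form_sum; apply: eq_bigr => e _.
by rewrite !formMz key.
Qed.
End Cycles.

Lemma real_cycleK (x : OmegaDual C) : integral (real_cycle x) = x.
Proof.
have [v0] : exists v0 : V, true by have /card_gt0P[v _] := graph_nonempty C; exists v.
move=> _; have [a ha] := integral_cycle_surj v0 x.
by have := @xgetPex _ 0 [set a : H1 C R | integral a = x]; apply; exists a.
Qed.

Lemma real_cycle_integral (a : H1 C R) : real_cycle (integral a) = a.
Proof.
have [v0] : exists v0 : V, true by have /card_gt0P[v _] := graph_nonempty C; exists v.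
move=> _; apply/eqP; rewrite -subr_eq0; apply/eqP/(integral_cycle_inj v0).
by rewrite [LHS]integralD integralN real_cycleK subrr.
Qed.

Lemma real_of_int (c : H1 C int) : {a : H1 C R | forall e, a e = (c e)%:~R}.
Proof.
have h v : boundary (ofint c) v = 0 by rewrite boundary_ofint cycle_boundary.
by have [a ha] := mk_cycle h; exists a => e; rewrite ha ffunE.
Qed.

Lemma real_cycle_chain_form (c : H1 C int) e : real_cycle (chain_form c) e = (c e)%:~R.
Proof.
have [a ha] := real_of_int c; rewrite -ha; congr (cycle_chain _ e).
rewrite -[a]real_cycle_integral; congr (real_cycle (integral _)).
by apply/ffunP => f; rewrite ffunE ha.
Qed.

Lemma chain_form_cycle_inj (c d : H1 C int) : chain_form c = chain_form d -> c = d.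
Proof.
move=> cd; apply: H1_eq => e; apply: (@intr_inj R).
by rewrite -!real_cycle_chain_form cd.
Qed.

(** Paired with a period, the quadratic form is an evaluation; this removes the
    isomorphism with real cycles from the theta function. *)
Lemma Q_chain_form (c : H1 C int) x : Q (chain_form c) x = x c.
Proof.
rewrite -{2}(real_cycleK x) integralE; apply: eq_bigr => e _.
by rewrite real_cycle_chain_form [_ * real_cycle x e]mulrC.
Qed.

Definition sqnorm (c : H1 C int) : R := \sum_e (c e)%:~R ^+ 2 * len e.

Lemma Q_chain_form_chain_form (c : H1 C int) : Q (chain_form c) (chain_form c) = sqnorm c.
Proof. by rewrite Q_chain_form chain_formE; apply: eq_bigr => e _; rewrite expr2. Qed.

Lemma chain_form_sqnorm (c : H1 C int) : chain_form c c = sqnorm c.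
Proof. by rewrite -Q_chain_form Q_chain_form_chain_form. Qed.

Lemma chain_formC (c d : H1 C int) : chain_form c d = chain_form d c.
Proof. by rewrite !chain_formE; apply: eq_bigr => e _; rewrite [_%:~R * _]mulrC. Qed.

Lemma sqnormD (c d : H1 C int) : sqnorm (c + d) = sqnorm c + sqnorm d + chain_form c d *+ 2.
Proof.
by rewrite -!chain_form_sqnorm !chain_formD !odD !formD (chain_formC d c) mulr2n; ring.
Qed.

Definition theta_set (x : OmegaDual C) : set R :=
  [set x c - sqnorm c / 2 | c in [set: H1 C int]].

Lemma ThetaE x : Theta x = sup (theta_set x).
Proof.
congr sup; apply/seteqP; split=> [_ [l /LambdaP[c ->] <-]|_ [c _ <-]].
  by exists c => //; rewrite Q_chain_form Q_chain_form_chain_form.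
by exists (chain_form c); [exact: chain_form_Lambda | rewrite Q_chain_form Q_chain_form_chain_form].
Qed.

(** Completing the square bounds the terms of the theta series. *)
Lemma theta_term_le (x : OmegaDual C) c :
  x c - sqnorm c / 2 <= (\sum_e real_cycle x e ^+ 2 * len e) / 2.
Proof.
rewrite -subr_ge0 -{2}(real_cycleK x) integralE /sqnorm.
have -> : (\sum_e real_cycle x e ^+ 2 * len e) / 2 -
    (\sum_e real_cycle x e * (c e)%:~R * len e - (\sum_e (c e)%:~R ^+ 2 * len e) / 2)
    = \sum_e (real_cycle x e - (c e)%:~R) ^+ 2 * len e / 2.
  rewrite !mulr_suml opprB addrA -big_split -sumrB /=.
  by apply: eq_bigr => e _; field.
apply: sumr_ge0 => e _.
by rewrite mulr_ge0 ?invr_ge0 // mulr_ge0 ?sqr_ge0 ?len_ge0.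
Qed.

Lemma theta_set_sup x : has_sup (theta_set x).
Proof.
split; first by exists (x 0 - sqnorm 0 / 2), 0.
exists ((\sum_e real_cycle x e ^+ 2 * len e) / 2) => _ [c _ <-].
exact: theta_term_le.
Qed.

Lemma Theta_ge (x : OmegaDual C) c : x c - sqnorm c / 2 <= Theta x.
Proof. by rewrite ThetaE; apply: (ub_le_sup (theta_set_sup x).2); exists c. Qed.

Lemma Theta_le (x : OmegaDual C) M : (forall c, x c - sqnorm c / 2 <= M) -> Theta x <= M.
Proof.
move=> h; rewrite ThetaE; apply: (ge_sup (theta_set_sup x).1).
by move=> _ [c _ <-].
Qed.

(** The periods act on the theta series by translations of the summation index. *)
Lemma Theta_quasi (x : OmegaDual C) (c : H1 C int) : Theta (x + chain_form c) = Theta x + x c + sqnorm c / 2.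
Proof.
have e2 (d : H1 C int) : (x + chain_form c) (d + c) - sqnorm (d + c) / 2 =
    (x d - sqnorm d / 2) + x c + sqnorm c / 2.
  by rewrite odD !formD sqnormD (chain_formC d) chain_form_sqnorm mulr2n; field.
apply/eqP; rewrite eq_le; apply/andP; split.
  apply: Theta_le => d; have -> : d = (d - c) + c by rewrite subrK.
  by rewrite e2 !lerD2r Theta_ge.
rewrite -addrA -lerBrDr; apply: Theta_le => d.
by rewrite lerBrDr addrA -e2 Theta_ge.
Qed.

End Pairing.

(** * Paths and the Abel-Jacobi map *)

Section Paths.
Variables (R : realType) (C : tropCurve R).
Local Notation V := (vert C).
Local Notation E := (edge C).
Local Notation len := (@len R C).
Local Notation chain_form := (@chain_form R C).

Lemma coord_finite (e : E) x : ~~ leaf e -> (lo e <= x <= hi e)%E -> exists r, x = r%:E.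
Proof.
case/finite_edge=> a [b [-> -> _ _]]; case: x => [r| |] //; first by exists r.
by rewrite leye_eq andbF.
Qed.

Definition seg (e : E) (x y : \bar R) : OmegaDual C := path_integral [:: (e, x, y)].

Lemma segE e x y w : seg e x y w = (w e)%:~R * fine (y - x)%E.
Proof. by rewrite /seg /= big_seq1. Qed.

Lemma seg_leaf e x y : leaf e -> seg e x y = 0.
Proof. by move=> le; apply: od_eq => w; rewrite segE leaf_cycle // mul0r. Qed.

Lemma path_integral_cat s1 s2 :
  path_integral (s1 ++ s2) = path_integral s1 + path_integral s2 :> OmegaDual C.
Proof. by apply: od_eq => w; rewrite odD /= big_cat. Qed.

Lemma path_integral_nil : path_integral [::] = 0 :> OmegaDual C.
Proof. by apply: od_eq => w; rewrite /= big_nil. Qed.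

Lemma path_integral_cons e x y s :
  path_integral ((e, x, y) :: s) = seg e x y + path_integral s.
Proof. by rewrite -cat1s path_integral_cat. Qed.

Lemma seg_trans e x y z : (lo e <= x <= hi e)%E -> (lo e <= y <= hi e)%E ->
  (lo e <= z <= hi e)%E -> seg e x z = seg e x y + seg e y z.
Proof.
move=> hx hy hz; have [le|le] := boolP (leaf e); first by rewrite !seg_leaf ?addr0.
have [a ->] := coord_finite le hx; have [b ->] := coord_finite le hy.
have [c ->] := coord_finite le hz.
by apply: od_eq => w; rewrite odD !segE /= -mulrDr; congr (_ * _); ring.
Qed.

Lemma seg_sym e x y : (lo e <= x <= hi e)%E -> (lo e <= y <= hi e)%E ->
  seg e x y = - seg e y x.
Proof.
move=> hx hy; have [le|le] := boolP (leaf e); first by rewrite !seg_leaf ?oppr0.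
have [a ->] := coord_finite le hx; have [b ->] := coord_finite le hy.
by apply: od_eq => w; rewrite odN !segE /= -mulrN; congr (_ * _); ring.
Qed.

Lemma seg_refl e x : (lo e <= x <= hi e)%E -> seg e x x = 0.
Proof.
by move=> hx; apply/eqP; rewrite -[_ == _](inj_eq (addrI (seg e x x))) addr0 -seg_trans.
Qed.

Lemma lo_range (e : E) : (lo e <= lo e <= hi e)%E.
Proof. by rewrite lexx ltW ?lo_lt_hi. Qed.
Lemma hi_range (e : E) : (lo e <= hi e <= hi e)%E.
Proof. by rewrite lexx ltW ?lo_lt_hi. Qed.

Lemma chain_form_edge e : chain_form (edge_chain e) = seg e (lo e) (hi e).
Proof.
apply: od_eq => w; rewrite chain_formE segE (bigD1 e) //= big1 ?addr0.
  by rewrite ffunE eqxx mul1r.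
by move=> f /negbTE fe; rewrite ffunE fe !mul0r.
Qed.

(** Reference vertices for the comparison of paths: up to the offsets of its ends,
    an integral along a path is one over an integral chain between their anchors. *)
Definition anchor (p : Point C) : V :=
  match p with inl v => v | inr u => src (val u).1 end.

Definition offset (p : Point C) : OmegaDual C :=
  match p with
  | inl v => 0
  | inr u => seg (val u).1 (lo (val u).1) (val u).2%:E
  end.

Lemma offset_epoint e x : (lo e <= x <= hi e)%E -> exists n : {ffun E -> int},
  (forall v, boundary n v = (v == anchor (epoint e x))%:R - (v == src e)%:R) /\
  seg e (lo e) x = offset (epoint e x) + chain_form n.
Proof.
move=> /andP[lx xh]; have [xl|xl] := leP x (lo e).
  have -> : x = lo e by apply/eqP; rewrite eq_le xl lx.
  exists 0; split=> [v|]; rewrite epoint_lo //= ?chain_form0 ?addr0.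
    by rewrite subrr ffunE !big1 ?subrr // => f _; rewrite ffunE.
  exact/seg_refl/lo_range.
have [hx|hx] := leP (hi e) x.
  have -> : x = hi e by apply/eqP; rewrite eq_le hx xh.
  exists (edge_chain e); split=> [v|]; rewrite epoint_hi //=.
    exact: boundary_edge_chain.
  by rewrite chain_form_edge add0r.
case: x xl hx {lx xh} => [r| |] xl hx.
- have h : (lo e < r%:E < hi e)%E by rewrite xl hx.
  exists 0; rewrite (epoint_in h) /= chain_form0 addr0; split=> // v.
  by rewrite subrr ffunE !big1 ?subrr // => f _; rewrite ffunE.
- by move: hx; rewrite ltNge leey.
- by move: xl; rewrite ltNge leNye.
Qed.

(** In particular two paths with the same ends differ by a period. *)
Lemma path_integral_chain (p : Point C) s q : is_path p s q -> exists n : {ffun E -> int},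
  (forall v, boundary n v = (v == anchor q)%:R - (v == anchor p)%:R) /\
  path_integral s = offset q - offset p + chain_form n.
Proof.
elim: s p => [|[[e x] y] s IH] p /=.
  move=> ->; exists 0; rewrite path_integral_nil chain_form0 subrr addr0; split=> // v.
  by rewrite subrr ffunE !big1 ?subrr // => f _; rewrite ffunE.
case=> -> hx hy /IH[n [bn En]].
have [nx [bx Ex]] := offset_epoint hx; have [ny [by_ Ey]] := offset_epoint hy.
exists (n + (ny - nx)); split=> [v|].
  by rewrite boundaryD boundaryB bn by_ bx; ring.
rewrite path_integral_cons En (seg_trans hx (lo_range e) hy) (seg_sym hx (lo_range e)).
rewrite Ex Ey chain_formD chain_formB; apply: od_eq => w; rewrite !(odD, odN); ring.
Qed.

Lemma is_path_cat (p : Point C) s1 q s2 r : is_path p s1 q -> is_path q s2 r ->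
  is_path p (s1 ++ s2) r.
Proof.
elim: s1 p => [|[[e x] y] s IH] p /=; first by move=> ->.
by case=> -> hx hy h1 h2; split=> //; apply: IH.
Qed.

Lemma point_epoint (p : Point C) : (exists v, p = inl v) \/
  exists e (r : R), (lo e < r%:E < hi e)%E /\ p = epoint e r%:E.
Proof.
case: p => [v|[[e r] h]]; first by left; exists v.
by right; exists e, r; split=> //; rewrite (epoint_in h).
Qed.

Lemma in_range (e : E) x : (lo e < x < hi e)%E -> (lo e <= x <= hi e)%E.
Proof. by case/andP => h1 h2; rewrite !ltW. Qed.

Lemma is_path_vert (u v : V) : exists s, is_path (inl u) s (inl v : Point C).
Proof.
have /connectP[p] := graph_connected u v.
elim: p u => [|y p IH] u /=; first by move=> _ ->; exists [::].
case/andP=> /existsP[e ue] /IH{}IH /IH[s hs].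
case/orP: ue => /andP[/eqP Eu /eqP Ey].
  exists ((e, lo e, hi e) :: s); split; rewrite ?lo_range ?hi_range //.
    by rewrite epoint_lo ?Eu.
  by rewrite epoint_hi ?Ey.
exists ((e, hi e, lo e) :: s); split; rewrite ?lo_range ?hi_range //.
  by rewrite epoint_hi ?Ey.
by rewrite epoint_lo ?Eu.
Qed.

Lemma is_path_ex (p q : Point C) : exists s, is_path p s q.
Proof.
have to_v r v : exists s, is_path r s (inl v : Point C).
  have [[u ->]|[e [x [hx ->]]]] := point_epoint r; first exact: is_path_vert.
  have [s hs] := is_path_vert (src e) v.
  exists ((e, x%:E, lo e) :: s); split; rewrite ?lo_range ?in_range //.
  by rewrite epoint_lo.
have [[u ->]|[e [x [hx ->]]]] := point_epoint q; first exact: to_v.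
have [s hs] := to_v p (src e); exists (s ++ [:: (e, lo e, x%:E)]).
by apply: is_path_cat hs _; split; rewrite ?lo_range ?in_range // epoint_lo.
Qed.

Section Base.
Variable p0 : Point C.

(** A lift of the Abel-Jacobi map given by a formula, where [path_to] is an
    arbitrary path. *)
Definition AJ_lift (p : Point C) : OmegaDual C :=
  offset p - offset p0 + chain_form (vchain (anchor p0) (anchor p)).

Lemma path_toP p : is_path p0 (path_to p0 p) p.
Proof.
have [s hs] := is_path_ex p0 p.
by have := @xgetPex _ ([::] : cpath C) [set s | is_path p0 s p]; apply; exists s.
Qed.

Lemma path_to_lift p : exists c : H1 C int,
  path_integral (path_to p0 p) = AJ_lift p + chain_form c.
Proof.
have [n [bn ->]] := path_integral_chain (path_toP p).
have cl v : boundary (n - vchain (anchor p0) (anchor p)) v = 0.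
  by rewrite boundaryB bn boundary_vchain subrr.
have /LambdaP[c hc] := closed_Lambda cl; exists c.
by rewrite -hc chain_formB /AJ_lift; apply: od_eq => w; rewrite !(odD, odN); ring.
Qed.

Lemma mu_lift p : mu p0 p = \pi_(Jac C) (AJ_lift p).
Proof.
rewrite /mu; have [c ->] := path_to_lift p; apply/jac_eqP.
by rewrite addrAC subrr add0r chain_form_Lambda.
Qed.

Lemma AJ_lift_epoint e x : (lo e <= x <= hi e)%E -> exists c : H1 C int,
  AJ_lift (epoint e x) = AJ_lift (inl (src e)) + seg e (lo e) x + chain_form c.
Proof.
move=> hx; have [n [bn ->]] := offset_epoint hx.
pose m := vchain (anchor p0) (anchor (epoint e x)) - vchain (anchor p0) (src e) - n.
have cl v : boundary m v = 0.
  by rewrite !boundaryB bn !boundary_vchain; ring.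
have /LambdaP[c hc] := closed_Lambda cl; exists c.
rewrite -hc /AJ_lift !chain_formB /=; apply: od_eq => w; rewrite !(odD, odN, od0); ring.
Qed.

Lemma mu_src e x : (lo e <= x <= hi e)%E ->
  mu p0 (epoint e x) = mu p0 (inl (src e)) + \pi_(Jac C) (seg e (lo e) x).
Proof.
move=> hx; have [c Ec] := AJ_lift_epoint hx.
rewrite !mu_lift -jacD; apply/jac_eqP.
by rewrite Ec addrAC subrr add0r chain_form_Lambda.
Qed.

Lemma mu_seg e x y : (lo e <= x <= hi e)%E -> (lo e <= y <= hi e)%E ->
  mu p0 (epoint e y) = mu p0 (epoint e x) + \pi_(Jac C) (seg e x y).
Proof.
move=> hx hy; rewrite (mu_src hx) (mu_src hy).
by rewrite (seg_trans (lo_range e) hx hy) jacD addrA.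
Qed.

Lemma AJ_lift_tgt e :
  AJ_lift (inl (src e)) + seg e (lo e) (hi e) = AJ_lift (inl (tgt e)) +
    chain_form (fund_cycle (anchor p0) e).
Proof.
rewrite -chain_form_edge /AJ_lift /=.
have -> : chain_form (fund_cycle (anchor p0) e) = chain_form (edge_chain e) -
    chain_form (vchain (anchor p0) (tgt e)) + chain_form (vchain (anchor p0) (src e)).
  rewrite -chain_formB -chain_formD; congr chain_form; apply/ffunP => f.
  by rewrite fund_cycleE !ffunE.
by apply: od_eq => w; rewrite !(odD, odN, od0); ring.
Qed.

Lemma AJ_sub (D : Div C) s : uniq s -> {subset dom D <= s} ->
  AJ p0 D = \sum_(p <- s) mu p0 p *~ coeff p D.
Proof.
move=> us sD; rewrite /AJ [RHS](bigID (mem (dom D))) /=.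
rewrite [X in _ + X]big1 ?addr0 => [|p pD]; last by rewrite coeff_outdom ?mulr0z.
rewrite -[RHS]big_filter; apply: perm_big; apply: uniq_perm.
- exact: uniq_dom.
- exact: filter_uniq.
- by move=> p; rewrite mem_filter; case: (boolP (p \in dom D)) => // /sD ->.
Qed.

Lemma AJB (D1 D2 : Div C) : AJ p0 (D1 - D2) = AJ p0 D1 - AJ p0 D2.
Proof.
pose s := undup (dom D1 ++ dom D2).
have us : uniq s by exact: undup_uniq.
rewrite !(@AJ_sub _ s) //.
- by rewrite -sumrB; apply: eq_bigr => p _; rewrite coeffB mulrzBr.
- by move=> p; rewrite mem_undup mem_cat orbC => ->.
- by move=> p; rewrite mem_undup mem_cat => ->.
- by move=> p /domB; rewrite mem_undup.
Qed.

HB.instance Definition _ := GRing.isZmodMorphism.Build (Div C) (Jac C) (AJ p0) AJB.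

Lemma AJU k p : AJ p0 << k *g p >> = mu p0 p *~ k.
Proof.
rewrite (@AJ_sub _ [:: p]) //; first by rewrite big_seq1 coeffU eqxx mulr1.
move=> q; rewrite mem_dom coeffU inE mulf_eq0 negb_or => /andP[_].
by rewrite pnatr_eq0 eqb0 negbK eq_sym.
Qed.

End Base.

Lemma fsum_coeff (F : Point C -> int) (D : Div C) : (forall p, coeff p D = F p) ->
  \sum_(p \in [set: Point C]) << F p *g p >> = D.
Proof.
move=> h; rewrite -[RHS]freeg_sumE (fsbigE (dom D)) ?uniq_dom //.
  by rewrite big_mkcond; apply: eq_bigr => p _; rewrite h in_setT.
by move=> p _; rewrite mem_dom h negbK => /eqP ->; rewrite freegU0.
Qed.

End Paths.

(** * Stokes' theorem for families of piecewise linear functions *)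

Section PiecewiseLinear.
Variables (R : realType) (C : tropCurve R).
Local Notation V := (vert C).
Local Notation E := (edge C).
Local Notation len := (@len R C).
Local Open Scope ereal_scope.

Definition PL_on (g : \bar R -> \bar R) (a b : \bar R) := exists B : seq (\bar R),
  forall x y, a <= x -> x < y -> y <= b -> (forall z, z \in B -> ~~ (x < z < y)) ->
  exists s, affine_on g x y s.

(** Piecewise linear functions are handled by cutting the interval until the
    function is affine, so additive statements need only the affine case. *)
Lemma PL_on_ind (P : \bar R -> \bar R -> Prop) g a b :
  (forall x y s, a <= x -> x < y -> y <= b -> affine_on g x y s -> P x y) ->
  (forall x m y, a <= x -> x < m -> m < y -> y <= b -> P x m -> P m y -> P x y) ->
  PL_on g a b -> a < b -> P a b.
Proof.
move=> Pa Ps [B hB] ab.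
have main (B' : seq (\bar R)) x y : a <= x -> x < y -> y <= b ->
    (forall z, z \in B -> x < z < y -> z \in B') -> P x y.
  elim: B' x y => [|z B' IH] x y ax xy yb h.
    have [|s] := hB x y ax xy yb; last exact: Pa.
    by move=> z /h {}h; apply/negP => /h.
  have [/andP[xz zy]|nz] := boolP (x < z < y).
    apply: (Ps x z y) => //; apply: IH => //.
    - exact: le_trans (ltW zy) yb.
    - move=> w wB /andP[xw wz]; have := h w wB; rewrite xw (lt_trans wz zy).
      by move=> /(_ isT); rewrite inE => /orP[/eqP ww|//]; move: wz; rewrite ww ltxx.
    - exact: le_trans ax (ltW xz).
    - move=> w wB /andP[zw wy]; have := h w wB; rewrite wy (lt_trans xz zw).
      by move=> /(_ isT); rewrite inE => /orP[/eqP ww|//]; move: zw; rewrite ww ltxx.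
  apply: IH => // w wB xwy; have := h w wB xwy; rewrite inE => /orP[/eqP ww|//].
  by move: nz; rewrite -ww xwy.
by apply: (main B) => // ; rewrite lexx.
Qed.

Lemma slope_affine (g : \bar R -> \bar R) x y a d s : x < y -> (if d then x <= a < y else x < a <= y) ->
  affine_on g x y s -> slope g a d = (if d then s else - s)%R.
Proof.
move=> xy + [c F]; case: d => /andP[h1 h2]; apply: xget_unique.
- by exists y; split=> //; exists c => z /andP[z1 z2]; apply: F; rewrite z2 (le_trans h1).
- move=> s' [b [ab [c' F']]].
  have [] := @affine_uniq R g a (Order.min b y) s' s c' c.
  + by rewrite lt_min ab.
  + by move=> z; rewrite lt_min => /and3P[z1 z2 z3]; apply: F'; rewrite !ltW.
  + move=> z; rewrite lt_min => /and3P[z1 z2 z3]; apply: F.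
    by rewrite (le_trans h1) ?ltW.
  by [].
- exists x; split=> //; exists c => z /andP[z1 z2]; rewrite opprK; apply: F.
  by rewrite z1 (le_trans z2).
- move=> s' [b [ab [c' F']]].
  have [] := @affine_uniq R g (Order.max b x) a (- s')%R s c' c.
  + by rewrite gt_max ab.
  + by move=> z; rewrite gt_max => /andP[/andP[z1 z2] z3]; apply: F'; rewrite !ltW.
  + move=> z; rewrite gt_max => /andP[/andP[z1 z2] z3]; apply: F.
    by rewrite ltW // (le_trans _ h2) ?ltW.
  by move=> <- _; rewrite opprK.
Qed.

Lemma PL_on_sub g a b a' b' : a <= a' -> b' <= b -> PL_on g a b -> PL_on g a' b'.
Proof.
move=> aa bb [B hB]; exists B => x y ax xy yb; apply: hB => //.
  exact: le_trans ax.
exact: le_trans bb.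
Qed.

Lemma sum_tangents_vert (M : nmodType) (F : tangent C -> M) v :
  (\sum_(t <- tangents (inl v : Point C)) F t =
   \sum_(e | src e == v) F (e, lo e, true) + \sum_(e | tgt e == v) F (e, hi e, false))%R.
Proof.
rewrite /= big_map big_enum /= -(pair_big_dep xpredT (fun e d => hend (e, d) == v)
  (fun e d => F (e, if d then lo e else hi e, d))) /=.
under eq_bigr do rewrite big_mkcond big_bool /=.
by rewrite big_split /= -!big_mkcond.
Qed.

Lemma sum_tangents_inr (M : nmodType) (F : tangent C -> M) e (x : R)
    (h : lo e < x%:E < hi e) :
  (\sum_(t <- tangents (epoint e x%:E)) F t = F (e, x%:E, true) + F (e, x%:E, false))%R.
Proof. by rewrite epoint_in /= !big_cons big_nil addr0. Qed.

(** Neither the vectors pointing out of the segment at its ends nor those of its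
    complement are counted, so consecutive segments share no tangent vector. *)
Definition in_seg (e : E) (a b : \bar R) (t : tangent C) : bool :=
  (t.1.1 == e) && (if t.2 then a <= t.1.2 < b else a < t.1.2 <= b).

Lemma in_seg_split (M : nmodType) e a m b t (x : M) : a < m -> m < b ->
  ((if in_seg e a b t then x else 0) =
   (if in_seg e a m t then x else 0) + (if in_seg e m b t then x else 0))%R.
Proof.
case: t => [[f y] d] am mb; rewrite /in_seg /=; case: eqP => _ /=; last by rewrite addr0.
case: d.
  have [my|ym] := leP m y; first by rewrite (le_trans (ltW am) my) add0r.
  by rewrite (lt_trans ym mb) addr0 andbT.
have [my|ym] := ltP m y; first by rewrite (lt_trans am my) add0r.
by rewrite (le_trans ym (ltW mb)) addr0 andbT.
Qed.

Lemma epoint_eq_inl e a v : (epoint e a == inl v :> Point C) ->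
  a <= lo e \/ hi e <= a.
Proof.
have [|la] := leP a (lo e); first by left.
have [|ah] := leP (hi e) a; first by right.
case: a la ah => [x| |] la ah; last by move: la; rewrite ltNge leNye.
  have h : lo e < x%:E < hi e by rewrite la ah.
  by rewrite (epoint_in h).
by move: ah; rewrite ltNge leey.
Qed.

Lemma epoint_eq_in e a f (x : R) : lo f < x%:E < hi f ->
  (epoint e a == epoint f x%:E :> Point C) = (e == f) && (a == x%:E).
Proof.
move=> h; apply/eqP/andP => [|[/eqP -> /eqP ->] //]; rewrite (epoint_in h).
have [la|la] := leP a (lo e); first by rewrite epoint_lo.
have [ah|ah] := leP (hi e) a; first by rewrite epoint_hi.
case: a la ah => [y| |] la ah; last by move: la; rewrite ltNge leNye.
  have h' : lo e < y%:E < hi e by rewrite la ah.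
  by rewrite (epoint_in h') => -[-> ->].
by move: ah; rewrite ltNge leey.
Qed.


Lemma sum_only (M : nmodType) (P Q : pred E) e (x : M) :
  (\sum_(f | P f) (if (f == e) && Q f then x else 0) = if P e && Q e then x else 0)%R.
Proof.
rewrite big_mkcond (bigD1 e) //= eqxx big1 => [|f /negbTE ->]; last by case: ifP.
by rewrite addr0; case: (P e).
Qed.

(** An interior point has one tangent vector in each direction; only the ends are
    unbalanced. *)
Lemma sum_seg_tangents e a b p : lo e <= a -> a < b -> b <= hi e ->
  (\sum_(t <- tangents p | in_seg e a b t) (if t.2 then 1 else -1 : int) =
   (epoint e a == p)%:R - (epoint e b == p)%:R)%R.
Proof.
move=> la ab bh; rewrite big_mkcond.
have [[v ->]|[f [x [hx ->]]]] := point_epoint p.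
  rewrite (sum_tangents_vert (fun t => if in_seg e a b t then if t.2 then 1 else -1 else 0)%R).
  rewrite /in_seg /= !sum_only; congr (_ + _)%R.
    have [Ea|nea] := eqVneq a (lo e).
      by rewrite Ea lexx -{1}Ea ab epoint_lo // andbT -[inl _ == _]/(src e == v); case: eqP.
    have laa : lo e < a by rewrite lt_neqAle eq_sym nea.
    rewrite [a <= _]leNgt laa andbF; case: eqP => // /eqP /epoint_eq_inl [|].
      by rewrite leNgt laa.
    by rewrite leNgt (lt_le_trans ab bh).
  have [Eb|neb] := eqVneq b (hi e).
    by rewrite -Eb lexx ab epoint_hi ?Eb // !andbT -[inl _ == _]/(tgt e == v); case: eqP.
  have bhh : b < hi e by rewrite lt_neqAle neb.
  rewrite [_ <= b]leNgt bhh !andbF; case: eqP => [/eqP /epoint_eq_inl [|]|]; rewrite ?oppr0 //.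
    by rewrite leNgt (le_lt_trans la ab).
  by rewrite leNgt bhh.
rewrite sum_tangents_inr // !epoint_eq_in // /in_seg /= [e == f]eq_sym.
case: eqP => //= _; rewrite ?subrr ?addr0 //.
have [xa|ax|Ea] := ltgtP a x%:E; have [xb|bx|Eb] := ltgtP b x%:E => //=; rewrite ?oppr0 ?addr0 ?add0r //.
- by move: ab; rewrite Eb ltNge ltW.
- by move: ab; rewrite Ea ltNge ltW.
Qed.

(** The periods of a chain of signed length [r] on [e], wherever it lies. *)
Definition edge_form (e : E) (r : R) : OmegaDual C := seg e 0 r%:E.

Lemma edge_formE e r w : edge_form e r w = ((w e)%:~R * r)%R.
Proof. by rewrite segE sube0. Qed.

Lemma edge_formD e r s : (edge_form e (r + s) = edge_form e r + edge_form e s)%R.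
Proof. by apply: od_eq => w; rewrite odD !edge_formE mulrDr. Qed.

Definition divisor_of_seg g e a b (D : Div C) :=
  [/\ forall p, (coeff p D = \sum_(t <- tangents p | in_seg e a b t) slope g t.1.2 t.2)%R,
      deg D = 0%R &
      forall p0, (AJ p0 D = - \pi_(Jac C) (edge_form e (fine (g b) - fine (g a))))%R].

Lemma divisor_of_seg_ex g e a b : lo e <= a -> a < b -> b <= hi e -> PL_on g a b ->
  exists D, divisor_of_seg g e a b D.
Proof.
move=> la ab bh gPL.
pose P x y := exists D, divisor_of_seg g e x y D.
suff : P a b by [].
apply: (@PL_on_ind P g a b) gPL ab => [x y s ax xy yb F|x m y ax xm my yb [D1 [c1 d1 a1]] [D2 [c2 d2 a2]]].
  have lx := le_trans la ax; have yh := le_trans yb bh.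
  have rx : lo e <= x <= hi e by rewrite lx (le_trans (ltW xy)).
  have ry : lo e <= y <= hi e by rewrite yh (le_trans lx) ?ltW.
  exists (<< s *g epoint e x >> - << s *g epoint e y >>)%R; split=> [p||p0].
  - rewrite coeffB !coeffU -mulrBr -sum_seg_tangents // mulr_sumr.
    rewrite big_seq_cond [RHS]big_seq_cond; apply: eq_bigr => -[[f z] d] /andP[_].
    case/andP=> /= _ hz; rewrite (slope_affine xy hz F).
    by case: (d); rewrite ?mulr1 ?mulrN1.
  - by rewrite degB !degU subrr.
  - rewrite raddfB /= !AJU -mulrzBl (mu_seg p0 rx ry) opprD addrA subrr add0r mulNrz.
    rewrite -jacMz; congr (- \pi_(Jac C) _)%R; apply: od_eq => w.
    rewrite odMz segE edge_formE.
    have [le|le] := boolP (leaf e); first by rewrite leaf_cycle // !mul0r.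
    have [c hc] := F; rewrite !hc ?lexx ?ltW //.
    have [[x' ->] [y' ->]] : (exists r, x = r%:E) /\ (exists r, y = r%:E).
      by split; apply: (coord_finite le).
    rewrite /=; ring.
exists (D1 + D2)%R; split=> [p||p0].
- rewrite coeffD c1 c2 big_mkcond [X in (_ + X)%R]big_mkcond [RHS]big_mkcond.
  under [RHS]eq_bigr do rewrite (in_seg_split _ _ _ xm my).
  by rewrite big_split.
- by rewrite degD d1 d2 addr0.
- rewrite raddfD /= a1 a2 -opprD -jacD; congr (- \pi_(Jac C) _)%R.
  by rewrite -edge_formD addrC subrKA.
Qed.

Definition edge_order (G : E -> \bar R -> \bar R) (p : Point C) : int :=
  (\sum_(t <- tangents p) slope (G t.1.1) t.1.2 t.2)%R.

(** Stokes' theorem on the curve.  It suffices to treat a function that is affine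
    on a segment and absent elsewhere: its divisor is a multiple of the difference
    of the two ends.  No matching is required at the vertices, so the theorem
    applies to global functions (Abel) and to the branches of the multivalued
    theta function (Jacobi) alike. *)
Lemma divisor_of_edge_functions (G : E -> \bar R -> \bar R) :
  (forall e, PL_on (G e) (lo e) (hi e)) -> exists D : Div C,
  [/\ forall p, coeff p D = edge_order G p, deg D = 0%R &
      forall p0, (AJ p0 D = - \pi_(Jac C)
        (\sum_e edge_form e (fine (G e (hi e)) - fine (G e (lo e)))))%R].
Proof.
move=> GPL.
have /(@boolp.choice E (Div C) (fun e D => divisor_of_seg (G e) e (lo e) (hi e) D))[D hD] :
    forall e, exists D, divisor_of_seg (G e) e (lo e) (hi e) D.
  by move=> e; apply: divisor_of_seg_ex; rewrite ?lo_lt_hi.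
exists (\sum_e D e)%R; split=> [p||p0].
- rewrite raddf_sum /edge_order /=.
  under eq_bigr => e _ do [have [-> _ _] := hD e; rewrite big_mkcond].
  rewrite exchange_big /= big_seq [RHS]big_seq; apply: eq_bigr => -[[e a] d] /tangentsP[_ h].
  rewrite (bigD1 e) //= big1 ?addr0; first by rewrite /in_seg /= eqxx h.
  by move=> f /negbTE fe; rewrite /in_seg /= eq_sym fe.
- by rewrite raddf_sum big1 // => e _; have [] := hD e.
- rewrite raddf_sum jac_sum -sumrN; apply: eq_bigr => e _ /=.
  by have [_ _ h] := hD e; apply: h.
Qed.

End PiecewiseLinear.

(** * Piecewise linearity of theta along an edge *)

Section ThetaDivisor.
Variables (R : realType) (C : tropCurve R).
Local Notation V := (vert C).
Local Notation E := (edge C).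
Local Notation len := (@len R C).

Lemma seq_max (T : eqType) (f : T -> R) (L : seq T) : L != [::] ->
  exists2 l, l \in L & forall l', l' \in L -> f l' <= f l.
Proof.
elim: L => // l L IH _; case: (eqVneq L [::]) => [->|/IH[m mL hm]].
  by exists l; rewrite ?mem_head // => l'; rewrite inE => /eqP ->.
have [lm|ml] := leP (f l) (f m).
  exists m; rewrite ?inE ?mL ?orbT // => l'; rewrite inE => /orP[/eqP ->|/hm] //.
exists l; rewrite ?mem_head // => l'; rewrite inE => /orP[/eqP -> //|/hm h].
exact: le_trans h (ltW ml).
Qed.

Lemma fin_between (a b : R) (x : \bar R) : (a%:E <= x <= b%:E)%E -> exists r, x = r%:E.
Proof.
case: x => [r| |]; first by exists r.
  by rewrite leye_eq andbF.
by rewrite leeNy_eq.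
Qed.

(** A maximum of finitely many affine functions with integral slopes is
    piecewise linear: its breakpoints are among the crossings of the lines. *)
Lemma PL_on_max (a b : R) (L : seq (int * R)) (h : R -> R) :
  (forall t, a <= t <= b -> forall l, l \in L -> l.1%:~R * t + l.2 <= h t) ->
  (forall t, a <= t <= b -> exists2 l, l \in L & h t = l.1%:~R * t + l.2) ->
  PL_on (fun y => (h (fine y))%:E) a%:E b%:E.
Proof.
move=> hub hatt.
exists [seq (((l.2 - l'.2) / (l'.1 - l.1)%:~R)%:E : \bar R) | l <- L, l' <- L].
move=> x y ax xy yb; have [|x' Ex] := @fin_between a b x.
  by rewrite ax ltW ?(lt_le_trans xy).
have [|y' Ey] := @fin_between a b y; first by rewrite yb ltW ?(le_lt_trans ax).
subst x y; rename x' into x; rename y' into y.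
rewrite !lee_fin lte_fin in ax xy yb => hB.
(* A line that is highest in the middle of a gap stays highest on the gap: to be
   overtaken it would have to cross another line inside. *)
pose z := (x + y) / 2.
have [xz zy] : x < z /\ z < y by rewrite !midf_lt.
have [|l lL hl] := hatt z; first by apply/andP; split; lra.
exists l.1, l.2 => t' ht'; have [t Et] := fin_between ht'.
move: ht'; rewrite Et !lee_fin /= => /andP[xt ty]; congr (_%:E).
have [|l' l'L hl'] := hatt t; first by apply/andP; split; lra.
rewrite hl'; apply/eqP; rewrite eq_le -{2}hl' hub ?andbT //; last by apply/andP; split; lra.
rewrite leNgt; apply/negP => lt_t.
have le_z : l'.1%:~R * z + l'.2 <= l.1%:~R * z + l.2 by rewrite -hl hub //; apply/andP; split; lra.
have ne : (l'.1 - l.1)%:~R != 0 :> R.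
  rewrite intr_eq0 subr_eq0; apply/eqP => El; move: lt_t le_z; rewrite El; lra.
pose u := (l.2 - l'.2) / (l'.1 - l.1)%:~R.
have hu : (l'.1 - l.1)%:~R * u = l.2 - l'.2 by rewrite /u mulrC divfK.
have /hB : u%:E \in [seq (((l.2 - l'.2) / (l'.1 - l.1)%:~R)%:E : \bar R) | l <- L, l' <- L].
  by apply/allpairsP; exists (l, l').
rewrite !lte_fin; apply/negP; rewrite negbK.
move: ne hu lt_t le_z; rewrite intrB; set m := l.1%:~R; set m' := l'.1%:~R => ne hu lt_t le_z.
have ht : 0 < (m' - m) * (t - u) by rewrite mulrBr hu; lra.
have hz : (m' - m) * (z - u) <= 0 by rewrite mulrBr hu; lra.
have [pos|neg|E0] := ltgtP (m' - m) 0; last by move: ne; rewrite E0 eqxx.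
  have : t - u < 0 by rewrite -(nmulr_rgt0 _ pos).
  have : 0 <= z - u by rewrite -(nmulr_rle0 _ pos).
  by move=> *; apply/andP; split; lra.
have : 0 < t - u by rewrite -(pmulr_rgt0 _ neg).
have : z - u <= 0 by rewrite -(pmulr_rle0 _ neg).
by move=> *; apply/andP; split; lra.
Qed.

(** Restricted to an edge, the terms of the theta series are affine functions
    whose slopes are the multiplicities of the edge in the summation cycle;
    by positivity of the quadratic form only finitely many slopes contribute. *)
Lemma Theta_PL (x : OmegaDual C) e a0 : (lo e <= a0 <= hi e)%E ->
  PL_on (fun y => (Theta (x + seg e a0 y))%:E) (lo e) (hi e).
Proof.
have [le _|le] := boolP (leaf e).
  exists [::] => u v _ _ _ _; exists 0, (Theta x) => y _.
  by rewrite seg_leaf // addr0 mul0e add0e.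
have l0 := len_gt0 le; have [a [b [Ea Eb ab El]]] := finite_edge le.
move/(coord_finite le) => [t0 ->].
suff : PL_on (fun y => (Theta (x + seg e t0%:E (fine y)%:E))%:E) a%:E b%:E.
  rewrite -Ea -Eb => -[B hB]; exists B => u v au uv vb nB.
  have [s [c hs]] := hB u v au uv vb nB; exists s, c => y huv; rewrite -hs //.
  have [|r ->] // := @coord_finite R C e y le.
  by case/andP: huv => h1 h2; rewrite (le_trans au h1) (le_trans h2 vb).
pose term (c : H1 C int) t := (c e)%:~R * t + (x c - (c e)%:~R * t0 - sqnorm c / 2).
have termE c t : term c t = (x + seg e t0%:E t%:E) c - sqnorm c / 2.
  by rewrite /term odD segE /=; ring.
pose h t := Theta (x + seg e t0%:E t%:E).
have term_le c t : term c t <= h t by rewrite termE Theta_ge.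
have h_le t M : (forall c, term c t <= M) -> h t <= M.
  by move=> hM; apply: Theta_le => c; rewrite -termE.
(* Half of the quadratic form bounds the part of the terms without slope, the
   other half outweighs the linear part for slopes larger than N. *)
pose K := \sum_e real_cycle (x *+ 2) e ^+ 2 * len e / 4 + 1.
have K0 : 0 <= K.
  by rewrite addr_ge0 // sumr_ge0 // => f _; rewrite mulr_ge0 ?invr_ge0 // mulr_ge0 ?sqr_ge0 ?len_ge0.
have xK (c : H1 C int) : x c - sqnorm c / 4 <= K.
  have := theta_term_le (x *+ 2) c; rewrite odMn mulr2n /K.
  rewrite -mulr_suml; set S := \sum_e _; lra.
have sqnorm_ge (c : H1 C int) : (c e)%:~R ^+ 2 * len e <= sqnorm c.
  rewrite /sqnorm (bigD1 e) //= lerDl sumr_ge0 // => f _.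
  by rewrite mulr_ge0 ?sqr_ge0 ?len_ge0.
pose T : R := `|a - t0| + `|b - t0|.
have hT t : a <= t <= b -> `|t - t0| <= T.
  rewrite /T => /andP[h1 h2]; rewrite ler_norml; apply/andP.
  have := ler_norm (b - t0); have := ler_norm (- (a - t0)); rewrite normrN.
  have := normr_ge0 (a - t0); have := normr_ge0 (b - t0).
  by move=> *; split; lra.
have T0 : 0 <= T by rewrite addr_ge0.
pose N := Num.bound ((K + T) * 4 / len e).
have big (c : H1 C int) t : a <= t <= b -> (N < `|c e|)%N -> term c t <= 0.
  move=> /hT ht Nc.
  have n1 : 1 <= (`|c e|%N)%:R :> R by rewrite ler1n (leq_ltn_trans (leq0n N)).
  have hn : (K + T) * 4 / len e < (`|c e|%N)%:R.
    apply: lt_trans (archi_boundP _) _; last by rewrite ltr_nat.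
    apply: divr_ge0; last exact: len_ge0.
    by apply: mulr_ge0 => //; exact: addr_ge0.
  move: n1 hn; rewrite natr_absz intr_norm; set n := `|_| => n1 hn.
  have hn' : (K + T) * 4 < n * len e by rewrite -ltr_pdivrMr.
  have nsq : (c e)%:~R ^+ 2 = n ^+ 2 :> R by rewrite /n real_normK ?num_real.
  have : (c e)%:~R * (t - t0) <= n * T.
    by apply: le_trans (ler_norm _) _; rewrite normrM ler_wpM2l.
  have := xK c; have := sqnorm_ge c; rewrite nsq /term => h1 h2 h3.
  have h4 : n * ((K + T) * 4) <= n * (n * len e) by rewrite ler_wpM2l ?ltW //; lra.
  have h5 : K <= n * K by rewrite ler_peMl.
  nra.
pose ns : seq int := [seq (i%:Z - N%:Z) | i <- iota 0 (N + N).+1].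
have nsP (n : int) : (`|n| <= N)%N -> n \in ns.
  move=> hn; apply/mapP; exists `|(n + N%:Z)%R|%N; last by lia.
  by rewrite mem_iota; lia.
pose Bset n := [set x c - (c e)%:~R * t0 - sqnorm c / 2 | c in [set c : H1 C int | c e = n]].
pose L := [seq (n, sup (Bset n)) | n <- ns & `[< exists c : H1 C int, c e = n >]].
have supB (c : H1 C int) : has_sup (Bset (c e)).
  split; first by exists (x c - (c e)%:~R * t0 - sqnorm c / 2), c.
  exists (h t0 - (c e)%:~R * t0) => _ [d /= dc <-].
  by have := term_le d t0; rewrite /term dc; lra.
apply: (@PL_on_max a b L h) => t hab.
  move=> _ /mapP[n + ->] /=; rewrite mem_filter => /andP[/asboolP[c cn] _].
  rewrite addrC -lerBrDr -cn; apply: (ge_sup (supB c).1) => _ [d /= dc <-].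
  by have := term_le d t; rewrite /term dc; lra.
have inL (c : H1 C int) : (`|c e| <= N)%N -> (c e, sup (Bset (c e))) \in L.
  by move=> hc; apply: map_f; rewrite mem_filter nsP // andbT; apply/asboolP; exists c.
have Ln : L != [::].
  have := inL 0; rewrite H10 => /(_ isT); by case: (L).
have [l lL hl] := seq_max (fun l => l.1%:~R * t + l.2) Ln.
have small (c : H1 C int) : (`|c e| <= N)%N -> term c t <= l.1%:~R * t + l.2.
  move=> hc; apply: le_trans (hl _ (inL c hc)) => /=; rewrite lerD2l.
  by apply: (ub_le_sup (supB c).2); exists c.
exists l => //; apply/eqP; rewrite eq_le; apply/andP; split.
  apply: h_le => c; have [hc|hc] := leqP `|c e| N; first exact: small.
  apply: le_trans (big c t hab hc) _; apply: le_trans (small 0 _); last by rewrite H10.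
  by rewrite /term H10 form0 /sqnorm big1 ?mul0r ?subr0 ?addr0 // => f _; rewrite H10 expr0n mul0r.
case/mapP: lL => n + ->; rewrite mem_filter /= => /andP[/asboolP[c cn] _].
rewrite addrC -lerBrDr -cn; apply: (ge_sup (supB c).1) => _ [d /= dc <-].
by have := term_le d t; rewrite /term dc; lra.
Qed.

End ThetaDivisor.

(** * Jacobi inversion *)

Section Inversion.
Variables (R : realType) (C : tropCurve R).
Local Notation V := (vert C).
Local Notation E := (edge C).
Local Notation len := (@len R C).

Lemma PL_on_tangent (g : \bar R -> \bar R) l h a d : PL_on g l h ->
  (if d then l <= a < h else l < a <= h)%E -> exists x y s,
  [/\ (x < y)%E, (l <= x)%E, (y <= h)%E,
      (if d then x <= a < y else x < a <= y)%E & affine_on g x y s].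
Proof.
case=> B hB; case: d => /andP[h1 h2].
  have [r [ar rh Br]] := gapr B h2; have [s hs] := hB a r h1 ar rh Br.
  by exists a, r, s; rewrite lexx ar.
have [r [ra hr Br]] := gapl B h1; have [s hs] := hB r a hr ra h2 Br.
by exists r, a, s; rewrite lexx ra.
Qed.

Section Base.
Variable p0 : Point C.
Local Notation AJ_lift := (AJ_lift p0).
Local Notation fund_cycle := (fund_cycle (anchor p0)).

(** On each edge the lift at its source is continued, where [theta_div] has a lift
    near each point. *)
Definition theta_edge (j : OmegaDual C) (e : E) (y : \bar R) : \bar R :=
  (Theta (AJ_lift (inl (src e)) - j + seg e (lo e) y))%:E.

Definition period (p : Point C) : H1 C int :=
  sval (cid (path_to_lift p0 p)).

Lemma path_to_period p : path_integral (path_to p0 p) = AJ_lift p + chain_form (period p).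
Proof. by rewrite /period; case: cid. Qed.

(** By quasi-periodicity, a change of the lift of the Abel-Jacobi map by a period
    [c] adds to theta an affine function with slope [c e] along [e]. *)
Lemma slope_theta_lift j e a d x (c : H1 C int) : (lo e <= a <= hi e)%E ->
  (if d then (lo e <= a < hi e)%E else (lo e < a <= hi e)%E) ->
  x + seg e a (lo e) = AJ_lift (inl (src e)) + chain_form c ->
  slope (fun y => (Theta (x + seg e a y - j))%:E) a d =
  slope (theta_edge j e) a d + (if d then c e else - c e).
Proof.
move=> ra hd Ex; have Gpl : PL_on (theta_edge j e) (lo e) (hi e).
  by apply: Theta_PL; exact: lo_range.
have [u [v [s [uv lu vh hdd [k hk]]]]] := PL_on_tangent Gpl hd.
rewrite (slope_affine uv hdd (ex_intro _ k hk)).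
have F : affine_on (fun y => (Theta (x + seg e a y - j))%:E) u v (s + c e).
  pose m := (AJ_lift (inl (src e)) - j) c + sqnorm c / 2 -
    (c e)%:~R * fine (lo e).
  exists (k + m) => y huv; have ry : (lo e <= y <= hi e)%E.
    by case/andP: huv => h1 h2; rewrite (le_trans lu h1) (le_trans h2 vh).
  have -> : x + seg e a y - j = AJ_lift (inl (src e)) - j + seg e (lo e) y + chain_form c.
    rewrite (seg_trans ra (lo_range e) ry) addrA Ex.
    by apply: od_eq => w; rewrite !(odD, odN); ring.
  rewrite Theta_quasi odD segE /m.
  have := hk y huv; rewrite /theta_edge.
  have [le|le] := boolP (leaf e).
    rewrite leaf_cycle // addr0 !mul0r subr0 addr0 => h.
    by rewrite -addrA EFinD h -addeA -EFinD.
  have [y' Ey] := coord_finite le ry; have [l' El] := coord_finite le (lo_range e).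
  rewrite Ey El /= => -[->]; congr (_%:E); rewrite intrD; ring.
by rewrite (slope_affine uv hdd F); case: (d); rewrite // opprD.
Qed.

Definition theta_correction : Div C := \sum_e << fund_cycle e e *g inl (tgt e) >>.

Definition theta_slope (j : Jac C) (p : Point C) (t : tangent C) : int :=
  slope (fun y => (Theta (path_integral (path_to p0 p) + seg t.1.1 t.1.2 y - repr j))%:E)
    t.1.2 t.2.

Lemma theta_slopeE j p e a d (c : H1 C int) : (lo e <= a <= hi e)%E ->
  (if d then (lo e <= a < hi e)%E else (lo e < a <= hi e)%E) ->
  path_integral (path_to p0 p) + seg e a (lo e) = AJ_lift (inl (src e)) + chain_form c ->
  theta_slope j p (e, a, d) =
  slope (theta_edge (repr j) e) a d + (if d then c e else - c e).
Proof. exact: slope_theta_lift. Qed.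

(** At the target of an edge, the lift continued from the source differs from the
    one chosen there by the fundamental cycle of the edge.  All other changes of
    lift contribute a cycle, which is balanced at every vertex. *)
Lemma theta_div_edges (j : Jac C) (D : Div C) :
  (forall p, coeff p D = edge_order (theta_edge (repr j)) p) ->
  theta_div p0 j = D + theta_correction.
Proof.
move=> hD; apply: fsum_coeff => p; rewrite coeffD hD.
have -> : \sum_(t <- tangents p) (let: (e, a, d) := t in
      slope (fun y => (Theta (path_integral (path_to p0 p)
               + path_integral [:: (e, a, y)] - repr j))%:E) a d) =
    \sum_(t <- tangents p) theta_slope j p t.
  by apply: eq_bigr => -[[e a] d] _.
have [[v ->]|[e [x [hx ->]]]] := point_epoint p; last first.
  rewrite /edge_order !sum_tangents_inr // [(_, _).1.1]/= [(_, _).1.2]/= [(_, _).2]/=.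
  have rx := in_range hx; have /andP[x1 x2] := hx.
  have [c Ec] := AJ_lift_epoint p0 rx.
  have E0 : path_integral (path_to p0 (epoint e x%:E)) + seg e x%:E (lo e) =
      AJ_lift (inl (src e)) + chain_form (c + period (epoint e x%:E)).
    rewrite path_to_period Ec (seg_sym rx (lo_range e)).
    have -> : chain_form (c + period (epoint e x%:E)) = chain_form c + chain_form (period (epoint e x%:E)).
      by rewrite -chain_formD.
    by apply: od_eq => w; rewrite !(odD, odN); ring.
  rewrite (@theta_slopeE j _ _ _ true _ rx _ E0); last by rewrite ltW ?x2.
  rewrite (@theta_slopeE j _ _ _ false _ rx _ E0); last by rewrite x1 ltW.
  rewrite addrACA subrr addr0 raddf_sum big1 ?addr0 // => f _.
  by rewrite /= coeffU epoint_in mulr0.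
rewrite /edge_order !sum_tangents_vert.
pose c := period (inl v).
have Elo e : src e == v -> theta_slope j (inl v) (e, lo e, true) =
    slope (theta_edge (repr j) e) (lo e) true + c e.
  move=> /eqP Ev; apply: (@theta_slopeE j _ _ _ true _ (lo_range e)).
    by rewrite lexx lo_lt_hi.
  by rewrite seg_refl ?lo_range // addr0 path_to_period Ev.
have Ehi e : tgt e == v -> theta_slope j (inl v) (e, hi e, false) =
    slope (theta_edge (repr j) e) (hi e) false + (fund_cycle e e - c e).
  move=> /eqP Ev; rewrite -opprB -H1B.
  apply: (@theta_slopeE j _ _ _ false _ (hi_range e)).
    by rewrite lexx lo_lt_hi.
  rewrite (seg_sym (hi_range e) (lo_range e)) path_to_period -Ev.
  have -> : chain_form (c - fund_cycle e) = chain_form c - chain_form (fund_cycle e) by rewrite -chain_formB.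
  have -> : AJ_lift (inl (tgt e)) = AJ_lift (inl (src e)) + seg e (lo e) (hi e) -
    chain_form (fund_cycle e) by rewrite AJ_lift_tgt addrK.
  by rewrite /c -Ev; apply: od_eq => w; rewrite !(odD, odN); ring.
rewrite (eq_bigr _ Elo) (eq_bigr _ Ehi).
rewrite !big_split /= sumrN addrACA; congr (_ + _).
have -> : coeff (inl v) theta_correction = \sum_(e | tgt e == v) fund_cycle e e.
  rewrite raddf_sum [RHS]big_mkcond; apply: eq_bigr => e _ /=.
  by rewrite coeffU -[inl _ == _]/(tgt e == v); case: eqP; rewrite ?mulr1 ?mulr0.
have := cycle_boundary c v; rewrite ffunE => /eqP; rewrite subr_eq0 => /eqP ->.
by rewrite addrCA subrr addr0.
Qed.

(** A lift of minus kappa, as it comes out of Stokes' theorem. *)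
Definition theta_const : OmegaDual C :=
  \sum_e AJ_lift (inl (tgt e)) *~ fund_cycle e e -
  \sum_e edge_form e (AJ_lift (inl (tgt e)) (fund_cycle e) + sqnorm (fund_cycle e) / 2).

(** Cycles are orthogonal to differentials. *)
Lemma edge_form_potential (F : V -> R) :
  \sum_e edge_form e (F (tgt e) - F (src e)) = 0.
Proof.
apply: od_eq => w; rewrite od_sum od0 -[RHS](cycle_potential w F).
by apply: eq_bigr => e _; rewrite edge_formE mulrC mulrzr.
Qed.

(** The expansion of cycles in fundamental cycles, seen on functionals. *)
Lemma edge_form_eval (x : OmegaDual C) : \sum_e edge_form e (x (fund_cycle e)) = x.
Proof.
apply: od_eq => w; rewrite od_sum [in RHS](cycle_fund_cycle (anchor p0) w) form_sum.
by apply: eq_bigr => e _; rewrite edge_formE formMz mulrC.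
Qed.

(** Jacobi inversion.  The increment of the theta function along an edge is,
    by quasi-periodicity and up to a vertex potential, the value of its argument
    on the fundamental cycle of the edge; summing over the edges recovers that
    argument, so the translation [j] comes back with a constant. *)
Lemma AJ_theta_div j : AJ p0 (theta_div p0 j) = j + \pi_(Jac C) theta_const.
Proof.
have [D [hD _ aD]] := @divisor_of_edge_functions R C (theta_edge (repr j))
  (fun e => Theta_PL _ (lo_range e)).
rewrite (theta_div_edges hD) raddfD /= aD.
have -> : AJ p0 theta_correction =
    \pi_(Jac C) (\sum_e AJ_lift (inl (tgt e)) *~ fund_cycle e e).
  rewrite raddf_sum jac_sum; apply: eq_bigr => e _.
  by rewrite /= AJU mu_lift jacMz.
rewrite -[X in _ = X + _](jac_repr j) -jacN -!jacD; congr (\pi_(Jac C) _).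
rewrite /theta_const.
set T := fun v => Theta (AJ_lift (inl v) - repr j).
have -> : \sum_e edge_form e (fine (theta_edge (repr j) e (hi e)) -
      fine (theta_edge (repr j) e (lo e))) =
    \sum_e edge_form e (T (tgt e) - T (src e)) +
    \sum_e edge_form e (AJ_lift (inl (tgt e)) (fund_cycle e) + sqnorm (fund_cycle e) / 2) -
    \sum_e edge_form e ((repr j) (fund_cycle e)).
  have key e : edge_form e (fine (theta_edge (repr j) e (hi e)) -
      fine (theta_edge (repr j) e (lo e))) = edge_form e (T (tgt e) - T (src e)) +
      edge_form e (AJ_lift (inl (tgt e)) (fund_cycle e) + sqnorm (fund_cycle e) / 2) -
      edge_form e ((repr j) (fund_cycle e)).
    rewrite -edge_formD; apply: od_eq => w; rewrite odB !edge_formE -mulrBr.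
    congr (_ * _); rewrite /theta_edge [fine _]/= [X in _ - X]/=.
    rewrite seg_refl ?lo_range // addr0 [X in Theta X - _]addrAC AJ_lift_tgt.
    rewrite [X in Theta X - _]addrAC Theta_quasi odB /T; ring.
  by rewrite (eq_bigr _ (fun e _ => key e)) sumrB big_split.
rewrite edge_form_potential edge_form_eval add0r.
by apply: od_eq => w; rewrite !(odD, odN); ring.
Qed.

Lemma kappaE : kappa p0 = - \pi_(Jac C) theta_const.
Proof.
have h : (forall j, AJ p0 (theta_div p0 j) + - \pi_(Jac C) theta_const = j).
  by move=> j; rewrite AJ_theta_div addrK.
have := @xgetPex _ 0 [set k | forall j, AJ p0 (theta_div p0 j) + k = j].
rewrite -/(kappa p0) => /(_ (ex_intro _ _ h) 0) /eqP.
by rewrite AJ_theta_div add0r addrC addr_eq0 => /eqP.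
Qed.

End Base.
End Inversion.

(** * The constant of Jacobi inversion *)

Section RiemannConstant.
Variables (R : realType) (C : tropCurve R).
Local Notation V := (vert C).
Local Notation E := (edge C).
Local Notation len := (@len R C).

(* On a leaf the role of the midpoint is played by an infinite end. *)
Definition midpoint (e : E) : \bar R :=
  if hi e == +oo%E then hi e else if lo e == -oo%E then lo e
  else ((fine (lo e) + fine (hi e)) / 2)%:E.

Lemma midpoint_finite e (a b : R) : lo e = a%:E -> hi e = b%:E ->
  midpoint e = ((a + b) / 2)%:E.
Proof. by rewrite /midpoint => -> ->. Qed.

Lemma midpoint_range e : (lo e <= midpoint e <= hi e)%E.
Proof.
have [le|/finite_edge[a [b [Ea Eb ab _]]]] := boolP (leaf e).
  rewrite /midpoint; case: ifP => hh; first exact: hi_range.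
  by move: le; rewrite /leaf hh orbF => ->; exact: lo_range.
rewrite (midpoint_finite Ea Eb) Ea Eb !lee_fin; apply/andP; split; lra.
Qed.

Definition mid_point (e : E) : Point C := epoint e (midpoint e).

Lemma seg_midpoint e : seg e (midpoint e) (hi e) = edge_form e (len e / 2).
Proof.
apply: od_eq => w; rewrite segE edge_formE.
have [le|/finite_edge[a [b [Ea Eb ab El]]]] := boolP (leaf e).
  by rewrite leaf_cycle // !mul0r.
by rewrite (midpoint_finite Ea Eb) Eb El /=; congr (_ * _); field.
Qed.

(** Half of the canonical divisor: each edge contributes its midpoint in the place
    of half of each end. *)
Definition K0_div : Div C := \sum_e << 1 *g mid_point e >> - \sum_v << 1 *g inl v >>.

Lemma deg_sum (I : finType) (F : I -> Div C) : deg (\sum_i F i) = \sum_i deg (F i).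
Proof. exact: raddf_sum. Qed.

Lemma deg_points (I : finType) (F : I -> Point C) : deg (\sum_i << 1 *g F i >>) = #|I|%:Z.
Proof.
rewrite deg_sum; under eq_bigr do rewrite degU.
by rewrite sumr_const natz.
Qed.

Lemma deg_K0_div : deg K0_div = #|E|%:Z - #|V|%:Z.
Proof. by rewrite /K0_div degB !deg_points. Qed.

Section Base.
Variable p0 : Point C.
Local Notation fund_cycle := (fund_cycle (anchor p0)).
Local Notation vchain := (vchain (anchor p0)).
Local Notation AJ_lift := (AJ_lift p0).

Lemma mu_midpoint e :
  mu p0 (mid_point e) = mu p0 (inl (tgt e)) - \pi_(Jac C) (edge_form e (len e / 2)).
Proof.
rewrite -seg_midpoint -(epoint_hi (lexx (hi e))).
by rewrite (mu_seg p0 (midpoint_range e) (hi_range e)) addrK.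
Qed.

Lemma mu_src_tgt e : mu p0 (inl (src e)) = mu p0 (inl (tgt e)) - \pi_(Jac C) (edge_form e (len e)).
Proof.
rewrite -(epoint_hi (lexx (hi e))) (mu_src p0 (hi_range e)).
suff -> : seg e (lo e) (hi e) = edge_form e (len e) by rewrite addrK.
by apply: od_eq => w; rewrite segE edge_formE.
Qed.

Definition cdot (n m : {ffun E -> int}) : R := \sum_e (n e)%:~R * (m e)%:~R * len e.

Lemma chain_form_dot n (w : H1 C int) : chain_form n w = cdot n w.
Proof. exact: chain_formE. Qed.

Lemma sqnorm_dot (w : H1 C int) : sqnorm w = cdot w w.
Proof. by apply: eq_bigr => e _; rewrite expr2. Qed.

(** Half the squared length of the fundamental cycle of [e] completes the squares
    of the chains that join the base vertex to its ends. *)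
Lemma vchain_fund_cycle e :
  cdot (vchain (tgt e)) (fund_cycle e) + sqnorm (fund_cycle e) / 2 =
  len e / 2 + (vchain (src e) e)%:~R * len e +
  (cdot (vchain (src e)) (vchain (src e)) / 2 - cdot (vchain (tgt e)) (vchain (tgt e)) / 2).
Proof.
have delta (F : E -> R) : \sum_f (f == e)%:R * F f = F e.
  rewrite (bigD1 e) //= eqxx mul1r big1 ?addr0 // => f /negbTE ->.
  by rewrite mul0r.
rewrite -(delta (fun f => len f / 2)) -(delta (fun f => (vchain (src e) f)%:~R * len f)).
rewrite sqnorm_dot /cdot !mulr_suml -sumrB -!big_split /=; apply: eq_bigr => f _; rewrite fund_cycleE !(intrD, mulrNz).
case: eqP => [->|_]; rewrite /=; field => //.
Qed.

Lemma boundary_sum I (r : seq I) (P : pred I) (F : I -> {ffun E -> int}) v :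
  boundary (\sum_(i <- r | P i) F i) v = \sum_(i <- r | P i) boundary (F i) v.
Proof.
elim/big_rec2: _ => [|i a b _ <-]; last by rewrite boundaryD.
by rewrite ffunE !big1 ?subrr // => e _; rewrite ffunE.
Qed.

Definition scale_chain (k : int) (n : {ffun E -> int}) : {ffun E -> int} := [ffun e => k * n e].

Lemma boundary_scale k n v : boundary (scale_chain k n) v = k * boundary n v.
Proof.
rewrite !ffunE mulrBr !mulr_sumr.
by congr (_ - _); apply: eq_bigr => e _; rewrite ffunE.
Qed.

Lemma chain_form_scale k n : chain_form (scale_chain k n) = chain_form n *~ k.
Proof.
apply: od_eq => w; rewrite odMz !chain_formE mulr_suml; apply: eq_bigr => e _.
rewrite ffunE intrM; ring.
Qed.

Lemma chain_form_sum I (r : seq I) (P : pred I) (F : I -> {ffun E -> int}) :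
  chain_form (\sum_(i <- r | P i) F i) = \sum_(i <- r | P i) chain_form (F i).
Proof. by elim/big_rec2: _ => [|i a b _ <-]; rewrite ?chain_form0 ?chain_formD. Qed.

Lemma chain_form_edge_scale k e : chain_form (scale_chain k (edge_chain e)) = edge_form e (k%:~R * len e).
Proof.
apply: od_eq => w; rewrite chain_form_scale odMz chain_form_edge segE edge_formE -/(len e).
ring.
Qed.

(** Each chain [vchain v] with [v] different from the base vertex carries one unit
    of flow into [v]. *)
Lemma vchain_diagonal (F : V -> int) :
  \sum_e (vchain (tgt e) e * F (tgt e) - vchain (src e) e * F (src e)) =
  \sum_v F v * (1 - (v == anchor p0)%:R).
Proof.
have part (h : E -> V) : \sum_e vchain (h e) e * F (h e) =
    \sum_v (\sum_(e | h e == v) vchain v e) * F v.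
  rewrite (partition_big h xpredT) //=; apply: eq_bigr => v _.
  by rewrite mulr_suml; apply: eq_bigr => e /eqP <-.
rewrite sumrB !part -sumrB; apply: eq_bigr => v _.
have := boundary_vchain (anchor p0) v v; rewrite ffunE eqxx => <-; ring.
Qed.

(** The difference of the lifts of the two sides of [AJ_K0_div] is the integral
    over this chain. *)
Definition K0_cycle : {ffun E -> int} :=
  \sum_e vchain (tgt e) - \sum_v vchain v
  + \sum_e scale_chain (vchain (src e) e) (edge_chain e)
  - \sum_e scale_chain (fund_cycle e e) (vchain (tgt e)).

(** The contributions of the two ends of each edge regroup, vertex by vertex, as
    the flow into the vertex carried by its own chain. *)
Lemma K0_cycle_closed x : boundary K0_cycle x = 0.
Proof.
pose F v : int := (x == v)%:R - (x == anchor p0)%:R.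
have -> : boundary K0_cycle x = - \sum_v F v +
    \sum_e (vchain (tgt e) e * F (tgt e) - vchain (src e) e * F (src e)).
  rewrite !(boundaryB, boundaryD) !boundary_sum.
  under eq_bigr do rewrite boundary_vchain.
  under [X in _ - X + _ - _]eq_bigr do rewrite boundary_vchain.
  under [X in _ + X - _]eq_bigr do rewrite boundary_scale boundary_edge_chain.
  under [X in _ - X = _]eq_bigr do rewrite boundary_scale boundary_vchain fund_cycleE eqxx.
  have -> : \sum_e (vchain (tgt e) e * F (tgt e) - vchain (src e) e * F (src e)) =
      \sum_e F (tgt e) + \sum_e vchain (src e) e * ((x == tgt e)%:R - (x == src e)%:R) -
      \sum_e (1 - vchain (tgt e) e + vchain (src e) e) * F (tgt e).
    by rewrite -big_split -sumrB; apply: eq_bigr => e _; rewrite /F /=; ring.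
  rewrite /F; ring.
rewrite vchain_diagonal; apply/eqP; rewrite addrC subr_eq0; apply/eqP/eq_bigr => v _.
have F0 : F (anchor p0) = 0 by rewrite /F subrr.
by have [->|_] := eqVneq v (anchor p0); rewrite ?F0 ?mul0r // subr0 mulr1.
Qed.

(** The trace of the projection of chains onto cycles, hence the genus. *)
Lemma sum_fund_cycle_diag : \sum_e fund_cycle e e = #|E|%:Z - #|V|%:Z + 1.
Proof.
have := vchain_diagonal (fun=> 1).
rewrite (eq_bigr (fun e => 1 - fund_cycle e e)); last first.
  by move=> e _; rewrite fund_cycleE eqxx /=; ring.
rewrite [RHS](eq_bigr (fun v => 1 - (v == anchor p0)%:R)); last by move=> v _; rewrite mul1r.
have d1 : \sum_v ((v == anchor p0)%:R : int) = 1.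
  by rewrite (bigD1 (anchor p0)) //= eqxx big1 ?addr0 // => v /negbTE ->.
rewrite !sumrB !sumr_const !natz d1 => h.
have {}h : #|E|%:Z - \sum_e fund_cycle e e = #|V|%:Z - 1 := h.
by rewrite -[\sum_e _]opprK -[- \sum_e _](addKr #|E|%:Z) h; ring.
Qed.

Lemma AJ_sum (I : finType) (F : I -> Div C) :
  AJ p0 (\sum_i F i) = \sum_i AJ p0 (F i).
Proof. exact: raddf_sum. Qed.

Lemma AJ_lift_vert v : AJ_lift (inl v) = chain_form (vchain v) - offset p0.
Proof. by rewrite /AJ_lift [offset (inl v)]/= [anchor (inl v)]/= sub0r addrC. Qed.

(** Completing squares turns the quadratic part of the constant of Jacobi inversion
    into half-lengths of edges, which the midpoints account for; what remains is
    a period. *)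
Lemma AJ_K0_div : AJ p0 K0_div = \pi_(Jac C) (theta_const p0).
Proof.
pose X : OmegaDual C := \sum_e (AJ_lift (inl (tgt e)) - edge_form e (len e / 2)) -
  \sum_v AJ_lift (inl v).
have -> : AJ p0 K0_div = \pi_(Jac C) X.
  rewrite /K0_div AJB !AJ_sum /X jacB !jac_sum; congr (_ - _).
    by apply: eq_bigr => e _; rewrite /= AJU mulr1z mu_midpoint mu_lift jacB.
  by apply: eq_bigr => v _; rewrite /= AJU mulr1z mu_lift.
apply/jac_eqP.
suff -> : X - theta_const p0 = chain_form K0_cycle by exact/closed_Lambda/K0_cycle_closed.
have quad : \sum_e edge_form e (AJ_lift (inl (tgt e)) (fund_cycle e) + sqnorm (fund_cycle e) / 2) =
    \sum_e edge_form e (len e / 2) +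
    \sum_e chain_form (scale_chain (vchain (src e) e) (edge_chain e)) - offset p0.
  pose G v : R := - (cdot (vchain v) (vchain v) / 2).
  have key e : edge_form e (AJ_lift (inl (tgt e)) (fund_cycle e) + sqnorm (fund_cycle e) / 2) =
      edge_form e (len e / 2) + chain_form (scale_chain (vchain (src e) e) (edge_chain e))
      - edge_form e (offset p0 (fund_cycle e)) + edge_form e (G (tgt e) - G (src e)).
    rewrite AJ_lift_vert odB chain_form_dot chain_form_edge_scale.
    apply: od_eq => w; rewrite !(odD, odN) !edge_formE /G.
    have := vchain_fund_cycle e; set a := cdot _ (fund_cycle e).
    set s := sqnorm _; set b := cdot (vchain (src e)) _; set d := cdot (vchain (tgt e)) (vchain (tgt e)).
    by move=> h; rewrite addrAC h; field.
  rewrite (eq_bigr _ (fun e _ => key e)) big_split sumrB big_split /=.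
  by rewrite edge_form_potential addr0 edge_form_eval.
have S1 : \sum_e (AJ_lift (inl (tgt e)) - edge_form e (len e / 2)) =
    \sum_e chain_form (vchain (tgt e)) - offset p0 *+ #|E| - \sum_e edge_form e (len e / 2).
  rewrite sumrB; congr (_ - _); rewrite -sumr_const -sumrB.
  by apply: eq_bigr => e _; rewrite AJ_lift_vert.
have S2 : \sum_v AJ_lift (inl v) = \sum_v chain_form (vchain v) - offset p0 *+ #|V|.
  by rewrite -sumr_const -sumrB; apply: eq_bigr => v _; rewrite AJ_lift_vert.
have S3 : \sum_e AJ_lift (inl (tgt e)) *~ fund_cycle e e =
    \sum_e chain_form (scale_chain (fund_cycle e e) (vchain (tgt e))) -
    offset p0 *~ \sum_e fund_cycle e e.
  rewrite mulrz_sumr -sumrB; apply: eq_bigr => e _.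
  by rewrite AJ_lift_vert mulrzBl chain_form_scale.
rewrite /X /theta_const quad S1 S2 S3 sum_fund_cycle_diag.
rewrite /K0_cycle !(chain_formB, chain_formD) !chain_form_sum.
apply: od_eq => w; rewrite !(odD, odN, odMn, odMz) !(intrD, mulrNz) /=.
rewrite -!pmulrn -[_ *+ #|E|]mulr_natr -[_ *+ #|V|]mulr_natr; ring.
Qed.

End Base.
End RiemannConstant.

(** * Principal divisors *)

Section Abel.
Variables (R : realType) (C : tropCurve R).
Local Notation V := (vert C).
Local Notation E := (edge C).
Local Notation len := (@len R C).

Lemma PL_on_ext (g g' : \bar R -> \bar R) a b :
  (forall y, (a <= y <= b)%E -> g y = g' y) -> PL_on g a b -> PL_on g' a b.
Proof.
move=> gg [B hB]; exists B => x y ax xy yb nB.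
have [s [c h]] := hB x y ax xy yb nB; exists s, c => z /andP[h1 h2].
by rewrite -gg ?h ?h1 ?h2 // (le_trans ax h1) (le_trans h2 yb).
Qed.

Lemma slope_ext (g g' : \bar R -> \bar R) l h a d :
  (forall y, (l <= y <= h)%E -> g y = g' y) -> PL_on g l h ->
  (if d then l <= a < h else l < a <= h)%E -> slope g a d = slope g' a d.
Proof.
move=> gg gPL hd; have [x [y [s [xy lx yh hd' F]]]] := PL_on_tangent gPL hd.
rewrite (slope_affine xy hd' F) (@slope_affine R g' x y a d s) //.
have [c hc] := F; exists c => z /andP[h1 h2].
by rewrite -gg ?hc ?h1 ?h2 // (le_trans lx h1) (le_trans h2 yh).
Qed.

Lemma eq_edge_order (G G' : E -> \bar R -> \bar R) p :
  (forall e y, (lo e <= y <= hi e)%E -> G e y = G' e y) ->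
  (forall e, PL_on (G e) (lo e) (hi e)) -> edge_order G p = edge_order G' p.
Proof.
move=> GG GPL; rewrite /edge_order big_seq [RHS]big_seq.
apply: eq_bigr => -[[e a] d] /tangentsP[_ h] /=.
by apply: (@slope_ext _ _ (lo e) (hi e)) => // y; apply: GG.
Qed.

Lemma glue_PL (G : E -> \bar R -> \bar R) (f : Point C -> \bar R) :
  (forall e y, (lo e <= y <= hi e)%E -> f (epoint e y) = G e y) ->
  (forall e, PL_on (G e) (lo e) (hi e)) ->
  (forall p, valence p != 1%N -> f p \is a fin_num) ->
  is_PL f /\ forall p, order_at f p = edge_order G p.
Proof.
move=> fG GPL ffin.
have fPL e : PL_on (f \o epoint e) (lo e) (hi e).
  by apply: PL_on_ext (GPL e) => y hy; rewrite /= fG.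
split.
  split=> // e; have [B hB] := fPL e; exists B => a b *; exact: hB.
move=> p; rewrite -(@eq_edge_order (fun e => f \o epoint e)) //.
by apply: eq_bigr => -[[e a] d].
Qed.

Lemma order_edge_order (f : Point C -> \bar R) p :
  order_at f p = edge_order (fun e => f \o epoint e) p.
Proof. by apply: eq_bigr => -[[e a] d]. Qed.

Lemma PL_PL_on (f : Point C -> \bar R) e : is_PL f -> PL_on (f \o epoint e) (lo e) (hi e).
Proof. by case=> _ /(_ e)[B hB]; exists B => a b *; apply: hB. Qed.

(** One half of Abel's theorem is Stokes' theorem for a global function. *)
Lemma principal_deg_AJ (D : Div C) : D \in @principal R C ->
  deg D = 0 /\ forall p0, AJ p0 D = 0.
Proof.
case/asboolP=> f fPL fD.
have [D' [hD' d' a']] := divisor_of_edge_functions (fun e => PL_PL_on e fPL).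
have -> : D = D'.
  by apply/eqP/freeg_eqP => p; rewrite fD hD' order_edge_order.
split=> // p0; rewrite a'.
have := edge_form_potential (fun v => fine (f (inl v))) => e0.
under eq_bigr do rewrite /= epoint_hi // epoint_lo //.
by rewrite e0 jac0 oppr0.
Qed.

Lemma principalE (f : Point C -> \bar R) (D : Div C) : is_PL f ->
  (forall p, coeff p D = order_at f p) -> D \in @principal R C.
Proof. by move=> fPL fD; apply/asboolP; exists f. Qed.

Definition clamp (x y z : \bar R) : \bar R := Order.max x (Order.min z y).

Lemma clamp_le x y z : (x < y)%E -> (z <= x)%E -> clamp x y z = x.
Proof. by move=> xy zx; rewrite /clamp; apply/max_idPl; rewrite ge_min zx. Qed.

Lemma clamp_ge x y z : (x < y)%E -> (y <= z)%E -> clamp x y z = y.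
Proof. by move=> xy yz; rewrite /clamp (min_idPr yz); apply/max_idPr/ltW. Qed.

Lemma clamp_id x y z : (x <= z <= y)%E -> clamp x y z = z.
Proof. by case/andP=> xz zy; rewrite /clamp (min_idPl zy); apply/max_idPr. Qed.

Lemma real_between (x y : \bar R) : (x < y)%E -> (x != -oo%E -> exists r, x = r%:E) *
  (y != +oo%E -> exists r, y = r%:E).
Proof.
by case: x y => [x| |] [y| |] //= _; split=> // _; [exists x|exists y|exists x|exists y].
Qed.

Lemma affine_cst (g : \bar R -> \bar R) (a b c : \bar R) : c \is a fin_num ->
  (forall z, (a <= z <= b)%E -> g z = c) -> affine_on g a b 0.
Proof.
move=> cf h; exists (fine c) => z hz.
by rewrite h // mulr0z mul0e add0e fineK.
Qed.

Lemma clamp_affine x y a b : (x < y)%E -> (a < b)%E ->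
  (b <= x)%E \/ (y <= a)%E \/ (x <= a)%E /\ (b <= y)%E ->
  affine_on (clamp x y) a b (if (x <= a < y)%E then 1 else 0).
Proof.
move=> xy ab [bx|[ya|[xa by_]]].
- rewrite [(x <= a)%E]leNgt (lt_le_trans ab bx) /=.
  apply: (@affine_cst _ _ _ x) => [|z /andP[_ zb]]; last by rewrite clamp_le ?(le_trans zb).
  have [r ->] : exists r, x = r%:E; last by [].
  apply: (real_between xy).1; apply: contraTneq ab => Ex.
  by rewrite -leNgt (le_trans bx) // Ex leNye.
- rewrite [(a < y)%E]ltNge ya andbF.
  apply: (@affine_cst _ _ _ y) => [|z /andP[za _]]; last by rewrite clamp_ge ?(le_trans ya).
  have [r ->] : exists r, y = r%:E; last by [].
  apply: (real_between xy).2; apply: contraTneq ab => Ey.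
  by rewrite -leNgt (le_trans _ ya) // Ey leey.
- rewrite xa (lt_le_trans ab by_); exists 0 => z /andP[az zb].
  by rewrite clamp_id ?(le_trans xa) ?(le_trans zb) // mul1e adde0.
Qed.

Lemma clamp_PL x y l h : (x < y)%E -> PL_on (clamp x y) l h.
Proof.
move=> xy; exists [:: x; y] => a b _ ab _ nB.
have nx := nB x (mem_head _ _); have ny : ~~ (a < y < b)%E by apply: nB; rewrite !inE eqxx orbT.
eexists; apply: clamp_affine xy ab _.
have [bx|xb] := leP b x; first by left.
have [ya|ay] := leP y a; first by right; left.
right; right; move: nx ny; rewrite xb ay andbT /= -!leNgt => -> ->; split=> //.
Qed.

Lemma clamp_slope (e : E) x y a d : (lo e <= x)%E -> (x < y)%E -> (y <= hi e)%E ->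
  (if d then lo e <= a < hi e else lo e < a <= hi e)%E ->
  slope (clamp x y) a d = if in_seg e x y (e, a, d) then (if d then 1 else -1) else 0.
Proof.
move=> lx xy yh; rewrite /in_seg eqxx /=; case: d => /andP[h1 h2].
  have [ax|xa] := ltP a x.
    have F := clamp_affine xy ax (or_introl (lexx x)).
    by rewrite (slope_affine ax _ F) ?lexx // [(x <= a)%E]leNgt ax.
  have [ay|ya] := ltP a y.
    have F := clamp_affine xy ay (or_intror (or_intror (conj xa (lexx y)))).
    by rewrite (slope_affine ay _ F) ?lexx // xa ay.
  have F := clamp_affine xy h2 (or_intror (or_introl ya)).
  by rewrite (slope_affine h2 _ F) ?lexx // [(a < y)%E]ltNge ya /= andbF.
have [ax|xa] := leP a x.
  have F := clamp_affine xy h1 (or_introl ax).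
  rewrite (slope_affine h1 _ F) ?lexx ?h1 //.
  by rewrite [(x <= lo e)%E]leNgt (lt_le_trans h1 ax) /= oppr0.
have [ay|ya] := leP a y.
  have F := clamp_affine xy xa (or_intror (or_intror (conj (lexx x) ay))).
  by rewrite (slope_affine xa _ F) ?lexx ?xa ?xy.
have F := clamp_affine xy ya (or_intror (or_introl (lexx y))).
by rewrite (slope_affine ya _ F) ?lexx ?ya // ltxx andbF oppr0.
Qed.

Lemma clamp_order (G : E -> \bar R -> \bar R) e x y p :
  (lo e <= x)%E -> (x < y)%E -> (y <= hi e)%E ->
  (forall z, (lo e <= z <= hi e)%E -> G e z = clamp x y z) ->
  (forall f, f != e -> exists2 c, c \is a fin_num &
     forall z, (lo f <= z <= hi f)%E -> G f z = c) ->
  edge_order G p = coeff p (<< 1 *g epoint e x >> - << 1 *g epoint e y >>).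
Proof.
move=> lx xy yh Ge Gf; rewrite coeffB !coeffU !mul1r -sum_seg_tangents //.
rewrite [RHS]big_mkcond /edge_order big_seq [RHS]big_seq.
apply: eq_bigr => -[[f a] d] /tangentsP[_ /= h].
have [Ef|nf] := eqVneq f e.
  rewrite {}Ef in h *; rewrite -(clamp_slope lx xy yh h).
  by apply/esym/(slope_ext _ (clamp_PL _ _ xy) h) => z /Ge ->.
rewrite /in_seg /= (negbTE nf) /=; have [c cf hc] := Gf f nf.
rewrite (slope_affine (lo_lt_hi f) h (affine_cst cf hc)).
by case: (d); rewrite ?oppr0.
Qed.

Lemma leaf_lo (e : E) : lo e = -oo%E -> vvalence (src e) = 1%N.
Proof. by move=> /eqP; rewrite lo_infinite => /eqP. Qed.
Lemma leaf_hi (e : E) : hi e = +oo%E -> vvalence (tgt e) = 1%N.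
Proof. by move=> /eqP; rewrite hi_infinite => /eqP. Qed.

(** All points of a leaf are linearly equivalent: the clamped coordinate of the
    leaf extends to the rest of the curve by a constant. *)
Lemma leaf_principal_lt e x y : leaf e -> (lo e <= x)%E -> (x < y)%E -> (y <= hi e)%E ->
  << 1 *g epoint e x >> - << 1 *g epoint e y >> \in @principal R C.
Proof.
move=> le lx xy yh.
(* The value off the leaf.  When both ends are infinite the leaf is a connected
   component, and any finite value will do. *)
pose c : \bar R := if hi e == +oo%E then (if x == -oo%E then 0%E else x) else y.
have xfin : lo e != -oo%E -> x \is a fin_num.
  move=> l0; have [|r -> //] := (real_between xy).1.
  by apply: contra l0 => /eqP Ex; rewrite -leeNy_eq -Ex.
have yfin : hi e != +oo%E -> y \is a fin_num.
  move=> l0; have [|r -> //] := (real_between xy).2.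
  by apply: contra l0 => /eqP Ey; rewrite -leye_eq -Ey.
have cfin : c \is a fin_num.
  rewrite /c; have [h0|h0] := eqVneq (hi e) +oo%E; last exact: yfin.
  by have [//|x0] := eqVneq x -oo%E; have [r ->] := (real_between xy).1 x0.
pose f (p : Point C) : \bar R := match p with
  | inl v => if v == tgt e then y else if v == src e then x else c
  | inr u => if (val u).1 == e then clamp x y (val u).2%:E else c
  end.
have nloop : src e != tgt e.
  apply/eqP => st; move: le; rewrite /leaf lo_infinite hi_infinite st orbb -st => /eqP v1.
  by have := @val1_edge R C (e, true) (e, false) v1 (esym st).
have f_inl v k : (v = src k \/ v = tgt k) -> k != e -> f (inl v) = c.
  move=> vk nk; rewrite /f /c; have [Ev|nv] := eqVneq v (tgt e).
    case: eqP => // /leaf_hi h1; case: vk nk => Ek.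
      by have [->] := @val1_edge R C (e, false) (k, true) h1 (etrans (esym Ek) Ev); rewrite eqxx.
    by have [->] := @val1_edge R C (e, false) (k, false) h1 (etrans (esym Ek) Ev); rewrite eqxx.
  have [Ev|//] := eqVneq v (src e).
  have h1 : lo e != -oo%E.
    apply/negP => /eqP/leaf_lo h1; case: vk nk => Ek.
      by have [->] := @val1_edge R C (e, true) (k, true) h1 (etrans (esym Ek) Ev); rewrite eqxx.
    by have [->] := @val1_edge R C (e, true) (k, false) h1 (etrans (esym Ek) Ev); rewrite eqxx.
  move: le; rewrite /leaf (negbTE h1) /= => ->.
  by have := xfin h1; case: (x).
have f_e z : (lo e <= z <= hi e)%E -> f (epoint e z) = clamp x y z.
  case/andP=> h1 h2; have [zl|lz] := leP z (lo e).
    by rewrite epoint_lo //= (negbTE nloop) eqxx clamp_le // (le_trans zl).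
  have [hz|zh] := leP (hi e) z.
    by rewrite epoint_hi //= eqxx clamp_ge // (le_trans yh).
  case: z lz zh {h1 h2} => [z| |] lz zh.
  - have hz : (lo e < z%:E < hi e)%E by rewrite lz zh.
    by rewrite (epoint_in hz) /= eqxx.
  - by move: zh; rewrite ltNge leey.
  - by move: lz; rewrite ltNge leNye.
have f_k k z : k != e -> (lo k <= z <= hi k)%E -> f (epoint k z) = c.
  move=> nk /andP[h1 h2]; have [zl|lz] := leP z (lo k).
    by rewrite epoint_lo // (f_inl _ k) //; left.
  have [hz|zh] := leP (hi k) z.
    by rewrite epoint_hi // (f_inl _ k) //; right.
  case: z lz zh {h1 h2} => [z| |] lz zh.
  - have hz : (lo k < z%:E < hi k)%E by rewrite lz zh.
    by rewrite (epoint_in hz) /= (negbTE nk).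
  - by move: zh; rewrite ltNge leey.
  - by move: lz; rewrite ltNge leNye.
have [] := @glue_PL (fun k => f \o epoint k) f.
- by [].
- move=> k; have [->|nk] := eqVneq k e.
    by apply: PL_on_ext (clamp_PL _ _ xy) => z hz; rewrite /= f_e.
  exists [::] => a b la ab bh _; exists 0; apply: (affine_cst cfin) => z /andP[az zb] /=.
  by rewrite f_k // (le_trans la az) (le_trans zb bh).
- case=> [v|[[k z] hz]].
    rewrite valence_inl /= => v1; case: eqP => [Ev|_].
      by apply: yfin; rewrite hi_infinite -Ev.
    by case: eqP => [Ev|_] //; apply: xfin; rewrite lo_infinite -Ev.
  move=> _ /=; case: eqP => // _; have [zx|xz] := leP z%:E x.
    rewrite clamp_le //; have [|r -> //] := (real_between xy).1.
    by apply: contraTneq zx => ->; rewrite leeNy_eq.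
  have [yz|zy] := leP y z%:E; last by rewrite clamp_id // !ltW.
  rewrite clamp_ge //; have [|r -> //] := (real_between xy).2.
  by apply: contraTneq yz => ->; rewrite leye_eq.
move=> fPL fo; apply: (principalE fPL) => p; rewrite fo.
apply/esym/(clamp_order _ lx xy yh) => [z /f_e //|k nk].
by exists c => // z; apply: f_k.
Qed.

Lemma leaf_principal e x y : leaf e -> (lo e <= x <= hi e)%E -> (lo e <= y <= hi e)%E ->
  << 1 *g epoint e x >> - << 1 *g epoint e y >> \in @principal R C.
Proof.
move=> le /andP[lx xh] /andP[ly yh]; have [xy|yx|->] := ltgtP x y.
- exact: leaf_principal_lt.
- by rewrite -opprB rpredN; apply: leaf_principal_lt.
- by rewrite subrr rpred0.
Qed.

End Abel.

(** * Abel's theorem *)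

Section AbelConverse.
Variables (R : realType) (C : tropCurve R).
Local Notation V := (vert C).
Local Notation E := (edge C).
Local Notation len := (@len R C).

(** Finite values and zeros on the leaves avoid sums of opposite infinities; the
    points of a leaf are equivalent anyway. *)
Definition edge_family (G : E -> \bar R -> \bar R) := forall e,
  PL_on (G e) (lo e) (hi e) /\ forall y, (lo e <= y <= hi e)%E ->
    G e y \is a fin_num /\ (leaf e -> G e y = 0%E).

Definition family_div (D : Div C) := exists2 G, edge_family G &
  forall p, coeff p D = edge_order G p.

Lemma family_sub (G1 G2 : E -> \bar R -> \bar R) : edge_family G1 -> edge_family G2 ->
  edge_family (fun e y => G1 e y - G2 e y)%E /\
  forall p, edge_order (fun e y => G1 e y - G2 e y)%E p = edge_order G1 p - edge_order G2 p.
Proof.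
move=> h1 h2.
have piece e x y s1 s2 : (lo e <= x)%E -> (y <= hi e)%E -> affine_on (G1 e) x y s1 ->
    affine_on (G2 e) x y s2 -> ~~ leaf e ->
    affine_on (fun y => G1 e y - G2 e y)%E x y (s1 - s2).
  move=> lx yh [c1 F1] [c2 F2] le; exists (c1 - c2) => z /andP[xz zy].
  rewrite F1 ?xz // F2 ?xz //.
  have [r ->] : exists r, z = r%:E.
    by apply: (coord_finite le); rewrite (le_trans lx xz) (le_trans zy).
  by rewrite -!EFinM -!EFinD -?EFinB; congr (_%:E); rewrite intrB; ring.
have zero e : leaf e -> forall y, (lo e <= y <= hi e)%E -> (G1 e y - G2 e y)%E = 0%E.
  move=> le y hy; have [_ /(_ y hy)[_ ->] //] := h1 e.
  by have [_ /(_ y hy)[_ ->] //] := h2 e; rewrite sube0.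
have zero_aff (G : \bar R -> \bar R) (e : E) x y : (forall y, (lo e <= y <= hi e)%E -> G y = 0%E) ->
    (lo e <= x)%E -> (y <= hi e)%E -> affine_on G x y 0.
  move=> hG lx yh; apply: (@affine_cst _ _ _ _ 0%E) => // z /andP[xz zy].
  by rewrite hG // (le_trans lx xz) (le_trans zy).
split=> [e|p].
  split.
    have [le|le] := boolP (leaf e).
      exists [::] => x y lx xy yh _; exists 0.
      exact: (zero_aff (fun y => (G1 e y - G2 e y)%E) e x y (zero e le) lx yh).
    have [[B1 P1] _] := h1 e; have [[B2 P2] _] := h2 e.
    exists (B1 ++ B2) => x y lx xy yh nB.
    have [|s1 F1] := P1 x y lx xy yh.
      by move=> z zB; apply: nB; rewrite mem_cat zB.
    have [|s2 F2] := P2 x y lx xy yh.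
      by move=> z zB; apply: nB; rewrite mem_cat zB orbT.
    by exists (s1 - s2); apply: piece.
  move=> y hy; split; last by move=> le; apply: zero.
  have [_ /(_ y hy)[f1 _]] := h1 e; have [_ /(_ y hy)[f2 _]] := h2 e.
  by rewrite fin_numB f1 f2.
rewrite /edge_order -sumrB big_seq [RHS]big_seq.
apply: eq_bigr => -[[e a] d] /tangentsP[_ h] /=.
have [le|le] := boolP (leaf e).
  have z1 : forall y, (lo e <= y <= hi e)%E -> G1 e y = 0%E.
    by move=> y hy; have [_ /(_ y hy)[_ ->]] := h1 e.
  have z2 : forall y, (lo e <= y <= hi e)%E -> G2 e y = 0%E.
    by move=> y hy; have [_ /(_ y hy)[_ ->]] := h2 e.
  rewrite (slope_affine (lo_lt_hi e) h (zero_aff _ e _ _ z1 (lexx _) (lexx _))).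
  rewrite (slope_affine (lo_lt_hi e) h (zero_aff _ e _ _ z2 (lexx _) (lexx _))).
  rewrite (slope_affine (lo_lt_hi e) h (zero_aff _ e _ _ (zero e le) (lexx _) (lexx _))).
  by case: (d); rewrite ?oppr0 subrr.
have [[B1 P1] _] := h1 e; have [[B2 P2] _] := h2 e.
have [x [y [lx xy yh [hd nB]]]] : exists x y, [/\ (lo e <= x)%E, (x < y)%E, (y <= hi e)%E &
    (if d then x <= a < y else x < a <= y)%E /\ forall z, z \in B1 ++ B2 -> ~~ (x < z < y)%E].
  case: d h => /andP[la ah].
    have [r [ar rh Br]] := gapr (B1 ++ B2) ah.
    by exists a, r; split=> //; split=> //; rewrite lexx.
  have [r [ra hr Br]] := gapl (B1 ++ B2) la.
  by exists r, a; split=> //; split=> //; rewrite lexx andbT.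
have [|s1 F1] := P1 x y lx xy yh; first by move=> z zB; apply: nB; rewrite mem_cat zB.
have [|s2 F2] := P2 x y lx xy yh; first by move=> z zB; apply: nB; rewrite mem_cat zB orbT.
rewrite (slope_affine xy hd F1) (slope_affine xy hd F2).
rewrite (slope_affine xy hd (piece e x y s1 s2 lx yh F1 F2 le)).
by case: (d); rewrite // opprB opprK addrC.
Qed.

Lemma family_div_sub D1 D2 : family_div D1 -> family_div D2 -> family_div (D1 - D2).
Proof.
case=> G1 h1 c1 [G2 h2 c2]; have [h3 c3] := family_sub h1 h2.
by exists (fun e y => G1 e y - G2 e y)%E => // p; rewrite coeffB c1 c2 c3.
Qed.

Lemma family_div0 : family_div 0.
Proof.
exists (fun=> fun=> 0%E) => [e|p].
  split=> //; exists [::] => x y *; exists 0; exact: (@affine_cst _ _ _ _ 0%E).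
rewrite coeff0 /edge_order big_seq big1 // => -[[e a] d] /tangentsP[_ h] /=.
have F : affine_on (fun=> 0%E) (lo e) (hi e) (0 : int) by exact: (@affine_cst R _ _ _ 0%E).
by rewrite (slope_affine (lo_lt_hi e) h F); case: (d); rewrite ?oppr0.
Qed.

Lemma family_seg_lt e x y : ~~ leaf e -> (lo e <= x)%E -> (x < y)%E -> (y <= hi e)%E ->
  family_div (<< 1 *g epoint e x >> - << 1 *g epoint e y >>).
Proof.
move=> le lx xy yh.
pose G (f : E) (z : \bar R) : \bar R := if f == e then clamp x y z else 0%E.
exists G => [f|p].
  rewrite /G; case: eqP => [->|_].
    split; first exact: clamp_PL.
    move=> z hz; split; last by rewrite (negbTE le).
    have [r ->] := coord_finite le hz.
    have [|x' ->] := coord_finite le (x := x).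
      by rewrite lx (le_trans (ltW xy)).
    have [|y' ->] := coord_finite le (x := y).
      by rewrite yh (le_trans lx) // ltW.
    by rewrite /clamp -EFin_min -EFin_max.
  split=> //; exists [::] => u v *; exists 0; exact: (@affine_cst _ _ _ _ 0%E).
rewrite -(@clamp_order _ _ G e x y p) //; first by move=> z _; rewrite /G eqxx.
by move=> f nf; exists 0%E => // z _; rewrite /G (negbTE nf).
Qed.

Lemma family_seg e x y : ~~ leaf e -> (lo e <= x <= hi e)%E -> (lo e <= y <= hi e)%E ->
  family_div (<< 1 *g epoint e x >> - << 1 *g epoint e y >>).
Proof.
move=> le /andP[lx xh] /andP[ly yh]; have [xy|yx|->] := ltgtP x y.
- exact: family_seg_lt.
- by rewrite -opprB -sub0r; apply: family_div_sub family_div0 _; apply: family_seg_lt.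
- by rewrite subrr; apply: family_div0.
Qed.

(** These divisors form a group; it contains the difference of any two points of an
    edge, hence by connectedness all divisors of degree 0. *)
Definition tame_div (D : Div C) := exists2 D', family_div D' & D - D' \in @principal R C.

Lemma tame_sub D1 D2 : tame_div D1 -> tame_div D2 -> tame_div (D1 - D2).
Proof.
case=> D1' f1 p1 [D2' f2 p2]; exists (D1' - D2'); first exact: family_div_sub.
have -> : D1 - D2 - (D1' - D2') = (D1 - D1') - (D2 - D2').
  by rewrite !opprB addrACA [RHS]addrACA [- D2 - D1']addrC.
exact: rpredB.
Qed.

Lemma tame0 : tame_div 0.
Proof. by exists 0; [exact: family_div0 | rewrite subrr rpred0]. Qed.

Lemma tame_add D1 D2 : tame_div D1 -> tame_div D2 -> tame_div (D1 + D2).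
Proof.
move=> t1 t2; rewrite -[D2]opprK -[- D2]sub0r.
by apply: tame_sub => //; apply: tame_sub => //; exact: tame0.
Qed.

Lemma tame_path s (p q : Point C) : is_path p s q -> tame_div (<< 1 *g p >> - << 1 *g q >>).
Proof.
elim: s p => [|[[e x] y] s IH] p /=; first by move=> ->; rewrite subrr; exact: tame0.
case=> -> hx hy /IH t.
have -> : << 1 *g epoint e x >> - << 1 *g q >> = (<< 1 *g epoint e x >> - << 1 *g epoint e y >>) +
   (<< 1 *g epoint e y >> - << 1 *g q >>) :> Div C by rewrite addrA subrK.
apply: tame_add t; have [le|le] := boolP (leaf e).
  by exists 0; [exact: family_div0 | rewrite subr0; exact: leaf_principal].
by exists (<< 1 *g epoint e x >> - << 1 *g epoint e y >>);
  [exact: family_seg | rewrite subrr rpred0].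
Qed.

Lemma tame_deg0 (D : Div C) : deg D = 0 -> tame_div D.
Proof.
move=> D0; have [v0 _] : exists v0 : V, true by have /card_gt0P[v _] := graph_nonempty C; exists v.
pose p0 : Point C := inl v0.
have -> : D = \sum_(p <- dom D) (<< 1 *g p >> - << 1 *g p0 >>) *~ coeff p D.
  under eq_bigr do rewrite mulrzBl.
  rewrite sumrB -mulrz_sumr -[D in LHS]freeg_sumE.
  have -> : \sum_(p <- dom D) coeff p D = deg D.
    by rewrite -{3}[D]freeg_sumE raddf_sum /=; apply: eq_bigr => p _; rewrite degU.
  rewrite D0 mulr0z subr0; apply: eq_bigr => p _.
  by rewrite freeg_mulz intz.
elim/big_rec: _ => [|p D' _]; first exact: tame0.
apply: tame_add; have [s hs] := is_path_ex p p0; have t := tame_path hs.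
have tn n : tame_div ((<< 1 *g p >> - << 1 *g p0 >>) *+ n).
  by elim: n => [|n IH]; rewrite ?mulr0n ?mulrS; [exact: tame0 | exact: tame_add].
case: (coeff p D) => n; first by rewrite -pmulrn.
by rewrite NegzE mulrNz -pmulrn -sub0r; apply: tame_sub tame0 _.
Qed.

(** A family with Abel-Jacobi image 0 has, after subtraction of an integral
    cycle, increments orthogonal to all cycles; these are the differences of a
    vertex potential, which glues the family to a function on the curve. *)
Lemma family_principal p0 (D : Div C) : family_div D -> AJ p0 D = 0 -> D \in @principal R C.
Proof.
case=> G hG cG aD.
pose Delta e := fine (G e (hi e)) - fine (G e (lo e)).
have [D' [c' _ a']] := @divisor_of_edge_functions R C G (fun e => (hG e).1).
have ED : D = D' by apply/eqP/freeg_eqP => p; rewrite cG c'.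
have /LambdaP[c hc] : \sum_e edge_form e (Delta e) \in @Lambda R C.
  have /jac_eqP : \pi_(Jac C) (\sum_e edge_form e (Delta e)) = \pi_(Jac C) 0.
    by rewrite jac0; apply/eqP; rewrite -oppr_eq0 -(a' p0) -ED aD.
  by rewrite subr0.
(* A cycle is balanced at every vertex, so subtracting it keeps the divisor. *)
pose H e (y : \bar R) : \bar R :=
  (if leaf e then 0 else G e y - ((c e)%:~R * (fine y - fine (lo e)))%:E)%E.
pose Dl e : R := Delta e - (c e)%:~R * len e.
pose n := vchain (anchor p0).
pose F v : R := \sum_e (n v e)%:~R * Dl e.
have pot e : F (tgt e) - F (src e) = Dl e.
  have h0 : \sum_f (fund_cycle (anchor p0) e f)%:~R * Dl f = 0.
    transitivity ((\sum_f edge_form f (Delta f)) (fund_cycle (anchor p0) e) -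
        chain_form c (fund_cycle (anchor p0) e)); last by rewrite hc subrr.
    rewrite od_sum chain_formE -sumrB; apply: eq_bigr => f _.
    by rewrite edge_formE /Dl; ring.
  apply/eqP; rewrite eq_sym -subr_eq0 -h0 /F opprB addrA; apply/eqP.
  have -> : Dl e = \sum_f (f == e)%:R * Dl f.
    rewrite (bigD1 e) //= eqxx mul1r big1 ?addr0 // => f /negbTE ->.
    by rewrite mul0r.
  rewrite -big_split -sumrB; apply: eq_bigr => f _ /=.
  by rewrite fund_cycleE !(intrD, mulrNz) /n; case: eqP => _ /=; ring.
pose f (p : Point C) : \bar R := match p with
  | inl v => (F v)%:E
  | inr u => ((F (src (val u).1) - fine (G (val u).1 (lo (val u).1)))%:E +
              (if leaf (val u).1 then 0 else
              G (val u).1 (val u).2%:E - ((c (val u).1)%:~R * ((val u).2 - fine (lo (val u).1)))%:E))%E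
  end.
pose K e y : \bar R := ((F (src e) - fine (G e (lo e)))%:E + H e y)%E.
have fin e y : (lo e <= y <= hi e)%E -> G e y \is a fin_num by move=> hy; have [_ /(_ y hy)[]] := hG e.
have Gleaf e y : leaf e -> (lo e <= y <= hi e)%E -> G e y = 0%E.
  by move=> le hy; have [_ /(_ y hy)[_ ->]] := hG e.
have flo e : f (inl (src e)) = K e (lo e).
  rewrite /f /K /H; have [le|le] := boolP (leaf e).
    by rewrite Gleaf ?lo_range // subr0 adde0.
  rewrite subrr mulr0 sube0 -{2}(fineK (fin e _ (lo_range e))) -EFinD.
  by rewrite subrK.
have fhi e : f (inl (tgt e)) = K e (hi e).
  have := pot e; rewrite /f /K /H /Dl /Delta; have [le|le] := boolP (leaf e).
    rewrite leaf_cycle // !Gleaf ?lo_range ?hi_range // mul0r subrr subr0 adde0 subr0.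
    by move/eqP; rewrite subr_eq0 => /eqP ->.
  have [a [b [Ea Eb ab El]]] := finite_edge le.
  rewrite -{2}(fineK (fin e _ (hi_range e))) -EFinB -EFinD => h; congr (_%:E).
  have -> : fine (hi e) - fine (lo e) = len e by rewrite El Ea Eb.
  move/eqP: h; rewrite subr_eq => /eqP ->; ring.
have fK e y : (lo e <= y <= hi e)%E -> f (epoint e y) = K e y.
  move=> hy; have [yl|ly] := leP y (lo e).
    rewrite epoint_lo // flo; congr (K e _); apply/eqP.
    by case/andP: hy => h1 _; rewrite eq_le h1 yl.
  have [hy'|yh] := leP (hi e) y.
    rewrite epoint_hi // fhi; congr (K e _); apply/eqP.
    by case/andP: hy => _ h1; rewrite eq_le h1 hy'.
  case: y ly yh {hy} => [z| |] lz zh.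
  - have hz : (lo e < z%:E < hi e)%E by rewrite lz zh.
    by rewrite (epoint_in hz).
  - by move: zh; rewrite ltNge leey.
  - by move: lz; rewrite ltNge leNye.
have Kaff e x y s : ~~ leaf e -> (lo e <= x)%E -> (y <= hi e)%E ->
    affine_on (G e) x y s -> affine_on (K e) x y (s - c e).
  move=> le lx yh [k hk].
  have [a [b [Ea Eb ab El]]] := finite_edge le.
  exists (F (src e) - fine (G e (lo e)) + k + (c e)%:~R * a) => z /andP[xz zy].
  rewrite /K /H (negbTE le) (hk z) ?xz //.
  have [r ->] : exists r, z = r%:E.
    by apply: (coord_finite le); rewrite (le_trans lx xz) (le_trans zy).
  rewrite Ea -!EFinM -!EFinD -?EFinB -?EFinD intrB /=. congr (_%:E); ring.
have Kcst e : leaf e -> forall x y, affine_on (K e) x y 0.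
  move=> le x y; exists (F (src e) - fine (G e (lo e))) => z _.
  by rewrite /K /H le mul0e adde0 add0e.
have KPL e : PL_on (K e) (lo e) (hi e).
  have [[B hB] _] := hG e; exists B => x y lx xy yh nB.
  have [le|le] := boolP (leaf e); first by exists 0; exact: Kcst.
  by have [s hs] := hB x y lx xy yh nB; exists (s - c e); apply: Kaff.
have [] := glue_PL fK KPL.
  case=> [v //|[[e z] hz]] _ /=; case: ifP => _; first by rewrite adde0.
  have hz' := in_range hz.
  by rewrite -(fineK (fin e _ hz')).
move=> fPL fo; apply: (principalE fPL) => p; rewrite fo cG.
have slo t : t \in tangents p -> slope (K t.1.1) t.1.2 t.2 =
    slope (G t.1.1) t.1.2 t.2 - (if t.2 then c t.1.1 else - c t.1.1).
  case: t => [[e a] d] /tangentsP[_ h] /=.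
  have [le|le] := boolP (leaf e).
    have F0 : affine_on (G e) (lo e) (hi e) 0.
      by apply: (@affine_cst _ _ _ _ 0%E) => // z hz; apply: Gleaf.
    rewrite (slope_affine (lo_lt_hi e) h F0).
    rewrite (slope_affine (lo_lt_hi e) h (Kcst e le _ _)) leaf_cycle // oppr0.
    by case: (d); rewrite ?oppr0 subr0.
  have [x [y [s [xy lx yh hd hs]]]] := PL_on_tangent (hG e).1 h.
  rewrite (slope_affine xy hd hs) (slope_affine xy hd (Kaff e x y s le lx yh hs)).
  by case: (d); rewrite // opprB opprK addrC.
rewrite /edge_order [RHS]big_seq (eq_bigr _ slo) -big_seq sumrB.
rewrite [X in _ - X](_ : _ = 0) ?subr0 //.
have [[v ->]|[e [x [hx ->]]]] := point_epoint p; last first.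
  by rewrite sum_tangents_inr //= subrr.
rewrite sum_tangents_vert /= sumrN.
by have := cycle_boundary c v; rewrite ffunE => /eqP; rewrite subr_eq0 => /eqP ->; rewrite subrr.
Qed.

(** The other half of Abel's theorem. *)
Lemma Abel p0 (D : Div C) : deg D = 0 -> AJ p0 D = 0 -> D \in @principal R C.
Proof.
move=> /tame_deg0[D' fD' pD] aD.
suff pD' : D' \in @principal R C by rewrite -[D](subrK D') rpredD.
apply: (family_principal (p0 := p0) fD').
have [_ /(_ p0)] := principal_deg_AJ pD.
by rewrite AJB aD sub0r => /eqP; rewrite oppr_eq0 => /eqP.
Qed.

End AbelConverse.

(** * Genus, Picard group and the canonical class *)

Section Genus.
Variables (R : realType) (C : tropCurve R).
Local Notation V := (vert C).
Local Notation E := (edge C).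

Local Notation CE := {ffun E -> R^o}.
Local Notation CV := {ffun V -> R^o}.

Lemma boundary_linear : linear (@boundary R C R^o : CE -> CV).
Proof.
move=> k a b; apply/ffunP => v; rewrite !ffunE scalerBr !scaler_sumr addrACA -opprD -!big_split.
by congr (_ - _); apply: eq_bigr => e _; rewrite !ffunE.
Qed.

HB.instance Definition _ :=
  GRing.isLinear.Build R CE CV *:%R (@boundary R C R^o : CE -> CV) boundary_linear.

Definition vert_total (d : CV) : R^o := \sum_v d v.

Lemma vert_total_linear : linear vert_total.
Proof.
move=> k a b; rewrite /vert_total scaler_sumr -big_split.
by apply: eq_bigr => v _; rewrite !ffunE.
Qed.

HB.instance Definition _ := GRing.isLinear.Build R CV R^o *:%R vert_total vert_total_linear.

(** A vertex function with sum 0 is the boundary of the chain that carries all its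
    values in from a base vertex. *)
Lemma limg_boundary :
  limg (linfun (@boundary R C R^o : CE -> CV)) = lker (linfun vert_total).
Proof.
have [v0 _] : exists v0 : V, true by have /card_gt0P[v _] := graph_nonempty C; exists v.
apply/vspaceP => d; apply/idP/idP; rewrite memv_ker lfunE.
  case/memv_imgP => c _ ->; rewrite lfunE /= /vert_total.
  have := sum_by_parts_real c (fun=> 1).
  under [X in _ = X -> _]eq_bigr do rewrite mulr1.
  by move=> <-; rewrite big1 // => e _; rewrite subrr mulr0.
move=> /eqP d0.
pose n := vchain v0.
suff -> : d = linfun (@boundary R C R^o : CE -> CV) (\sum_v d v *: (ofint (n v) : CE)).
  by rewrite memv_img ?memvf.
rewrite linear_sum /=; under eq_bigr do rewrite lfunE linearZ /=.
apply/ffunP => x; rewrite sum_ffunE.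
under eq_bigr do rewrite ffunE boundary_ofint boundary_vchain intrB scalerBr.
rewrite sumrB (bigD1 x) //= eqxx big1 ?addr0 => [|v /negbTE xv].
  rewrite -scaler_suml -[\sum_i _]/(vert_total d) d0 scale0r subr0.
  by rewrite /GRing.scale /= mulr1.
by rewrite eq_sym xv scaler0.
Qed.

Lemma genusE : (genus C)%:Z = #|E|%:Z - #|V|%:Z + 1.
Proof.
have [v0 _] : exists v0 : V, true by have /card_gt0P[v _] := graph_nonempty C; exists v.
have dE : \dim {:CE} = #|E| by rewrite dimvf /dim /= muln1.
have dV : \dim {:CV} = #|V| by rewrite dimvf /dim /= muln1.
have h1 := limg_ker_dim (linfun (@boundary R C R^o : CE -> CV)) fullv.
have h2 := limg_ker_dim (linfun vert_total) fullv.
rewrite !capfv in h1 h2; rewrite limg_boundary dE in h1.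
have h3 : \dim (limg (linfun vert_total)) = 1%N.
  apply/eqP; rewrite eqn_leq; apply/andP; split.
    by apply: leq_trans (dimvS (subvf _)) _; rewrite dimvf.
  rewrite lt0n dimv_eq0 -subv0; apply/negP => /subvP h.
  have := h (linfun vert_total [ffun v => (v == v0)%:R]) (memv_img _ (memvf _)).
  rewrite memv0 lfunE /= /vert_total (bigD1 v0) //= ffunE eqxx big1 ?addr0 ?oner_eq0 //.
  by move=> v /negbTE vv; rewrite ffunE vv.
rewrite dV h3 in h2; rewrite /genus; lia.
Qed.

End Genus.

Section Picard.
Variables (R : realType) (C : tropCurve R).
Local Notation V := (vert C).
Local Notation E := (edge C).

Lemma cls_eqP (D1 D2 : Div C) : reflect (cls D1 = cls D2) (D1 - D2 \in @principal R C).
Proof. by rewrite Quotient.idealrBE; apply: eqP. Qed.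

Lemma clsB (D1 D2 : Div C) : cls (D1 - D2) = cls D1 - cls D2.
Proof. exact: raddfB. Qed.
Lemma clsD (D1 D2 : Div C) : cls (D1 + D2) = cls D1 + cls D2.
Proof. exact: raddfD. Qed.

Lemma cls_repr (x : Pic C) : exists D : Div C, x = cls D.
Proof. by exists (repr x); rewrite /cls reprK. Qed.

Lemma cls_deg (D1 D2 : Div C) : cls D1 = cls D2 -> deg D1 = deg D2.
Proof.
move=> /cls_eqP /principal_deg_AJ[]; rewrite degB => /eqP.
by rewrite subr_eq0 => /eqP.
Qed.

Lemma Pic_deg_cls (D : Div C) : Pic_deg (deg D) (cls D).
Proof. by exists D. Qed.

Lemma Pic_degB d1 d2 (x y : Pic C) : Pic_deg d1 x -> Pic_deg d2 y -> Pic_deg (d1 - d2) (x - y).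
Proof. by case=> D1 <- <- [D2 <- <-]; exists (D1 - D2); rewrite ?clsB ?degB. Qed.

Lemma Pic_degD d1 d2 (x y : Pic C) : Pic_deg d1 x -> Pic_deg d2 y -> Pic_deg (d1 + d2) (x + y).
Proof. by case=> D1 <- <- [D2 <- <-]; exists (D1 + D2); rewrite ?clsD ?degD. Qed.

Section Base.
Variable p0 : Point C.

Lemma phi_cls (D : Div C) : phi p0 (cls D) = AJ p0 D.
Proof.
have : cls (repr (cls D)) = cls D by rewrite /cls reprK.
move=> /cls_eqP /principal_deg_AJ[_ /(_ p0)]; rewrite AJB => /eqP.
by rewrite subr_eq0 => /eqP.
Qed.

Lemma phiB (x y : Pic C) : phi p0 (x - y) = phi p0 x - phi p0 y.
Proof.
have [D1 ->] := cls_repr x; have [D2 ->] := cls_repr y.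
by rewrite -clsB !phi_cls AJB.
Qed.

Lemma phi0 : phi p0 0 = 0.
Proof. by have := phiB 0 0; rewrite !subrr. Qed.

Lemma phiD (x y : Pic C) : phi p0 (x + y) = phi p0 x + phi p0 y.
Proof.
by have := phiB x (- y); rewrite opprK => ->; rewrite -[- y]sub0r phiB phi0 sub0r opprK.
Qed.

Lemma phi_inj d (x y : Pic C) : Pic_deg d x -> Pic_deg d y -> phi p0 x = phi p0 y -> x = y.
Proof.
case=> D1 <- d1 [D2 <- d2]; rewrite !phi_cls => a12.
by apply/cls_eqP/(Abel (p0 := p0)); rewrite ?degB ?AJB ?d1 ?d2 ?a12 subrr.
Qed.

Lemma K0_phi : Pic_deg ((genus C)%:Z - 1) (K0 p0) /\ phi p0 (K0 p0) = AJ p0 (K0_div C).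
Proof.
have h : Pic_deg ((genus C)%:Z - 1) (cls (K0_div C)) /\ phi p0 (cls (K0_div C)) = - kappa p0.
  split; first by exists (K0_div C) => //; rewrite deg_K0_div genusE addrK.
  by rewrite phi_cls kappaE opprK AJ_K0_div.
have := @xgetPex _ 0 [set x | Pic_deg ((genus C)%:Z - 1) x /\ phi p0 x = - kappa p0].
move=> /(_ (ex_intro _ _ h)); rewrite -/(K0 p0) => -[h1 h2]; split=> //.
by rewrite h2 kappaE opprK AJ_K0_div.
Qed.

(** Both classes have degree [g - 1] and Abel-Jacobi image [- kappa]. *)
Lemma K0_cls : K0 p0 = cls (K0_div C).
Proof.
have [h1 h2] := K0_phi; apply: (phi_inj h1).
  by exists (K0_div C) => //; rewrite deg_K0_div genusE addrK.
by rewrite h2 phi_cls.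
Qed.

Definition K_div : Div C :=
  \sum_e (<< 1 *g inl (src e) >> + << 1 *g inl (tgt e) >>) - \sum_v << 2 *g inl v >>.

Lemma vvalenceE v : (vvalence v)%:Z = \sum_(e : E) ((src e == v)%:R + (tgt e == v)%:R).
Proof.
rewrite /vvalence -sum1_card -natz natr_sum /=.
rewrite big_mkcond /= -(pair_bigA _ (fun e d => if hend (e, d) == v then 1 else 0)) /=.
apply: eq_bigr => e _; rewrite big_bool /hend /=.
by congr (_ + _); case: eqP.
Qed.

Lemma coeff_sum (I : finType) (F : I -> Div C) p :
  coeff p (\sum_i F i) = \sum_i coeff p (F i).
Proof. exact: raddf_sum. Qed.

Lemma coeff_K_div p : coeff p K_div = (valence p)%:Z - 2.
Proof.
rewrite /K_div coeffB !coeff_sum.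
under eq_bigr do rewrite coeffD !coeffU !mul1r.
under [X in _ - X = _]eq_bigr do rewrite coeffU.
have [[v ->]|[e [x [hx ->]]]] := point_epoint p.
  rewrite valence_inl vvalenceE; congr (_ - _).
  rewrite (bigD1 v) //= eqxx mulr1 big1 ?addr0 // => w /negbTE wv.
  by rewrite -[inl _ == _]/(w == v) wv mulr0.
by rewrite epoint_in /valence /= !big1 ?subrr // => e' _; rewrite ?addr0 ?mulr0.
Qed.

Lemma canonical_divE : canonical_div C = K_div.
Proof. exact: fsum_coeff coeff_K_div. Qed.

Lemma AJ_canonical : AJ p0 (canonical_div C) = AJ p0 (K0_div C) *+ 2.
Proof.
rewrite canonical_divE /K_div /K0_div !AJB !AJ_sum mulrnBl -!sumrMnl.
congr (_ - _); last by apply: eq_bigr => v _; rewrite !AJU.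
apply: eq_bigr => e _; rewrite raddfD /= !AJU !mulr1z.
rewrite mu_midpoint mu_src_tgt mulrnBl -[X in _ = _ - X]raddfMn /=.
have -> : edge_form e (len e / 2) *+ 2 = edge_form e (len e).
  by apply: od_eq => w; rewrite odMn !edge_formE; field.
by rewrite mulr2n addrAC.
Qed.

Lemma deg_canonical : deg (canonical_div C) = ((genus C)%:Z - 1) *+ 2.
Proof.
rewrite canonical_divE /K_div degB !deg_sum genusE addrK.
under eq_bigr do rewrite degD !degU.
under [X in _ - X = _]eq_bigr do rewrite degU.
have h (n : nat) : (1 + 1 : int) *+ n = n%:Z *+ 2.
  by rewrite -[LHS]mulr_natr natz mulr2n mulrDl !mul1r.
by rewrite !sumr_const mulrnBl -!h.
Qed.

End Base.
End Picard.

(** * The class of minus kappa is not effective *)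

Section NotEffective.
Variables (R : realType) (C : tropCurve R).
Local Notation V := (vert C).
Local Notation E := (edge C).

(** A piecewise linear function without concave breakpoints inside an interval
    is convex there, so its slopes at the two ends are ordered and bound its
    increment. *)
Lemma convex_slopes (g : \bar R -> \bar R) a b : (a < b)%E -> PL_on g a b ->
  (forall z, (a < z < b)%E -> 0 <= slope g z true + slope g z false) ->
  slope g a true + slope g b false <= 0 /\
  forall x y : R, a = x%:E -> b = y%:E ->
    (slope g a true)%:~R * (y - x) <= fine (g b) - fine (g a) <=
    - (slope g b false)%:~R * (y - x).
Proof.
move=> ab gPL.
pose P x y := (forall z, (x < z < y)%E -> 0 <= slope g z true + slope g z false) ->
  slope g x true + slope g y false <= 0 /\
  forall u v : R, x = u%:E -> y = v%:E ->
    (slope g x true)%:~R * (v - u) <= fine (g y) - fine (g x) <=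
    - (slope g y false)%:~R * (v - u).
suff : P a b by [].
apply: (@PL_on_ind R P g a b) gPL ab => [x y s ax xy yb F _|x m y ax xm my yb h1 h2 h].
  have F1 : slope g x true = s by apply: (slope_affine (d := true) xy _ F); rewrite lexx.
  have F2 : slope g y false = - s by apply: (slope_affine (d := false) xy _ F); rewrite lexx xy.
  rewrite F1 F2 subrr mulrNz opprK; split=> // u v xu yv.
  have [c hc] := F; rewrite (hc x) ?(hc y) ?lexx ?(ltW xy) // xu yv /=.
  apply/andP; split; lra.
have [|p1 q1] := h1; first by move=> z /andP[z1 z2]; apply: h; rewrite z1 (lt_trans z2).
have [|p2 q2] := h2; first by move=> z /andP[z1 z2]; apply: h; rewrite z2 (lt_trans xm).
have pm : 0 <= slope g m true + slope g m false by apply: h; rewrite xm my.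
split; first by lia.
move=> u v xu yv.
have [w mw] : exists w, m = w%:E.
  by apply: (@fin_between R u v); rewrite -xu -yv !ltW.
have uw : u < w by rewrite -lte_fin -xu -mw.
have wv : w < v by rewrite -lte_fin -mw -yv.
have /andP[a1 b1] := q1 u w xu mw; have /andP[a2 b2] := q2 w v mw yv.
move: a1 b1 a2 b2.
have e1 : (slope g x true)%:~R <= - (slope g m false)%:~R :> R by rewrite -mulrNz ler_int; lia.
have e2 : - (slope g m false)%:~R <= (slope g m true)%:~R :> R by rewrite -mulrNz ler_int; lia.
have e3 : (slope g m true)%:~R <= - (slope g y false)%:~R :> R by rewrite -mulrNz ler_int; lia.
set s1 := _%:~R in e1 *; set t1 := (slope g m false)%:~R in e1 e2 *.
set s2 := _%:~R in e2 e3 *; set t2 := (slope g y false)%:~R in e3 *.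
move=> a1 b1 a2 b2; apply/andP; split; nra.
Qed.

Lemma fin_point (e : E) (x : \bar R) : (lo e < x < hi e)%E -> exists r, x = r%:E.
Proof.
case: x => [r| |] /andP[h1 h2]; first by exists r.
  by move: h2; rewrite ltNge leey.
by move: h1; rewrite ltNge leNye.
Qed.

Lemma mid_inside (e : E) : ~~ leaf e -> (lo e < midpoint e < hi e)%E.
Proof.
case/finite_edge=> a [b [Ea Eb ab _]].
by rewrite (midpoint_finite Ea Eb) Ea Eb !lte_fin; apply/andP; split; lra.
Qed.

Lemma mid_leaf (e : E) : leaf e -> exists2 v : V, mid_point e = inl v & vvalence v = 1%N.
Proof.
rewrite /mid_point /midpoint /leaf; have [h _|_] := eqVneq (hi e) +oo%E.
  by exists (tgt e); [rewrite epoint_hi | exact: leaf_hi h].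
rewrite orbF => h; rewrite h; exists (src e); first by rewrite epoint_lo.
by apply/eqP; rewrite -lo_infinite.
Qed.

Lemma coeff_K0_div p : coeff p (K0_div C) =
  \sum_e (mid_point e == p)%:R - \sum_(v : V) (inl v == p)%:R.
Proof.
rewrite /K0_div coeffB !coeff_sum.
by congr (_ - _); apply: eq_bigr => i _; rewrite coeffU mul1r.
Qed.

Lemma coeff_K0_in e (x : R) : (lo e < x%:E < hi e)%E ->
  coeff (epoint e x%:E) (K0_div C) = (~~ leaf e && (midpoint e == x%:E))%:R.
Proof.
move=> hx; rewrite coeff_K0_div [X in _ - X]big1 => [|v _]; last by rewrite epoint_in.
rewrite subr0 (bigD1 e) //= big1 => [|f nf]; last first.
  by rewrite /mid_point epoint_eq_in // (negbTE nf).
rewrite addr0; have [le|le] := boolP (leaf e).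
  by have [v -> _] := mid_leaf le; rewrite epoint_in.
by rewrite /mid_point epoint_eq_in // eqxx.
Qed.

Lemma sum_vert_one v : \sum_(w : V) ((inl w == inl v :> Point C)%:R : int) = 1.
Proof.
rewrite (bigD1 v) //= eqxx big1 ?addr0 // => w /negbTE wv.
by rewrite -[inl _ == _]/(w == v) wv.
Qed.

Lemma coeff_K0_vert v : vvalence v != 1%N -> coeff (inl v) (K0_div C) = -1.
Proof.
move=> v1; rewrite coeff_K0_div sum_vert_one big1 ?sub0r // => e _.
have [le|le] := boolP (leaf e).
  have [w -> w1] := mid_leaf le; rewrite -[inl _ == _]/(w == v).
  by have [wv|//] := eqVneq w v; rewrite -wv w1 in v1.
have h := mid_inside le; have [r Er] := fin_point h; rewrite Er in h.
by rewrite /mid_point Er (epoint_in h).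
Qed.

Lemma coeff_K0_leaf v : vvalence v = 1%N -> coeff (inl v) (K0_div C) <= 0.
Proof.
move=> v1; rewrite coeff_K0_div sum_vert_one subr_le0.
have inc e : mid_point e = inl v -> exists d, hend (e, d) = v.
  move=> Ev; have [le|le] := boolP (leaf e); last first.
    have h := mid_inside le; have [r Er] := fin_point h; rewrite Er in h.
    by move: Ev; rewrite /mid_point Er (epoint_in h).
  move: Ev le; rewrite /mid_point /midpoint /leaf; have [h|_] := eqVneq (hi e) +oo%E.
    by rewrite epoint_hi // => -[<-] _; exists false.
  by rewrite orbF => + h; rewrite h epoint_lo // => -[<-]; exists true.
have [/existsP[e /eqP Ee]|/existsPn h] := boolP [exists e, mid_point e == inl v]; last first.
  by rewrite big1 // => e _; rewrite (negbTE (h e)).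
rewrite (bigD1 e) //= big1 => [|f nf]; first by rewrite addr0; case: eqP.
case: eqP => // Ef; have [d hd] := inc e Ee; have [d' hd'] := inc f Ef.
have := @val1_edge R C (e, d) (f, d'); rewrite hd hd' => /(_ v1 erefl) [Ef' _].
by rewrite Ef' eqxx in nf.
Qed.

Lemma sum_pos (T : eqType) (r : seq T) (F : T -> int) :
  1 <= \sum_(i <- r) F i -> exists2 i, i \in r & 1 <= F i.
Proof.
elim: r => [|i r IH]; first by rewrite big_nil.
rewrite big_cons => h; have [h1|h1] := leP 1 (F i); first by exists i; rewrite ?mem_head.
have [|j jr hj] := IH; first by move: h; move: (\big[_/_]_(j <- r) F j) => S; lia.
by exists j; rewrite // inE jr orbT.
Qed.

(** If all vertices lie at infinity there are half as many edges as vertices. *)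
Lemma finite_vertex_or_neg :
  (exists v : V, vvalence v != 1%N) \/ deg (K0_div C) < 0.
Proof.
have [/existsP[v hv]|/existsPn h] := boolP [exists v : V, vvalence v != 1%N].
  by left; exists v.
right; rewrite deg_K0_div.
have h2 : \sum_(v : V) vvalence v = (2 * #|E|)%N.
  transitivity (\sum_(h : E * bool) 1)%N; last first.
    by rewrite sum1_card card_prod card_bool mulnC.
  rewrite (partition_big (@hend C) xpredT) //=; apply: eq_bigr => v _.
  by rewrite sum1_card.
have h1 : \sum_(v : V) vvalence v = #|V|.
  by rewrite -sum1_card; apply: eq_bigr => v _; have := h v; rewrite negbK => /eqP.
have := graph_nonempty C; rewrite -h1 h2; lia.
Qed.

Lemma deg_effective (D : Div C) : effective D -> 0 <= deg D.
Proof.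
move=> h; rewrite -[D]freeg_sumE raddf_sum /= sumr_ge0 // => p _.
by rewrite degU h.
Qed.

(** Chips on the midpoints and debts on the vertices.  Adding the divisor of [f]
    would have to produce an outgoing slope at a finite vertex where [f] is
    largest; by convexity [f] would then grow up to the midpoint of that edge,
    and the single chip there cannot make it decrease beyond, so that [f] would
    be larger at the other end. *)
Lemma K0_not_effective (D : Div C) : effective D -> cls D <> cls (K0_div C).
Proof.
move=> effD cD; have [[v0 v01]|neg] := finite_vertex_or_neg; last first.
  by have := deg_effective effD; rewrite (cls_deg cD) leNgt neg.
move/cls_eqP: cD => /asboolP[f fPL fD].
have ord p : - coeff p (K0_div C) <= order_at f p.
  by rewrite -fD coeffB lerBrDr addrC subrr effD.
have [v v1 vmax] : exists2 v : V, vvalence v != 1%N &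
    forall u : V, vvalence u != 1%N -> fine (f (inl u)) <= fine (f (inl v)).
  have [|v] := @seq_max R V (fun v => fine (f (inl v))) (enum [pred v : V | vvalence v != 1%N]).
    apply/eqP => h0; have : v0 \in enum [pred v : V | vvalence v != 1%N] by rewrite mem_enum.
    by rewrite h0.
  rewrite mem_enum => hv hm; exists v => // u hu.
  by apply: hm; rewrite mem_enum.
have fin_slope e z : (lo e < z < hi e)%E -> midpoint e != z \/ leaf e ->
    0 <= slope (f \o epoint e) z true + slope (f \o epoint e) z false.
  move=> hz; have [r Er] := fin_point hz; rewrite Er in hz * => hm.
  have := ord (epoint e r%:E); rewrite coeff_K0_in // /order_at sum_tangents_inr //.
  by case: hm => [/negbTE ->|->]; rewrite ?andbF oppr0.
have mid_slope e : ~~ leaf e -> - 1 <= slope (f \o epoint e) (midpoint e) true +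
    slope (f \o epoint e) (midpoint e) false.
  move=> le; have hm := mid_inside le; have [r Er] := fin_point hm; rewrite Er in hm *.
  by have := ord (epoint e r%:E); rewrite coeff_K0_in // Er eqxx le /order_at sum_tangents_inr.
have leaf_slope t w : vvalence w = 1%N -> t \in tangents (inl w) ->
    let: (e, a, d) := t in 0 <= slope (f \o epoint e) a d.
  move=> w1 tw; have := ord (inl w); have := coeff_K0_leaf w1.
  have := valence_inl w; rewrite w1 /valence /order_at.
  case: (tangents (inl w)) tw => [|t' [|]] //; rewrite inE => /eqP <- _.
  rewrite big_seq1; case: t => [[e a] d] h1 h2; lia.
have [|[[e a] d] tv slope1] := @sum_pos _ (tangents (inl v))
    (fun t => let: (e, a, d) := t in slope (f \o epoint e) a d).
  by have := ord (inl v); rewrite coeff_K0_vert.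
have sub_PL x y : (lo e <= x)%E -> (y <= hi e)%E -> PL_on (f \o epoint e) x y.
  by move=> lx yh; apply: PL_on_sub (PL_PL_on e fPL).
case/mapP: tv => -[e' d']; rewrite mem_enum inE /= => /eqP hv [Ee Ea Ed].
move: hv Ea; rewrite -{}Ee -{}Ed /hend /= => {e' d'}.
(* Two mirror cases: the edge leaves v from its source or from its target. *)
case: d slope1 => slope1 hv Ea.
  have l0 : lo e != -oo%E by rewrite lo_infinite hv.
  have [le|le] := boolP (leaf e).
    have hoo : hi e = +oo%E by move: le; rewrite /leaf (negbTE l0) => /eqP.
    have [||s0 _] := @convex_slopes (f \o epoint e) _ _ (lo_lt_hi e).
    - exact: sub_PL.
    - by move=> z hz; apply: fin_slope => //; right.
    have := leaf_slope _ _ (leaf_hi hoo) (tangents_hi e).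
    by rewrite -Ea in s0; lia.
  have [x [y [Ex Ey xy _]]] := finite_edge le.
  have /andP[m1 m2] := mid_inside le.
  have Em := midpoint_finite Ex Ey.
  have [||s1 /(_ x ((x + y) / 2) Ex Em) /andP[i1 _]] := @convex_slopes (f \o epoint e) _ _ m1.
  - by apply: sub_PL; rewrite // ltW.
  - move=> z /andP[z1 z2]; apply: fin_slope; first by rewrite z1 (lt_trans z2).
    by left; rewrite gt_eqF.
  have [||_ /(_ ((x + y) / 2) y Em Ey) /andP[i2 _]] := @convex_slopes (f \o epoint e) _ _ m2.
  - by apply: sub_PL; rewrite // ltW.
  - move=> z /andP[z1 z2]; apply: fin_slope; first by rewrite z2 (lt_trans m1).
    by left; rewrite lt_eqF.
  have := mid_slope e le; rewrite -Ea in s1 i1 => ms.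
  have t0 : 0 <= slope (f \o epoint e) (midpoint e) true by lia.
  have := vmax (tgt e); rewrite -hi_infinite Ey => /(_ isT).
  move: i1 i2; rewrite /= Ea (epoint_lo (lexx (lo e))) (epoint_hi (lexx (hi e))) hv.
  have : 1 <= (slope (f \o epoint e) a true)%:~R :> R by rewrite ler1z.
  have : 0 <= (slope (f \o epoint e) (midpoint e) true)%:~R :> R by rewrite ler0z.
  rewrite -/(f \o epoint e); set p := _%:~R; set q := _%:~R; move=> p0 q1.
  rewrite -Ea -/q => i1 i2 i3.
  have k1 : 0 < q * ((x + y) / 2 - x) by apply: mulr_gt0; lra.
  have k2 : 0 <= p * (y - (x + y) / 2) by apply: mulr_ge0; lra.
  by clear -i1 i2 i3 k1 k2; lra.
have h0 : hi e != +oo%E by rewrite hi_infinite hv.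
have [le|le] := boolP (leaf e).
  have loo : lo e = -oo%E by move: le; rewrite /leaf (negbTE h0) orbF => /eqP.
  have [||s0 _] := @convex_slopes (f \o epoint e) _ _ (lo_lt_hi e).
  - exact: sub_PL.
  - by move=> z hz; apply: fin_slope => //; right.
  have := leaf_slope _ _ (leaf_lo loo) (tangents_lo e).
  by rewrite -Ea in s0; lia.
have [x [y [Ex Ey xy _]]] := finite_edge le.
have /andP[m1 m2] := mid_inside le.
have Em := midpoint_finite Ex Ey.
have [||s1 /(_ ((x + y) / 2) y Em Ey) /andP[_ i1]] := @convex_slopes (f \o epoint e) _ _ m2.
- by apply: sub_PL; rewrite // ltW.
- move=> z /andP[z1 z2]; apply: fin_slope; first by rewrite z2 (lt_trans m1).
  by left; rewrite lt_eqF.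
have [||_ /(_ x ((x + y) / 2) Ex Em) /andP[_ i2]] := @convex_slopes (f \o epoint e) _ _ m1.
- by apply: sub_PL; rewrite // ltW.
- move=> z /andP[z1 z2]; apply: fin_slope; first by rewrite z1 (lt_trans z2).
  by left; rewrite gt_eqF.
have := mid_slope e le; rewrite -Ea in s1 i1 => ms.
have t0 : 0 <= slope (f \o epoint e) (midpoint e) false by lia.
have := vmax (src e); rewrite -lo_infinite Ex => /(_ isT).
move: i1 i2; rewrite /= Ea (epoint_lo (lexx (lo e))) (epoint_hi (lexx (hi e))) hv.
have : 1 <= (slope (f \o epoint e) a false)%:~R :> R by rewrite ler1z.
have : 0 <= (slope (f \o epoint e) (midpoint e) false)%:~R :> R by rewrite ler0z.
rewrite -/(f \o epoint e); set p := _%:~R; set q := _%:~R; move=> p0 q1.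
rewrite -Ea -/q => i1 i2 i3.
have k1 : 0 < q * (y - (x + y) / 2) by apply: mulr_gt0; lra.
have k2 : 0 <= p * ((x + y) / 2 - x) by apply: mulr_ge0; lra.
rewrite !mulNr in i1 i2.
by clear -i1 i2 i3 k1 k2; lra.
Qed.

End NotEffective.

(** * Eulerian orientations of even subgraphs *)

Section EulerOrientation.
Variables (R : realType) (C : tropCurve R).
Local Notation V := (vert C).
Local Notation E := (edge C).

Lemma F2_int (z : int) : (z%:~R == 0 :> 'F_2) = (2%:Z %| z)%Z.
Proof.
have ch : 2%N \in [pchar 'F_2] by exact: pchar_Fp.
case: z => n; first by rewrite -pmulrn dvdzE /= (dvdn_pcharf ch).
by rewrite NegzE mulrNz oppr_eq0 -pmulrn dvdzE abszN /= (dvdn_pcharf ch).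
Qed.

Lemma F2_neq0 (x : 'F_2) : x != 0 -> x = 1.
Proof. by case: x => -[|[|m]] h //= _; apply: val_inj. Qed.

Lemma F2_opp (x : 'F_2) : - x = x.
Proof.
by have [->|/F2_neq0 ->] := eqVneq x 0; rewrite ?oppr0 //; apply: val_inj.
Qed.

Definition flow (c : {ffun E -> int}) : rel V := fun x y =>
  [exists e, (0 < c e) && (src e == x) && (tgt e == y) ||
             (c e < 0) && (tgt e == x) && (src e == y)].

(** Simplicity keeps the edge added at each step off the rest of the path, so that no
    edge is used twice. *)
Lemma subflow (c : {ffun E -> int}) x p : (forall e, `|c e| <= 1) ->
  path (flow c) x p -> uniq (x :: p) -> exists n : {ffun E -> int},
  [/\ forall e, n e = 0 \/ n e = c e,
      forall e, n e != 0 -> (src e \in x :: p) && (tgt e \in x :: p) &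
      forall z, boundary n z = (z == last x p)%:R - (z == x)%:R].
Proof.
move=> c1; elim: p x => [|y p IH] x.
  exists 0; split=> [e|e|z]; rewrite ?ffunE ?eqxx //; first by left.
  by rewrite subrr !big1 ?subrr // => e _; rewrite ffunE.
rewrite [path _ _ _]/= [uniq _]/= => /andP[/existsP[e he] pp] /andP[xp up].
have [n [n0 ns bn]] := IH y pp up.
have xe : (src e == x) || (tgt e == x).
  by case/orP: he => /andP[/andP[_ ->]]; rewrite ?orbT.
have ne : n e = 0.
  apply/eqP; apply: contraNT xp => /ns /andP[h1 h2].
  by case/orP: xe => /eqP <-.
pose m : {ffun E -> int} := [ffun f => if f == e then c e else 0].
exists (n + m); split=> [f|f|z].
- rewrite !ffunE; case: eqP => [->|_]; first by rewrite ne add0r; right.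
  by rewrite addr0.
- rewrite !ffunE; have [-> _|_] := eqVneq f e; last first.
    by rewrite addr0 => /ns /andP[h1 h2]; rewrite 2!(in_cons x) h1 h2 !orbT.
  by case/orP: he => /andP[/andP[_ /eqP ->] /eqP ->]; rewrite !inE !eqxx !orbT.
- rewrite boundaryD bn.
  have -> : boundary m z = (z == y)%:R - (z == x)%:R.
    have -> : boundary m z = c e * boundary (edge_chain e) z.
      rewrite !ffunE mulrBr !mulr_sumr.
      congr (_ - _); apply: eq_bigr => f _; rewrite !ffunE;
        by rewrite mulr_natr; case: eqP.
    rewrite boundary_edge_chain; have := c1 e; rewrite ler_norml => /andP[c2 c3].
    case/orP: he => /andP[/andP[ce /eqP ->] /eqP ->].
      have -> : c e = 1 by lia.
      by rewrite mul1r.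
    have -> : c e = -1 by lia.
    by rewrite mulN1r opprB.
  by rewrite addrA subrK.
Qed.

(** All flow into such a set comes from inside the set. *)
Lemma flow_closed (c : {ffun E -> int}) (X : {set V}) :
  (forall x y, flow c x y -> y \in X -> x \in X) -> \sum_(v in X) boundary c v <= 0.
Proof.
move=> hX.
have := sum_by_parts c (fun v => (v \in X)%:R : int).
rewrite [X in _ = X -> _](_ : _ = \sum_(v in X) boundary c v); last first.
  rewrite [RHS]big_mkcond; apply: eq_bigr => v _.
  by case: (v \in X); rewrite ?mul0rz // intz.
move=> <-; apply: sumr_le0 => e _; rewrite mulrzz.
have [pos|neg|->] := ltgtP (c e) 0; last by rewrite mulr0.
  have := hX (tgt e) (src e); case: (src e \in X) => [-> //|_].
    by rewrite subrr mul0r.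
    by apply/existsP; exists e; rewrite pos !eqxx orbT.
  by rewrite subr0; case: (_ \in _); rewrite ?mul0r // mul1r ltW.
have := hX (src e) (tgt e); case: (tgt e \in X) => [-> //|_].
  by rewrite subrr mul0r.
  by apply/existsP; exists e; rewrite neg !eqxx.
by rewrite sub0r; case: (_ \in _); rewrite ?oppr0 ?mul0r // mulN1r oppr_le0 ltW.
Qed.

Section Gamma.
Variable gamma : H1 C 'F_2.

Definition lifts_gamma (c : {ffun E -> int}) :=
  forall e, (c e)%:~R = gamma e /\ `|c e| <= 1.

Definition imbalance (c : {ffun E -> int}) : nat := \sum_v `|boundary c v|%N.

Lemma boundary_even c v : lifts_gamma c -> (2%:Z %| boundary c v)%Z.
Proof.
move=> hc; rewrite -F2_int; apply/eqP; rewrite -(cycle_boundary gamma v) !ffunE.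
rewrite intrB !rmorph_sum /=.
by congr (_ - _); apply: eq_bigr => e _; rewrite (hc e).1.
Qed.

Lemma sum_boundary (c : {ffun E -> int}) : \sum_v boundary c v = 0.
Proof.
have := sum_by_parts c (fun=> 1 : int).
under [X in _ = X -> _]eq_bigr do rewrite intz.
by move=> <-; rewrite big1 // => e _; rewrite subrr mul0rz.
Qed.

(** Reversing a path from a deficient vertex to one with excess flow makes an
    orientation of an even subgraph more balanced. *)
Lemma rebalance c : lifts_gamma c -> (0 < imbalance c)%N ->
  exists2 c', lifts_gamma c' & (imbalance c' < imbalance c)%N.
Proof.
move=> hc imb.
have [v vpos] : exists v, 0 < boundary c v.
  apply/existsP; apply: contraTT imb => /existsPn h; rewrite -eqn0Ngt /imbalance.
  have := sum_boundary c => /eqP; rewrite -oppr_eq0 -sumrN psumr_eq0; last first.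
    by move=> v _; have := h v; rewrite -leNgt oppr_ge0.
  move=> /allP h0; rewrite big1 // => v _.
  by have := h0 v (mem_index_enum _); rewrite /= oppr_eq0 => /eqP ->.
have [u uneg uv] : exists2 u, boundary c u < 0 & connect (flow c) u v.
  pose X : {set V} := finset (fun u => connect (flow c) u v).
  have : [exists u, (u \in X) && (boundary c u < 0)].
    have [//|/existsPn h] := boolP [exists u, (u \in X) && (boundary c u < 0)].
    have : \sum_(u in X) boundary c u <= 0.
      apply: flow_closed => x y xy; rewrite !inE; exact/connect_trans/connect1.
    suff : 0 < \sum_(u in X) boundary c u by rewrite ltNge => /negbTE ->.
    rewrite (bigD1 v) /= ?inE //.
    apply: ltr_pwDl => //; apply: sumr_ge0 => u /andP[uX _].
    by have := h u; rewrite uX /= -leNgt.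
  by case/existsP=> u /andP[]; rewrite inE => h1 h2; exists u.
case/connectP: uv => p0 pp Ev.
case/shortenP: pp Ev => p pp up _ Ev {p0}.
have [n [n0 _ bn]] := subflow (fun e => (hc e).2) pp up.
have Ec e : (c - (n + n)) e = c e \/ (c - (n + n)) e = - c e.
  by rewrite !ffunE; case: (n0 e) => ->; [left|right]; ring.
exists (c - (n + n)).
  move=> e; have [h1 h2] := hc e; case: (Ec e) => ->; split=> //.
    by rewrite mulrNz h1 F2_opp.
  by rewrite normrN.
have b2 z : boundary (c - (n + n)) z = boundary c z - ((z == v)%:R - (z == u)%:R) *+ 2.
  by rewrite boundaryB boundaryD bn -Ev mulr2n.
have ev w := boundary_even w hc.
have uv : u != v by apply: contraTneq uneg => ->; rewrite -leNgt ltW.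
rewrite /imbalance (bigD1 v) //= (bigD1 u) //= [X in (_ < X)%N](bigD1 v) //= [X in (_ < _ + X)%N](bigD1 u) //=.
rewrite !addnA [X in (_ + X < _)%N](eq_bigr (fun w => `|boundary c w|%N)); last first.
  move=> w /andP[/negbTE wv /negbTE wu]; rewrite b2 wv wu subrr mul0rn subr0 //.
rewrite ltn_add2r !b2 !eqxx (negbTE uv) eq_sym (negbTE uv).
(* Moving two units between even balances of opposite signs shrinks both. *)
have := ev u; have := ev v; move: vpos uneg.
move: (boundary c v) (boundary c u) => a b a0 b0 /dvdzP[k ka] /dvdzP[l lb].
lia.
Qed.

(** An even subgraph has an Eulerian orientation: start from any orientation and
    rebalance. *)
Lemma simple_rep_ex : exists c : H1 C int, simple_rep gamma c.
Proof.
have main n c : lifts_gamma c -> (imbalance c <= n)%N ->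
    exists2 c', lifts_gamma c' & imbalance c' = 0%N.
  elim: n c => [|n IH] c hc; first by rewrite leqn0 => /eqP c0; exists c.
  have [/eqP c0 _|c0 cn] := boolP (imbalance c == 0%N); first by exists c.
  have [|c' hc' lt'] := rebalance hc; first by rewrite lt0n.
  by apply: (IH c' hc'); rewrite -ltnS (leq_trans lt').
pose c0 : {ffun E -> int} := [ffun e => if gamma e != 0 then 1 else 0].
have h0 : lifts_gamma c0.
  by move=> e; rewrite ffunE; have [->|/F2_neq0 ->] := eqVneq (gamma e) 0.
have [c hc /eqP] := main _ c0 h0 (leqnn _).
rewrite sum_nat_eq0 => /forallP b0.
have [c' hc'] := mk_cycle (fun v => eqP (etrans (esym (absz_eq0 _)) (b0 v))).
by exists c' => e; rewrite hc'.
Qed.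

Lemma simple_repP : simple_rep gamma (xget 0 (simple_rep gamma)).
Proof.
have [c hc] := simple_rep_ex.
by have := @xgetPex _ 0 (simple_rep gamma); apply; exists c.
Qed.

End Gamma.
End EulerOrientation.

(** * The distance to an even subgraph *)

Section Distance.
Variables (R : realType) (C : tropCurve R).
Local Notation V := (vert C).
Local Notation E := (edge C).
Local Notation len := (@len R C).
Variable gamma : H1 C 'F_2.
Local Notation S := (Defs.support gamma).
Local Notation d := (dist_gamma gamma).

Lemma path_length_cons (e : E) x y s :
  (path_length ((e, x, y) :: s) = `|y - x| + path_length s)%E.
Proof. by rewrite /path_length big_cons. Qed.

Lemma path_length_ge0 (s : cpath C) : (0 <= path_length s)%E.
Proof. by apply: sume_ge0 => -[[e x] y] _; apply: abse_ge0. Qed.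

Lemma dist_le (p q : Point C) s : S q -> is_path p s q -> (d p <= path_length s)%E.
Proof. by move=> Sq h; apply: ereal_inf_lbound; exists s => //; exists q. Qed.

Lemma dist_ge (p : Point C) m :
  (forall s q, S q -> is_path p s q -> (m <= path_length s)%E) -> (m <= d p)%E.
Proof. by move=> h; apply: le_ereal_inf_tmp => _ [s [q Sq hs] <-]; apply: h Sq hs. Qed.

Lemma dist_ge0 p : (0 <= d p)%E.
Proof. by apply: dist_ge => s q _ _; apply: path_length_ge0. Qed.

Lemma dist_support p : S p -> d p = 0%E.
Proof.
move=> Sp; apply/eqP; rewrite eq_le dist_ge0 andbT.
by have := @dist_le p p [::] Sp erefl; rewrite /path_length big_nil.
Qed.

Lemma dist_step (e : E) (x y : R) : (lo e <= x%:E <= hi e)%E -> (lo e <= y%:E <= hi e)%E ->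
  (d (epoint e x%:E) <= `|y - x|%:E + d (epoint e y%:E))%E.
Proof.
move=> hx hy; rewrite -leeBlDl //; apply: dist_ge => s q Sq hs.
rewrite leeBlDl //; have := @dist_le (epoint e x%:E) q ((e, x%:E, y%:E) :: s) Sq.
by rewrite path_length_cons -EFinB /=; apply.
Qed.

(** Along a path a 1-Lipschitz function drops by at most the length of the path. *)
Lemma dist_max (h : Point C -> \bar R) :
  (forall q, S q -> (h q <= 0)%E) ->
  (forall e x y, (lo e <= x <= hi e)%E -> (lo e <= y <= hi e)%E ->
     (h (epoint e x) <= `|y - x| + h (epoint e y))%E) ->
  forall p, (h p <= d p)%E.
Proof.
move=> h0 hL p; apply: dist_ge => s q Sq; elim: s p => [|[[e x] y] s IH] p /=.
  by move=> ->; rewrite /path_length big_nil h0.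
case=> -> hx hy hs; rewrite path_length_cons.
by apply: le_trans (hL e x y hx hy) _; rewrite leeD2l // IH.
Qed.

Lemma gamma_leaf e : gamma e != 0 -> ~~ leaf e.
Proof. by apply: contra => /leaf_cycle ->. Qed.

Lemma support_ends e : gamma e != 0 -> S (inl (src e)) /\ S (inl (tgt e)).
Proof.
move=> ge; split.
  by exists e, (lo e); rewrite lo_range epoint_lo.
by exists e, (hi e); rewrite hi_range epoint_hi.
Qed.

Hypothesis gamma0 : gamma != 0.

Lemma gamma_edge : exists e, gamma e != 0.
Proof.
apply/existsP; apply: contraTT gamma0 => /existsPn h; rewrite negbK.
by apply/eqP/H1_eq => e; rewrite H10; have := h e; rewrite negbK => /eqP.
Qed.

(** Such an edge would be the whole curve, which has no cycle. *)
Lemma no_line (e : E) : lo e = -oo%E -> hi e = +oo%E -> False.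
Proof.
move=> l h; have s1 := leaf_lo l; have t1 := leaf_hi h.
have only (f : E * bool) : hend f = src e \/ hend f = tgt e -> f.1 = e.
  case=> hf; first by have -> := @val1_edge R C (e, true) f s1 hf.
  by have -> := @val1_edge R C (e, false) f t1 hf.
have [f gf] := gamma_edge.
suff : f = e.
  by move=> Ef; move: (gamma_leaf gf); rewrite Ef /leaf l eqxx.
have /connectP[p] := graph_connected (src e) (src f).
have : src e = src e \/ src e = tgt e by left.
move: {1 3 4 5}(src e) => x; elim: p x => [|y p IH] x hx /=.
  by move=> _ Ef; have := only (f, true); rewrite /hend /= Ef; apply.
case/andP=> /existsP[k hk] /IH{}IH; apply: IH.
case/orP: hk => /andP[/eqP Ex /eqP Ey].
  have Ek : k = e by have := only (k, true); rewrite /hend /= Ex; apply.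
  by rewrite -Ey Ek; right.
have Ek : k = e by have := only (k, false); rewrite /hend /= Ey; apply.
by rewrite -Ex Ek; left.
Qed.

Lemma finite_edge_ends (e : E) : vvalence (src e) != 1%N -> vvalence (tgt e) != 1%N -> ~~ leaf e.
Proof. by rewrite /leaf lo_infinite hi_infinite => /negbTE -> /negbTE ->. Qed.

Lemma dist_step_edge e : ~~ leaf e ->
  (d (inl (src e)) <= (len e)%:E + d (inl (tgt e)))%E /\
  (d (inl (tgt e)) <= (len e)%:E + d (inl (src e)))%E.
Proof.
case/finite_edge=> a [b [Ea Eb ab El]].
have ra : (lo e <= a%:E <= hi e)%E by rewrite -Ea lo_range.
have rb : (lo e <= b%:E <= hi e)%E by rewrite -Eb hi_range.
have E1 : epoint e a%:E = inl (src e) by rewrite -Ea epoint_lo.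
have E2 : epoint e b%:E = inl (tgt e) by rewrite -Eb epoint_hi.
have := dist_step ra rb; have := dist_step rb ra; rewrite E1 E2 El.
by rewrite distrC gtr0_norm ?subr_gt0.
Qed.

(** Finiteness of the distance spreads along the edges; a vertex at infinity passes
    it on from its neighbour. *)
Lemma dist_fin v : vvalence v != 1%N -> d (inl v) \is a fin_num.
Proof.
have [f gf] := gamma_edge.
(* The invariant of the induction; at a vertex at infinity it speaks of the
   neighbour. *)
pose a v := if vvalence v != 1%N then (d (inl v) < +oo)%E else
  [exists e, ((src e == v) && (vvalence (tgt e) != 1%N) && (d (inl (tgt e)) < +oo)%E) ||
             ((tgt e == v) && (vvalence (src e) != 1%N) && (d (inl (src e)) < +oo)%E)].
suff : a v by rewrite /a => + v1; rewrite v1 => h; rewrite ge0_fin_numE ?dist_ge0.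
have /connectP[p] := graph_connected (src f) v.
have step x y e : src e = x -> tgt e = y -> (a x -> a y) /\ (a y -> a x).
  move=> Ex Ey; rewrite /a.
  have [x1|x1] := boolP (vvalence x != 1%N); have [y1|y1] := boolP (vvalence y != 1%N).
  - have le : ~~ leaf e by apply: finite_edge_ends; rewrite ?Ex ?Ey.
    have [] := dist_step_edge le; rewrite Ex Ey => h1 h2.
    split=> h; [apply: le_lt_trans h2 _|apply: le_lt_trans h1 _];
      by rewrite lte_add_pinfty // ltry.
  - split=> [h|].
      by apply/existsP; exists e; rewrite Ex Ey eqxx x1 h orbT.
    case/existsP=> k; move: y1; rewrite negbK => /eqP y1 /orP[] /andP[/andP[/eqP Ek k1] hk].
      have := @val1_edge R C (e, false) (k, true); rewrite /hend /= Ey Ek => /(_ y1 erefl) //.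
    have := @val1_edge R C (e, false) (k, false); rewrite /hend /= Ey Ek => /(_ y1 erefl) [ke].
    by rewrite -Ex -ke.
  - split=> [|h]; last first.
      by apply/existsP; exists e; rewrite Ex Ey eqxx y1 h.
    case/existsP=> k; move: x1; rewrite negbK => /eqP x1 /orP[] /andP[/andP[/eqP Ek k1] hk].
      have := @val1_edge R C (e, true) (k, true); rewrite /hend /= Ex Ek => /(_ x1 erefl) [ke].
      by rewrite -Ey -ke.
    have := @val1_edge R C (e, true) (k, false); rewrite /hend /= Ex Ek => /(_ x1 erefl) //.
  - exfalso; apply: (@no_line e); apply/eqP.
      by rewrite lo_infinite Ex; move: x1; rewrite negbK.
    by rewrite hi_infinite Ey; move: y1; rewrite negbK.
have : a (src f).
  rewrite /a; have := gamma_leaf gf; rewrite /leaf lo_infinite negb_or => /andP[-> _].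
  by rewrite dist_support ?ltry //; have [] := support_ends gf.
elim: p (src f) => [|y p IH] x ax /=; first by move=> _ ->.
case/andP=> /existsP[e he] hp; apply: IH hp.
case/orP: he => /andP[/eqP Ex /eqP Ey]; first by apply: (step _ _ _ Ex Ey).1.
exact: (step _ _ _ Ex Ey).2.
Qed.

(** The largest 1-Lipschitz extension of the vertex values [H] to an edge; on the
    support it is 0. *)
Definition cone (H : V -> R) (e : E) (y : \bar R) : \bar R :=
  if gamma e != 0 then 0%E
  else if hi e == +oo%E then ((H (src e))%:E + (y - lo e))%E
  else if lo e == -oo%E then ((H (tgt e))%:E + (hi e - y))%E
  else (Num.min (H (src e) + (fine y - fine (lo e))) (H (tgt e) + (fine (hi e) - fine y)))%:E.

Definition cone_point (H : V -> R) (p : Point C) : \bar R :=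
  match p with
  | inl v => if vvalence v == 1%N then +oo%E else (H v)%:E
  | inr u => cone H (val u).1 (val u).2%:E
  end.

Definition admissible (H : V -> R) := forall e, ~~ leaf e ->
  [/\ H (src e) <= H (tgt e) + len e, H (tgt e) <= H (src e) + len e &
      gamma e != 0 -> H (src e) = 0 /\ H (tgt e) = 0].

Lemma cone_pointE H e y : admissible H -> (lo e <= y <= hi e)%E ->
  cone_point H (epoint e y) = cone H e y.
Proof.
move=> aH hy; have ry := hy; have /andP[ly yh] := hy.
have [yl|{}ly] := leP y (lo e).
  have -> : y = lo e by apply/eqP; rewrite eq_le yl ly.
  rewrite epoint_lo //= /cone -lo_infinite.
  have [ge|ge] := boolP (gamma e != 0).
    have le := gamma_leaf ge; have [_ _ /(_ ge)[-> _]] := aH e le.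
    by move: le; rewrite /leaf; case: eqP.
  have [h1|h1] := eqVneq (hi e) +oo%E; have [l1|l1] := eqVneq (lo e) -oo%E.
  - by case: (no_line l1 h1).
  - by case: (lo e) (lo_lt_hi e) l1 => [a| |] //; rewrite ?h1 // -EFinB subrr adde0.
  - rewrite l1; case: (hi e) (lo_lt_hi e) h1 => [b| |] //; by rewrite l1.
  - have le : ~~ leaf e by rewrite /leaf (negbTE l1) (negbTE h1).
    have [h _ _] := aH e le; have [a [b [Ea Eb ab El]]] := finite_edge le.
    rewrite subrr addr0; congr (_%:E); apply/esym/min_idPl.
    by apply: le_trans h _; rewrite El Ea Eb.
have [hy'|{}yh] := leP (hi e) y.
  have -> : y = hi e by apply/eqP; rewrite eq_le yh hy'.
  rewrite epoint_hi //= /cone -hi_infinite.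
  have [ge|ge] := boolP (gamma e != 0).
    have le := gamma_leaf ge; have [_ _ /(_ ge)[_ ->]] := aH e le.
    by move: le; rewrite /leaf orbC; case: eqP.
  have [h1|h1] := eqVneq (hi e) +oo%E; have [l1|l1] := eqVneq (lo e) -oo%E.
  - by case: (no_line l1 h1).
  - by rewrite h1; case: (lo e) (lo_lt_hi e) l1 => [a| |] //; rewrite h1.
  - by case: (hi e) (lo_lt_hi e) h1 => [b| |] //; rewrite ?l1 // -EFinB subrr adde0.
  - have le : ~~ leaf e by rewrite /leaf (negbTE l1) (negbTE h1).
    have [_ h _] := aH e le; have [a [b [Ea Eb ab El]]] := finite_edge le.
    rewrite subrr addr0; congr (_%:E); apply/esym/min_idPr.
    by apply: le_trans h _; rewrite El Ea Eb.
have [|r Er] := @fin_point R C e y; first by rewrite ly yh.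
rewrite Er in ly yh *; have hz : (lo e < r%:E < hi e)%E by rewrite ly.
by rewrite (epoint_in hz).
Qed.

Lemma cone_Lipschitz H e x y : (lo e <= x <= hi e)%E -> (lo e <= y <= hi e)%E ->
  (cone H e x <= `|y - x| + cone H e y)%E.
Proof.
move=> hx hy; rewrite /cone; case: ifP => ge; first by rewrite adde0 abse_ge0.
have nrm (a b : R) : b - a <= `|b - a| /\ a - b <= `|b - a|.
  by rewrite ler_norm -normrN opprB ler_norm.
have [h1|h1] := eqVneq (hi e) +oo%E; have [l1|l1] := eqVneq (lo e) -oo%E.
- by case: (no_line l1 h1).
- have [l El] : exists l, lo e = l%:E.
    by case: (lo e) (lo_lt_hi e) l1 => [a| |] //; [exists a|rewrite h1].
  move: hx hy; rewrite El h1; case: x => [x| |] //; case: y => [y| |] //=; rewrite ?leey //.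
  by move=> _ _; rewrite -!EFinD lee_fin; have [] := nrm x y; lra.
- have [h Eh] : exists h, hi e = h%:E.
    by case: (hi e) (lo_lt_hi e) h1 => [a| |] //; [exists a|rewrite l1].
  move: hx hy; rewrite Eh l1; case: x => [x| |] //; case: y => [y| |] //=; rewrite ?leey //.
  by move=> _ _; rewrite -!EFinD lee_fin; have [] := nrm x y; lra.
- have le : ~~ leaf e by rewrite /leaf (negbTE l1) (negbTE h1).
  have [x' ->] := coord_finite le hx; have [y' ->] := coord_finite le hy.
  rewrite -EFinB /= lee_fin -lerBlDl le_min /=.
  have [n1 n2] := nrm x' y'.
  by apply/andP; split; rewrite lerBlDl ge_min; apply/orP; [left|right]; lra.
Qed.

Lemma cone_le_dist H : admissible H -> forall p, (cone_point H p <= d p)%E.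
Proof.
move=> aH; apply: dist_max => [q [e [x [ge hx ->]]]|e x y hx hy].
  by rewrite cone_pointE // /cone ge.
by rewrite !cone_pointE //; apply: cone_Lipschitz.
Qed.

Definition vert_dist (v : V) : R := fine (d (inl v)).

Lemma vert_distE v : vvalence v != 1%N -> d (inl v) = (vert_dist v)%:E.
Proof. by move=> h; rewrite fineK // dist_fin. Qed.

Lemma nonleaf_ends (e : E) : ~~ leaf e -> vvalence (src e) != 1%N /\ vvalence (tgt e) != 1%N.
Proof. by rewrite /leaf lo_infinite hi_infinite negb_or => /andP. Qed.

Lemma vert_dist_admissible : admissible vert_dist.
Proof.
move=> e le; have [s1 t1] := nonleaf_ends le.
have [] := dist_step_edge le; rewrite !vert_distE // -!EFinD !lee_fin => h1 h2.
split; [by rewrite addrC|by rewrite addrC|].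
by move=> ge; have [h3 h4] := support_ends ge; rewrite /vert_dist !dist_support.
Qed.

(** Paths through the ends of the edge bound the distance from above, the maximality
    of the distance bounds it from below. *)
Lemma dist_edge e y : (lo e <= y <= hi e)%E -> d (epoint e y) = cone vert_dist e y.
Proof.
move=> hy; apply/eqP; rewrite eq_le; apply/andP; split; last first.
  by rewrite -cone_pointE //; [apply: cone_le_dist; exact: vert_dist_admissible|exact: vert_dist_admissible].
rewrite /cone; case: ifP => ge.
  by rewrite dist_support //; exists e, y.
have [h1|h1] := eqVneq (hi e) +oo%E; have [l1|l1] := eqVneq (lo e) -oo%E.
- by case: (no_line l1 h1).
- have [l El] : exists l, lo e = l%:E.
    by case: (lo e) (lo_lt_hi e) l1 => [a| |] //; [exists a|rewrite h1].
  have rl : (lo e <= l%:E <= hi e)%E by rewrite -El lo_range.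
  case: y hy => [y| |] hy; rewrite ?El ?leey //; last by move: hy; rewrite El.
  have E1 : epoint e l%:E = inl (src e) by rewrite -El epoint_lo.
  have := dist_step hy rl; rewrite E1.
  have ly : l <= y by case/andP: hy; rewrite El lee_fin.
  rewrite vert_distE; last by rewrite -lo_infinite.
  by rewrite distrC ger0_norm ?subr_ge0 // addeC.
- have [h Eh] : exists h, hi e = h%:E.
    by case: (hi e) (lo_lt_hi e) h1 => [a| |] //; [exists a|rewrite l1].
  have rh : (lo e <= h%:E <= hi e)%E by rewrite -Eh hi_range.
  case: y hy => [y| |] hy; rewrite ?Eh ?leey //; first last.
    by move: hy; rewrite Eh leye_eq andbF.
  have E1 : epoint e h%:E = inl (tgt e) by rewrite -Eh epoint_hi.
  have := dist_step hy rh; rewrite E1.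
  have yh : y <= h by case/andP: hy; rewrite Eh lee_fin.
  rewrite vert_distE; last by rewrite -hi_infinite.
  by rewrite ger0_norm ?subr_ge0 // addeC.
- have le : ~~ leaf e by rewrite /leaf (negbTE l1) (negbTE h1).
  have [s1 t1] := nonleaf_ends le.
  have [a [b [Ea Eb ab El]]] := finite_edge le.
  have [y' Ey] := coord_finite le hy; rewrite Ey in hy *.
  have ra : (lo e <= a%:E <= hi e)%E by rewrite -Ea lo_range.
  have rb : (lo e <= b%:E <= hi e)%E by rewrite -Eb hi_range.
  have E1 : epoint e a%:E = inl (src e) by rewrite -Ea epoint_lo.
  have E2 : epoint e b%:E = inl (tgt e) by rewrite -Eb epoint_hi.
  have := dist_step hy ra; have := dist_step hy rb; rewrite E1 E2 !vert_distE //.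
  have /andP[h2 h3] : a <= y' <= b by move: hy; rewrite Ea Eb !lee_fin.
  rewrite -!EFinD ger0_norm ?subr_ge0 // distrC ger0_norm ?subr_ge0 // Ea Eb /= => i1 i2.
  rewrite EFin_min le_min; apply/andP; split.
    by rewrite addrC.
  by rewrite addrC.
Qed.

Lemma small_pos (T : eqType) (r : seq T) (F : T -> R) : (forall i, i \in r -> 0 < F i) ->
  exists2 z, 0 < z & forall i, i \in r -> z <= F i.
Proof.
elim: r => [|i r IH] h; first by exists 1.
have [|z z0 hz] := IH; first by move=> j jr; apply: h; rewrite inE jr orbT.
exists (Num.min z (F i)); first by rewrite lt_min z0 h ?mem_head.
by move=> j; rewrite inE ge_min => /orP[/eqP ->|/hz ->] //; rewrite lexx orbT.
Qed.

(** Otherwise the value at [v] could be raised a little while the function stays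
    1-Lipschitz, against the maximality of the distance. *)
Lemma tight_edge v : vvalence v != 1%N ->
  (forall e, gamma e != 0 -> src e != v /\ tgt e != v) ->
  exists2 e, ~~ leaf e & (src e = v /\ vert_dist v = vert_dist (tgt e) + len e) \/
                         (tgt e = v /\ vert_dist v = vert_dist (src e) + len e).
Proof.
move=> v1 hv.
pose slackS e := vert_dist (tgt e) + len e - vert_dist v.
pose slackT e := vert_dist (src e) + len e - vert_dist v.
have [/existsP[e /andP[le he]]|/existsPn h] := boolP [exists e, ~~ leaf e &&
    (((src e == v) && (tgt e != v) && (slackS e == 0)) ||
     ((tgt e == v) && (src e != v) && (slackT e == 0)))].
  exists e => //; case/orP: he => /andP[/andP[/eqP Ev _]]; rewrite subr_eq0 => /eqP <-; by [left|right].
exfalso.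
have pos (e : E * bool) : ~~ leaf e.1 -> (if e.2 then src e.1 == v else tgt e.1 == v) ->
    (if e.2 then tgt e.1 != v else src e.1 != v) ->
    0 < (if e.2 then slackS e.1 else slackT e.1).
  case: e => e [] /= le h1 h2; have [a1 a2 _] := vert_dist_admissible le.
    have := h e; rewrite le h1 h2 /= negb_or => /andP[h3 _].
    by rewrite lt_neqAle eq_sym h3 /slackS -(eqP h1) subr_ge0.
  have := h e; rewrite le h1 h2 /= negb_or => /andP[_ h3].
  by rewrite lt_neqAle eq_sym h3 /slackT -(eqP h1) subr_ge0.
have [|z z0 hz] := @small_pos _ (enum [pred e : E * bool | ~~ leaf e.1 &&
    (if e.2 then src e.1 == v else tgt e.1 == v) && (if e.2 then tgt e.1 != v else src e.1 != v)])
    (fun e => if e.2 then slackS e.1 else slackT e.1).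
  by move=> e; rewrite mem_enum => /andP[/andP[h1 h2] h3]; apply: pos.
pose H u := vert_dist u + (if u == v then z else 0).
have aH : admissible H.
  move=> e le; have [a1 a2 a3] := vert_dist_admissible le; rewrite /H.
  split; last first.
  - move=> ge; have [/negbTE -> /negbTE ->] := hv e ge.
    by have [-> ->] := a3 ge; rewrite addr0.
  - have [Et|nt] := eqVneq (tgt e) v; have [Es|ns] := eqVneq (src e) v; try lra.
    have := hz (e, false); rewrite mem_enum inE /= le Et eqxx ns => /(_ isT).
    by rewrite /slackT; lra.
  - have [Et|nt] := eqVneq (tgt e) v; have [Es|ns] := eqVneq (src e) v; try lra.
    have := hz (e, true); rewrite mem_enum inE /= le Es eqxx nt => /(_ isT).
    by rewrite /slackS; lra.
have := cone_le_dist aH (inl v); rewrite /= (negbTE v1) vert_distE // lee_fin /H eqxx.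
lra.
Qed.

(** The point where the rise of the distance from the source of an edge meets its
    rise from the target. *)
Definition peak (e : E) : \bar R :=
  if hi e == +oo%E then hi e else if lo e == -oo%E then lo e
  else ((fine (lo e) + fine (hi e)) / 2 + (vert_dist (tgt e) - vert_dist (src e)) / 2)%:E.

Lemma peak_finite e (a b : R) : lo e = a%:E -> hi e = b%:E ->
  peak e = ((a + b) / 2 + (vert_dist (tgt e) - vert_dist (src e)) / 2)%:E.
Proof. by rewrite /peak => -> ->. Qed.

Lemma peak_range e : (lo e <= peak e <= hi e)%E.
Proof.
have [le|le] := boolP (leaf e).
  rewrite /peak; case: ifP => hh; first exact: hi_range.
  by move: le; rewrite /leaf hh orbF => ->; exact: lo_range.
have [h1 h2 _] := vert_dist_admissible le; have [a [b [Ea Eb ab El]]] := finite_edge le.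
by rewrite (peak_finite Ea Eb) Ea Eb !lee_fin; apply/andP; split; lra.
Qed.

Lemma dist_rise e x y : gamma e == 0 -> (lo e <= x)%E -> (x < y)%E -> (y <= peak e)%E ->
  affine_on (d \o epoint e) x y 1.
Proof.
move=> ge lx xy yp; have /andP[pl ph] := peak_range e.
have ran z : (x <= z <= y)%E -> (lo e <= z <= hi e)%E.
  by case/andP=> xz zy; rewrite (le_trans lx xz) (le_trans zy) // (le_trans yp).
have [h1|h1] := eqVneq (hi e) +oo%E; have [l1|l1] := eqVneq (lo e) -oo%E.
- by case: (no_line l1 h1).
- have [l El] : exists l, lo e = l%:E.
    by case: (lo e) (lo_lt_hi e) l1 => [a| |] //; [exists a|rewrite h1].
  exists (vert_dist (src e) - l) => z hz; rewrite /= dist_edge ?ran // /cone ge h1 eqxx El mul1e.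
  have := ran z hz; rewrite El; case: z {hz} => [z| |] // _.
  by rewrite -!EFinD; congr (_%:E); ring.
- have Ep : peak e = lo e by rewrite /peak (negbTE h1) l1 eqxx.
  by move: (lt_le_trans (le_lt_trans lx xy) yp); rewrite Ep ltxx.
- have le : ~~ leaf e by rewrite /leaf (negbTE l1) (negbTE h1).
  have [a [b [Ea Eb ab El]]] := finite_edge le.
  exists (vert_dist (src e) - a) => z hz; rewrite /= dist_edge ?ran // /cone ge (negbTE h1) (negbTE l1).
  have [z' Ez] := coord_finite le (ran z hz); move: hz; rewrite Ez => /andP[_ zy].
  have := le_trans zy yp; rewrite (peak_finite Ea Eb) lee_fin => h.
  rewrite mul1e -EFinD Ea Eb /= min_l; last by lra.
  by congr (_%:E); ring.
Qed.

Lemma dist_fall e x y : gamma e == 0 -> (peak e <= x)%E -> (x < y)%E -> (y <= hi e)%E ->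
  affine_on (d \o epoint e) x y (-1).
Proof.
move=> ge px xy yh; have /andP[pl ph] := peak_range e.
have ran z : (x <= z <= y)%E -> (lo e <= z <= hi e)%E.
  by case/andP=> xz zy; rewrite (le_trans zy yh) (le_trans pl) // (le_trans px).
have [h1|h1] := eqVneq (hi e) +oo%E; have [l1|l1] := eqVneq (lo e) -oo%E.
- by case: (no_line l1 h1).
- have Ep : peak e = hi e by rewrite /peak h1 eqxx.
  by move: (lt_le_trans (le_lt_trans px xy) yh); rewrite Ep ltxx.
- have [h Eh] : exists h, hi e = h%:E.
    by case: (hi e) (lo_lt_hi e) h1 => [a| |] //; [exists a|rewrite l1].
  exists (vert_dist (tgt e) + h) => z hz; rewrite /= dist_edge ?ran // /cone ge (negbTE h1) l1 eqxx Eh.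
  rewrite mulrN1z mulN1e.
  have := ran z hz; rewrite Eh; case: z {hz} => [z _| |_] //=.
  by rewrite -!EFinD; congr (_%:E); ring.
- have le : ~~ leaf e by rewrite /leaf (negbTE l1) (negbTE h1).
  have [a [b [Ea Eb ab El]]] := finite_edge le.
  exists (vert_dist (tgt e) + b) => z hz; rewrite /= dist_edge ?ran // /cone ge (negbTE h1) (negbTE l1).
  have [z' Ez] := coord_finite le (ran z hz); move: hz; rewrite Ez => /andP[zx _].
  have := le_trans px zx; rewrite (peak_finite Ea Eb) lee_fin => h.
  rewrite mulrN1z mulN1e -EFinN -EFinD Ea Eb /= min_r; last by lra.
  by congr (_%:E); ring.
Qed.

Lemma outgoing_peak (c : H1 C int) e a dir : gamma e == 0 ->
  (if dir then (lo e <= a < hi e)%E else (lo e < a <= hi e)%E) ->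
  outgoing gamma c (e, a, dir) = (if dir then a < peak e else peak e < a)%E.
Proof.
move=> ge ha; rewrite /outgoing ge /=; case: dir ha => /andP[la ah].
  have [ap|pa] := ltP a (peak e).
    by rewrite (slope_affine (d := true) ap _ (dist_rise ge la ap (lexx _))) // lexx ap.
  by rewrite (slope_affine (d := true) ah _ (dist_fall ge pa ah (lexx _))) // lexx ah.
have [ap|pa] := leP a (peak e).
  by rewrite (slope_affine (d := false) la _ (dist_rise ge (lexx _) la ap)) // lexx la.
by rewrite (slope_affine (d := false) pa _ (dist_fall ge (lexx _) pa ah)) // lexx pa.
Qed.

End Distance.

(** * The divisors of the orientations attached to an even subgraph *)

Section GammaDivisors.
Variables (R : realType) (C : tropCurve R).
Local Notation V := (vert C).
Local Notation E := (edge C).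
Local Notation len := (@len R C).
Variable gamma : H1 C 'F_2.
Hypothesis gamma0 : gamma != 0.
Variable c : H1 C int.
Hypothesis c_rep : simple_rep gamma c.

Lemma rep_sign e : gamma e != 0 -> c e = 1 \/ c e = -1.
Proof.
move=> ge; have [h1 h2] := c_rep e; move: h2; rewrite ler_norml => /andP[h2 h3].
have : c e != 0 by apply: contraNneq ge => c0; rewrite -h1 c0.
lia.
Qed.

Lemma rep_off e : gamma e = 0 -> c e = 0.
Proof.
move=> ge; have [/eqP h1 h2] := c_rep e; move: h1; rewrite ge F2_int => /dvdzP[k hk].
by move: h2; rewrite ler_norml hk => /andP[h2 h3]; lia.
Qed.

(** Off the support each end is credited with an outgoing direction and the peak,
    which no direction leaves, is debited; this is also right when the peak is an
    end, where the two cancel. *)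
Definition Kplus_edge (e : E) : Div C :=
  if gamma e != 0 then << 1 *g inl (if 0 < c e then src e else tgt e) >>
  else << 1 *g inl (src e) >> + << 1 *g inl (tgt e) >> - << 1 *g epoint e (peak gamma e) >>.

Definition Kplus_div : Div C := \sum_e Kplus_edge e - \sum_v << 1 *g inl v >>.

Lemma deg_Kplus_div : deg Kplus_div = (genus C)%:Z - 1.
Proof.
rewrite /Kplus_div degB deg_points deg_sum genusE addrK; congr (_ - _).
rewrite (eq_bigr (fun=> 1%:Z)) => [|e _]; first by rewrite sumr_const natz.
by rewrite /Kplus_edge; case: ifP => _; rewrite ?degB ?degD !degU.
Qed.

Lemma coeff_peak_vert e v :
  ((epoint e (peak gamma e) == inl v :> Point C)%:R : int) =
  (src e == v)%:R * (peak gamma e <= lo e)%E%:R + (tgt e == v)%:R * (hi e <= peak gamma e)%E%:R.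
Proof.
have [pl|lp] := leP (peak gamma e) (lo e).
  rewrite epoint_lo // [(hi e <= _)%E]leNgt (le_lt_trans pl (lo_lt_hi e)) mulr0 addr0 mulr1.
  by [].
rewrite mulr0 add0r; have [hp|ph] := leP (hi e) (peak gamma e).
  by rewrite epoint_hi // mulr1.
rewrite mulr0; case: eqP => // /eqP /epoint_eq_inl [].
  by rewrite leNgt lp.
by rewrite leNgt ph.
Qed.

Lemma countE (T : eqType) (a : pred T) r : (count a r)%:Z = \sum_(t <- r) ((a t)%:R : int).
Proof. by elim: r => [|t r IH]; rewrite ?big_nil // big_cons -IH /= PoszD natz. Qed.

Local Arguments outgoing : simpl never.

Lemma coeff_Kplus_div p : coeff p Kplus_div = (val_plus gamma c p)%:Z - 1.
Proof.
rewrite /val_plus countE /Kplus_div coeffB !coeff_sum.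
have [[v ->]|[e [x [hx ->]]]] := point_epoint p.
  rewrite sum_tangents_vert; congr (_ - _); last first.
    by under eq_bigr do rewrite coeffU mul1r; exact: sum_vert_one.
  rewrite [X in _ = X + _]big_mkcond [X in _ = _ + X]big_mkcond -big_split.
  apply: eq_bigr => e _ /=; rewrite /Kplus_edge.
  have vE (w : V) : (inl w == inl v :> Point C) = (w == v) by [].
  have [ge|/negPn/eqP ge] := boolP (gamma e != 0).
    rewrite coeffU mul1r vE /outgoing ge.
    case: (rep_sign ge) => -> /=; first by case: (src e == v); case: (tgt e == v).
    by case: (src e == v); case: (tgt e == v).
  rewrite coeffB coeffD !coeffU !mul1r !vE coeff_peak_vert.
  rewrite !outgoing_peak ?ge ?lexx ?lo_lt_hi //.
  rewrite !ltNge; case: (src e == v); case: (tgt e == v);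
    case: (peak gamma e <= lo e)%E; case: (hi e <= peak gamma e)%E => //.
rewrite [X in _ - X]big1 ?subr0 => [|v _]; last by rewrite coeffU epoint_in // mulr0.
rewrite sum_tangents_inr // (bigD1 e) //= big1 => [|f nf]; last first.
  rewrite /Kplus_edge; case: ifP => _; first by rewrite coeffU (epoint_in hx) mulr0.
  by rewrite coeffB coeffD !coeffU epoint_eq_in // (negbTE nf) !(epoint_in hx) !mulr0 subr0.
rewrite addr0 /Kplus_edge; have [ge|/negPn/eqP ge] := boolP (gamma e != 0).
  rewrite coeffU (epoint_in hx) mulr0 /outgoing ge.
  by case: (0 < c e).
have /andP[x1 x2] := hx.
rewrite !(@outgoing_peak _ _ gamma gamma0) ?ge ?x1 ?x2 ?ltW //.
rewrite coeffB coeffD !coeffU epoint_eq_in // eqxx !(epoint_in hx) /= !mulr0 !add0r mul1r.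
by case: ltgtP.
Qed.

Lemma KplusE : Kplus gamma c = Kplus_div.
Proof. by apply: fsum_coeff => p; rewrite coeff_Kplus_div. Qed.

Definition half_form (c : {ffun E -> int}) : OmegaDual C :=
  \sum_e edge_form e ((c e)%:~R * len e / 2).

(** Off the support, moving the chip from the midpoint of an edge to its peak
    costs half the increment of the distance, which cancels against the vertex
    potential; on the support each edge is oriented, at the cost of half its
    length. *)
Lemma AJ_Kplus p0 : AJ p0 Kplus_div = AJ p0 (K0_div C) - \pi_(Jac C) (half_form c).
Proof.
pose F v : R := vert_dist gamma v / 2.
have edgeE e : AJ p0 (Kplus_edge e) = mu p0 (mid_point e) -
    \pi_(Jac C) (edge_form e (F (tgt e) - F (src e)) + edge_form e ((c e)%:~R * len e / 2)).
  rewrite mu_midpoint /Kplus_edge; have [ge|/negPn/eqP ge] := boolP (gamma e != 0).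
    have le := gamma_leaf ge; have [_ _ /(_ ge)[Fs Ft]] := vert_dist_admissible gamma0 le.
    rewrite /F Fs Ft AJU mulr1z -addrA -opprD -jacD.
    case: (rep_sign ge) => -> /=.
      rewrite mu_src_tgt; congr (_ - \pi_(Jac C) _).
      by apply: od_eq => w; rewrite !(odD, edge_formE); field.
    rewrite -[LHS]subr0 -jac0; congr (_ - \pi_(Jac C) _).
    by apply: od_eq => w; rewrite !(odD, od0, edge_formE) mulrN1z; field.
  rewrite rep_off // AJB raddfD /= !AJU !mulr1z.
  have -> : mu p0 (epoint e (peak gamma e)) =
      mu p0 (inl (tgt e)) - \pi_(Jac C) (seg e (peak gamma e) (hi e)).
    rewrite -(epoint_hi (lexx (hi e))).
    by rewrite (mu_seg p0 (peak_range gamma0 e) (hi_range e)) addrK.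
  have abel (a b s : Jac C) : a - b + a - (a - s) = a - (b - s).
    by rewrite !opprB [s - a]addrC addrA addrK -addrA [- b + s]addrC.
  rewrite mu_src_tgt abel -[RHS]addrA -opprD -jacD -jacB.
  congr (_ - \pi_(Jac C) _); apply: od_eq => w.
  rewrite !(odB, odD) segE !edge_formE mulr0z mul0r mul0r mulr0 addr0.
  have [le|le] := boolP (leaf e); first by rewrite leaf_cycle // !mul0r subrr addr0.
  have [a [b [Ea Eb ab El]]] := finite_edge le.
  by rewrite (peak_finite _ Ea Eb) Eb El /F /=; field.
rewrite /Kplus_div AJB !AJ_sum (eq_bigr _ (fun e _ => edgeE e)) sumrB.
have -> : \sum_e \pi_(Jac C) (edge_form e (F (tgt e) - F (src e)) +
    edge_form e ((c e)%:~R * len e / 2)) = \pi_(Jac C) (half_form c).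
  by rewrite -jac_sum big_split edge_form_potential; congr (\pi_(Jac C) _); exact: add0r.
rewrite /K0_div AJB !AJ_sum addrAC; congr (_ - _ - _).
by apply: eq_bigr => e _; rewrite AJU mulr1z.
Qed.

(** On the support the cyclic orientation enters every vertex that it leaves; off
    the support some direction leads closer to it. *)
Lemma incoming p : exists2 t, t \in tangents p & ~~ outgoing gamma c t.
Proof.
have [[v ->]|[e [x [hx ->]]]] := point_epoint p; last first.
  have /andP[x1 x2] := hx.
  have [ge|/negPn/eqP ge] := boolP (gamma e != 0).
    exists (e, x%:E, ~~ (0 < c e)).
      by rewrite epoint_in /= !inE; case: (0 < c e); rewrite eqxx ?orbT.
    by rewrite /outgoing ge; case: (0 < c e).
  have [xp|px] := leP x%:E (peak gamma e).
    exists (e, x%:E, false); first by rewrite epoint_in /= !inE eqxx orbT.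
    by rewrite outgoing_peak ?ge // ?x1 ?ltW // -leNgt.
  exists (e, x%:E, true); first by rewrite epoint_in /= !inE eqxx.
  by rewrite outgoing_peak ?ge // ?x2 ?ltW // -leNgt ltW.
have in_lo e : src e = v -> (e, lo e, true) \in tangents (inl v).
  by move=> <-; apply: tangents_lo.
have in_hi e : tgt e = v -> (e, hi e, false) \in tangents (inl v).
  by move=> <-; apply: tangents_hi.
have [/existsP[e he]|/existsPn off] := boolP [exists e, (gamma e != 0) && ((src e == v) || (tgt e == v))].
  have [/existsP[k hk]|/existsPn allout] := boolP [exists k, (gamma k != 0) &&
      (((src k == v) && (c k < 0)) || ((tgt k == v) && (0 < c k)))].
    case/andP: hk => gk /orP[] /andP[/eqP kv ck].
      by exists (k, lo k, true); rewrite ?in_lo // /outgoing gk eqb_id -leNgt ltW.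
    by exists (k, hi k, false); rewrite ?in_hi // /outgoing gk ck.
  exfalso.
  have src_ge k : src k == v -> 0 <= c k.
    move=> kv; have [gk|/negPn/eqP gk] := boolP (gamma k != 0); last by rewrite rep_off.
    by have := allout k; rewrite gk kv /= negb_or -leNgt => /andP[].
  have tgt_le k : tgt k == v -> c k <= 0.
    move=> kv; have [gk|/negPn/eqP gk] := boolP (gamma k != 0); last by rewrite rep_off.
    by have := allout k; rewrite gk kv /= negb_or -leNgt => /andP[_].
  have sT : \sum_(k | tgt k == v) c k <= 0 by apply: sumr_le0.
  have sS : 0 <= \sum_(k | src k == v) c k by apply: sumr_ge0.
  have := cycle_boundary c v; rewrite ffunE => b0.
  have {}b0 : \sum_(k | tgt k == v) c k = \sum_(k | src k == v) c k by apply/eqP; rewrite -subr_eq0 b0.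
  case/andP: he => ge /orP[ev|ev].
    have : 0 < \sum_(k | src k == v) c k.
      rewrite (bigD1 e) //=; apply: ltr_pwDl.
        by have := src_ge e ev; case: (rep_sign ge) => ->.
      by apply: sumr_ge0 => k /andP[/src_ge].
    by rewrite -b0 ltNge sT.
  have : \sum_(k | tgt k == v) c k < 0.
    rewrite (bigD1 e) //= -oppr_gt0 opprD; apply: ltr_pwDl.
      by have := tgt_le e ev; case: (rep_sign ge) => ->.
    by rewrite oppr_ge0; apply: sumr_le0 => k /andP[/tgt_le].
  by rewrite b0 ltNge sS.
have gamma_off e : (src e == v) || (tgt e == v) -> gamma e = 0.
  by move=> ev; have := off e; rewrite ev andbT negbK => /eqP.
have [v1|v1] := eqVneq (vvalence v) 1%N.
  have : (0 < vvalence v)%N by rewrite v1.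
  case/card_gt0P=> -[e d]; rewrite inE /hend /=; case: d => /eqP ev.
    have l1 : lo e = -oo%E by apply/eqP; rewrite lo_infinite ev v1.
    exists (e, lo e, true); first exact: in_lo.
    rewrite outgoing_peak ?lexx ?lo_lt_hi ?gamma_off ?ev ?eqxx // /peak l1 eqxx.
    by case: eqP => [h1|_]; [case: (no_line gamma0 l1 h1) | rewrite ltxx].
  have h1 : hi e = +oo%E by apply/eqP; rewrite hi_infinite ev v1.
  exists (e, hi e, false); first exact: in_hi.
  by rewrite outgoing_peak ?lexx ?lo_lt_hi ?gamma_off ?ev ?eqxx ?orbT // /peak h1 eqxx ltxx.
have [|e le [[ev dist_e]|[ev dist_e]]] := tight_edge gamma0 v1.
- move=> e ge; split; apply: contra ge => /eqP ev; apply/eqP/gamma_off; by rewrite ev eqxx ?orbT.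
- have [a [b [Ea Eb ab El]]] := finite_edge le.
  exists (e, lo e, true); first exact: in_lo.
  rewrite outgoing_peak ?lexx ?lo_lt_hi ?gamma_off ?ev ?eqxx // (peak_finite _ Ea Eb) Ea lte_fin.
  by rewrite -leNgt ev dist_e El; lra.
have [a [b [Ea Eb ab El]]] := finite_edge le.
exists (e, hi e, false); first exact: in_hi.
rewrite outgoing_peak ?lexx ?lo_lt_hi ?gamma_off ?ev ?eqxx ?orbT // (peak_finite _ Ea Eb) Eb lte_fin.
by rewrite -leNgt ev dist_e El; lra.
Qed.

Lemma Kminus_effective : effective (canonical_div C - Kplus_div).
Proof.
move=> p; rewrite coeffB canonical_divE coeff_K_div coeff_Kplus_div /valence /val_plus.
have [t tp nt] := incoming p.
have : (0 < count (predC (outgoing gamma c)) (tangents p))%N.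
  by rewrite -has_count; apply/hasP; exists t.
have := count_predC (outgoing gamma c) (tangents p); lia.
Qed.

End GammaDivisors.

(** * Half-periods and theta characteristics *)

Section HalfPeriods.
Variables (R : realType) (C : tropCurve R).
Local Notation V := (vert C).
Local Notation E := (edge C).
Local Notation len := (@len R C).

Lemma half_formE n (w : OmegaZ C) : half_form n w = \sum_e (n e)%:~R * (w e)%:~R * len e / 2.
Proof.
rewrite /half_form od_sum; apply: eq_bigr => e _; rewrite edge_formE.
by rewrite [_ * (w e)%:~R]mulrC !mulrA.
Qed.

Lemma half_formD (n m : {ffun E -> int}) :
  half_form (n + m) = half_form n + half_form m :> OmegaDual C.
Proof.
apply: od_eq => w; rewrite odD !half_formE -big_split; apply: eq_bigr => e _ /=.
by rewrite ffunE intrD !mulrDl.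
Qed.

Lemma half_formN (n : {ffun E -> int}) : half_form (- n) = - half_form n :> OmegaDual C.
Proof.
apply: od_eq => w; rewrite odN !half_formE -sumrN; apply: eq_bigr => e _ /=.
by rewrite ffunE mulrNz !mulNr.
Qed.

Lemma half_form_double (n : {ffun E -> int}) : half_form n *+ 2 = chain_form n :> OmegaDual C.
Proof.
apply: od_eq => w; rewrite odMn mulr2n half_formE chain_formE -big_split.
by apply: eq_bigr => e _ /=; field.
Qed.

Lemma od_half (x y : OmegaDual C) : x *+ 2 = y *+ 2 -> x = y.
Proof.
move=> xy; apply: od_eq => w.
have : x w *+ 2 = y w *+ 2 by rewrite -!odMn xy.
by rewrite !mulr2n => h; lra.
Qed.

Lemma even_cycle (c : H1 C int) : (forall e, (c e)%:~R = 0 :> 'F_2) ->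
  exists b : H1 C int, c = b + b.
Proof.
move=> hc; pose b : {ffun E -> int} := [ffun e => (c e %/ 2)%Z].
have cb e : c e = b e + b e.
  by have /eqP := hc e; rewrite F2_int => /divzK h; rewrite ffunE; lia.
have b0 v : boundary b v = 0.
  have : boundary (b + b) v = 0.
    rewrite -(cycle_boundary c v); congr (boundary _ v).
    by apply/ffunP => e; rewrite cb ffunE.
  by rewrite boundaryD => /eqP; rewrite -mulr2n mulrn_eq0 /= => /eqP.
have [b' hb] := mk_cycle b0; exists b'.
by apply: H1_eq => e; rewrite H1D hb cb.
Qed.

Lemma half_form_even (c : H1 C int) : (forall e, (c e)%:~R = 0 :> 'F_2) ->
  half_form c \in @Lambda R C.
Proof.
case/even_cycle => b ->; suff -> : half_form (b + b) = chain_form b by exact: chain_form_Lambda.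
have -> : half_form (b + b) = half_form b + half_form b.
  by rewrite -half_formD.
by rewrite -mulr2n half_form_double.
Qed.

Lemma half_form_Lambda (c : H1 C int) : half_form c \in @Lambda R C ->
  forall e, (c e)%:~R = 0 :> 'F_2.
Proof.
case/LambdaP => b hb e; have : c = b + b.
  apply: chain_form_cycle_inj; rewrite -half_form_double hb.
  have -> : chain_form (b + b) = chain_form b + chain_form b by rewrite -chain_formD.
  by rewrite mulr2n.
move=> ->; rewrite H1D; apply/eqP; rewrite F2_int.
by apply/dvdzP; exists (b e); lia.
Qed.

Lemma half_periodsP (j : Jac C) : half_periods C j <-> j *+ 2 = 0.
Proof.
split=> [[x /= hx <-]|h].
  rewrite mulr2n -jacD -mulr2n -jac0; apply/jac_eqP.
  by rewrite subr0.
exists (repr j); last exact: jac_repr.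
suff :  repr j *+ 2 - 0 \in @Lambda R C by rewrite subr0.
by apply/jac_eqP; rewrite mulr2n jacD jac_repr jac0 -mulr2n.
Qed.

Definition lift_gamma (gamma : H1 C 'F_2) : H1 C int := xget 0 (simple_rep gamma).

Lemma lift_gammaE gamma e : (lift_gamma gamma e)%:~R = gamma e.
Proof. by have [] := simple_repP gamma e. Qed.

(** The sign is the one of [AJ_Kplus]; on points of order 2 it is immaterial. *)
Definition half_point (gamma : H1 C 'F_2) : Jac C :=
  - \pi_(Jac C) (half_form (lift_gamma gamma)).

(** Two integral lifts of a class mod 2 differ by twice a cycle. *)
Lemma half_pointE (gamma : H1 C 'F_2) (c : H1 C int) : (forall e, (c e)%:~R = gamma e) ->
  half_point gamma = - \pi_(Jac C) (half_form c).
Proof.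
move=> hc; congr (- _); apply/jac_eqP; rewrite -half_formN -half_formD.
apply: (@half_form_even (lift_gamma gamma - c)) => e.
by rewrite H1B intrB lift_gammaE hc subrr.
Qed.

Lemma half_pointD gamma delta :
  half_point (gamma + delta) = half_point gamma + half_point delta.
Proof.
rewrite (@half_pointE _ (lift_gamma gamma + lift_gamma delta)) => [|e].
  by rewrite /half_point -opprD -jacD -half_formD.
by rewrite !H1D intrD !lift_gammaE.
Qed.

Lemma half_point_double gamma : half_point gamma *+ 2 = 0.
Proof.
rewrite mulNrn mulr2n -jacD -mulr2n half_form_double.
apply/eqP; rewrite oppr_eq0 -jac0; apply/eqP/jac_eqP.
by rewrite subr0 chain_form_Lambda.
Qed.

Lemma half_point_inj : injective half_point.
Proof.
move=> gamma delta /oppr_inj /jac_eqP; rewrite -half_formN -half_formD => h.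
have {}h : half_form (lift_gamma gamma - lift_gamma delta) \in @Lambda R C by [].
apply: H1_eq => e; have := half_form_Lambda h e.
by rewrite H1B intrB !lift_gammaE => /eqP; rewrite subr_eq0 => /eqP.
Qed.

Lemma half_point_surj j : j *+ 2 = 0 -> exists gamma, half_point gamma = j.
Proof.
move/half_periodsP => [x /= /LambdaP[c hc] <-].
pose g : {ffun E -> 'F_2} := [ffun e => (c e)%:~R].
have g0 v : boundary g v = 0.
  transitivity ((boundary c v)%:~R : 'F_2); last by rewrite cycle_boundary.
  rewrite !ffunE intrB !rmorph_sum /=.
  by congr (_ - _); apply: eq_bigr => e _; rewrite ffunE.
have [gamma hg] := mk_cycle g0; exists gamma.
rewrite (@half_pointE _ (- c)) => [|e]; last by rewrite H1N mulrNz F2_opp hg ffunE.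
rewrite -jacN; congr (\pi_(Jac C) _); apply: od_half.
rewrite hc -half_form_double; congr (_ *+ 2).
have -> : half_form (- c) = - half_form c by rewrite -half_formN.
by rewrite opprK.
Qed.

Section Base.
Variable p0 : Point C.
Local Notation K := (Kgamma p0).

Lemma half_point0 : half_point 0 = 0.
Proof. by have := half_pointD 0 0; rewrite addr0 => /eqP; rewrite -subr_eq0 opprD addrA subrr sub0r oppr_eq0 => /eqP. Qed.

Lemma K_0 : K 0 = cls (K0_div C).
Proof. by rewrite /Kgamma eqxx K0_cls. Qed.

Lemma K_cls gamma : gamma != 0 -> K gamma = cls (Kplus_div gamma (lift_gamma gamma)).
Proof.
move=> g0; rewrite /Kgamma (negbTE g0) -/(lift_gamma gamma) KplusE //.
exact: simple_repP.
Qed.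

Lemma deg_K gamma : Pic_deg ((genus C)%:Z - 1) (K gamma).
Proof.
have [->|g0] := eqVneq gamma 0.
  by rewrite K_0; exists (K0_div C); rewrite // deg_K0_div genusE addrK.
by rewrite K_cls //; exists (Kplus_div gamma (lift_gamma gamma)); rewrite // deg_Kplus_div.
Qed.

Lemma phi_K gamma : phi p0 (K gamma) = AJ p0 (K0_div C) + half_point gamma.
Proof.
have [->|g0] := eqVneq gamma 0; first by rewrite K_0 phi_cls half_point0 addr0.
by rewrite K_cls // phi_cls AJ_Kplus //; exact: simple_repP.
Qed.

Lemma phi_K_K0 gamma : phi p0 (K gamma - K 0) = half_point gamma.
Proof. by rewrite phiB !phi_K half_point0 addr0 addrAC subrr add0r. Qed.

Lemma theta_charsP (x : Pic C) : theta_chars C x <->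
  Pic_deg ((genus C)%:Z - 1) x /\ phi p0 x *+ 2 = AJ p0 (K0_div C) *+ 2.
Proof.
split=> -[dx hx]; split=> //.
  by rewrite -AJ_canonical -phi_cls -hx !mulr2n phiD.
apply: (@phi_inj _ _ p0 (((genus C)%:Z - 1) *+ 2)).
- by rewrite !mulr2n; apply: Pic_degD.
- by rewrite -deg_canonical; apply: Pic_deg_cls.
- by rewrite phi_cls AJ_canonical -hx !mulr2n phiD.
Qed.

Lemma K_effective gamma :
  (exists2 D : Div C, effective D & cls D = K gamma) <-> gamma != 0.
Proof.
split=> [[D effD cD]|g0].
  by apply/eqP => g0; move: cD; rewrite g0 K_0; exact: K0_not_effective.
exists (canonical_div C - Kplus_div gamma (lift_gamma gamma)).
  exact: (Kminus_effective g0 (simple_repP gamma)).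
apply: (@phi_inj _ _ p0 ((genus C)%:Z - 1)); last 1 first.
- rewrite phi_K phi_cls AJB AJ_canonical AJ_Kplus //; last exact: simple_repP.
  rewrite -/(half_point gamma) mulr2n opprD addrA addrK; congr (_ + _).
  by apply/eqP; rewrite -subr_eq0 -opprD oppr_eq0 -mulr2n half_point_double.
- exists (canonical_div C - Kplus_div gamma (lift_gamma gamma)) => //.
  rewrite degB deg_canonical deg_Kplus_div; first by rewrite mulr2n addrK.
- exact: deg_K.
Qed.

End Base.
End HalfPeriods.

Theorem theorem7 (R : realType) (C : tropCurve R) (p0 : Point C) :
  let K : H1 C 'F_2 -> Pic C := Kgamma p0 in
  (* the map is a bijection onto the theta characteristics *)
  set_bij [set: H1 C 'F_2] (theta_chars C) K
  (* gamma |-> K_gamma - K_0 is a group isomorphism onto (1/2)Lambda/Lambda *)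
  /\ (forall gamma, Pic_deg 0 (K gamma - K 0))
  /\ {morph (fun gamma => phi p0 (K gamma - K 0)) :
        gamma delta / gamma + delta}
  /\ set_bij [set: H1 C 'F_2] (half_periods C)
       (fun gamma => phi p0 (K gamma - K 0))
  (* the theta characteristics form a torsor under (1/2)Lambda/Lambda *)
  /\ (forall x, theta_chars C x ->
        set_bij [set t : Pic C | Pic_deg 0 t /\ half_periods C (phi p0 t)]
          (theta_chars C) (fun t => x + t))
  (* only K_0 is not the class of an effective divisor *)
  /\ (forall gamma,
        (exists2 D : Div C, effective D & cls D = K gamma) <-> gamma != 0).
Proof.
move=> K; have degK := @deg_K R C p0; have phiK := @phi_K R C p0.
have theta := @theta_charsP R C p0.
have -> : (fun gamma => phi p0 (K gamma - K 0)) = @half_point R C.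
  by apply/funext => gamma; exact: phi_K_K0.
split; [|split; [|split; [|split; [|split]]]].
- split.
  + move=> gamma _; apply/theta; split; first exact: degK.
    by rewrite phiK mulrnDl half_point_double addr0.
  + move=> gamma delta _ _ Kgd; apply: half_point_inj.
    by move: (phiK gamma) (phiK delta); rewrite -/(K gamma) -/(K delta) Kgd => -> /addrI.
  + move=> x /theta[dx hx].
    have [|gamma hg] := @half_point_surj R C (phi p0 x - AJ p0 (K0_div C)).
      by rewrite mulrnBl hx subrr.
    exists gamma => //; apply: (phi_inj (p0 := p0) (degK gamma) dx).
    by rewrite phiK hg addrC subrK.
- by move=> gamma; rewrite -(subrr ((genus C)%:Z - 1)); apply: Pic_degB; apply: degK.
- exact: half_pointD.
- split.
  + by move=> gamma _; apply/half_periodsP; exact: half_point_double.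
  + by move=> gamma delta _ _; exact: half_point_inj.
  + by move=> j /half_periodsP/half_point_surj[gamma hg]; exists gamma.
- move=> x /theta[dx hx]; split.
  + move=> t [dt /half_periodsP ht]; apply/theta; split.
      by rewrite -[_ - 1]addr0; apply: Pic_degD.
    by rewrite phiD mulrnDl hx ht addr0.
  + by move=> t u _ _ /addrI.
  + move=> y /theta[dy hy]; exists (y - x); last by rewrite addrC subrK.
    split; first by rewrite -(subrr ((genus C)%:Z - 1)); apply: Pic_degB.
    by apply/half_periodsP; rewrite phiB mulrnBl hx hy subrr.
- exact: K_effective.
Qed.
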